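(* Let $N\ge1$ be an integer, $s\in(0,1)$, $N>2s$, $2_s^*=\frac{2N}{N-2s}$. Let $V\in C(\mathbb{R}^N,[0,+\infty))$ satisfy $\sup_{x\in\mathbb{R}^N}(1+|x|^\omega)V(x)<+\infty$ for some $\omega\in[0,+\infty)$, and let $p\in(p_*,2_s^* )$, where $$p_*=\begin{cases}2+\frac{2s}{N-2s}&\text{if }\omega\in(2s,+\infty),\\[1mm]2+\frac{\omega}{N+2s-\omega}&\text{if }\omega\in[0,2s].\end{cases}$$ Let $\varepsilon>0$ and let $u$ be a positive weak solution of $\varepsilon^{2s}(-\Delta)^su+Vu=u^{p-1}$ in $\mathbb{R}^N$. Then the following lower decay estimates hold for all $x\in\mathbb{R}^N$: (i) $u(x)\ge\frac{C_\varepsilon}{1+|x|^{N-2s}}$ if $\omega>(N-2s)(p-2)>2s$; (ii) $u(x)\ge\frac{C_{\varepsilon,\mu}}{1+|x|^\mu}$ for any $\mu>N-2s$, if $\omega\in(2s,(N-2s)(p-2)]$; (iii) $u(x)\ge\frac{C_\varepsilon}{1+|x|^{N+2s-\omega}}$ if $\omega\in[0,2s]$. Here $C_\varepsilon,C_{\varepsilon,\mu}>0$ are constants independent of $x$ (they may depend on $u$).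
   Context: Here $(-\Delta)^su(x)=2\,\mathrm{P.V.}\int_{\mathbb{R}^N}\frac{u(x)-u(y)}{|x-y|^{N+2s}}\,dy$. Define $$H^s_{V,\varepsilon}(\mathbb{R}^N)=\Big\{u\in L^{2_s^*}(\mathbb{R}^N):\iint_{\mathbb{R}^{2N}}\frac{|u(x)-u(y)|^2}{|x-y|^{N+2s}}\,dx\,dy+\int_{\mathbb{R}^N}V(x)u^2\,dx<\infty\Big\}.$$ A positive weak solution is a function $u\in H^s_{V,\varepsilon}(\mathbb{R}^N)$, $u>0$, such that for all $\varphi\in H^s_{V,\varepsilon}(\mathbb{R}^N)$ $$\varepsilon^{2s}\iint_{\mathbb{R}^{2N}}\frac{(u(x)-u(y))(\varphi(x)-\varphi(y))}{|x-y|^{N+2s}}\,dx\,dy+\int_{\mathbb{R}^N}Vu\varphi\,dx=\int_{\mathbb{R}^N}|u|^{p-2}u\varphi\,dx.$$ (Such a $u$ is known to be continuous and bounded, so the pointwise estimates refer to its continuous representative.) *)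

(* Defs.v *)
From HB Require Import structures.
From mathcomp Require Import all_boot all_order all_algebra.
From mathcomp Require Import all_classical all_reals all_analysis.

Set Implicit Arguments.
Unset Strict Implicit.
Unset Printing Implicit Defensive.

Import Order.TTheory GRing.Theory Num.Theory.
Import numFieldNormedType.Exports.

Local Open Scope classical_set_scope.
Local Open Scope ring_scope.

(* The product sigma-algebra on 'rV[R]_n, generated by the coordinates as the
   library does for n.-tuple T; it coincides with the Borel sigma-algebra. *)
Section measurable_rV.
Context {R : realType} (n : nat).

Definition rV_coord (i : 'I_n) (x : 'rV[R]_n) : R := x ord0 i.

Let rV0 : g_sigma_preimage rV_coord set0.
Proof. exact: sigma_algebra0. Qed.

Let rVC A : g_sigma_preimage rV_coord A -> g_sigma_preimage rV_coord (~` A).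
Proof. exact: sigma_algebraC. Qed.

Let rV_bigcup (F : _^nat) : (forall i, g_sigma_preimage rV_coord (F i)) ->
  g_sigma_preimage rV_coord (\bigcup_i (F i)).
Proof. exact: sigma_algebra_bigcup. Qed.

HB.instance Definition _ := @isMeasurable.Build default_measure_display
  'rV[R]_n (g_sigma_preimage rV_coord) rV0 rVC rV_bigcup.
End measurable_rV.

Section measurable_rV_lemmas.
Context {R : realType}.

Lemma measurable_rV_coord n (i : 'I_n) :
  measurable_fun [set: 'rV[R]_n] (@rV_coord R n i).
Proof.
move=> _ Y mY; rewrite setTI; apply: sub_sigma_algebra => /=.
rewrite -bigcup_seq/=; exists i => /=; first by rewrite mem_index_enum.
by exists Y => //; rewrite setTI.
Qed.

Lemma measurable_fun_rV d (T : measurableType d) n (f : T -> 'rV[R]_n) :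
  (forall i, measurable_fun [set: T] (rV_coord i \o f)) ->
  measurable_fun [set: T] f.
Proof.
move=> mf.
suff : g_sigma_preimage (fun i => @rV_coord R n i \o f) `<=` measurable.
  rewrite g_sigma_preimage_comp => prefS.
  by move=> _ A mA; apply: prefS; exists A.
apply: smallest_sub; first exact: sigma_algebra_measurable.
case: n => [|n] in f mf *; first by rewrite big_ord0.
rewrite -bigcup_mkord_ord; apply: bigcup_sub => i Ii.
by move=> A [B mB <-]; exact: mf.
Qed.

Definition rV_cons n (p : R * 'rV[R]_n) : 'rV[R]_n.+1 :=
  \row_i oapp (p.2 ord0) p.1 (unlift ord0 i).

Definition rV_uncons n (x : 'rV[R]_n.+1) : R * 'rV[R]_n :=
  (x ord0 ord0, \row_j x ord0 (lift ord0 j)).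

Lemma rV_consK n : cancel (@rV_cons n) (@rV_uncons n).
Proof.
move=> [a y]; rewrite /rV_uncons /rV_cons mxE unlift_none/=; congr pair.
by apply/rowP => j; rewrite !mxE liftK.
Qed.

Lemma measurable_rV_cons n :
  measurable_fun [set: R * 'rV[R]_n] (@rV_cons n).
Proof.
apply: measurable_fun_rV => i; case: (unliftP ord0 i) => [j|] ->.
  rewrite (_ : _ \o _ = rV_coord j \o snd).
    by apply: measurableT_comp => //; exact: measurable_rV_coord.
  by apply/funext => p; rewrite /rV_coord/= mxE liftK.
rewrite (_ : _ \o _ = fst)//.
by apply/funext => p; rewrite /rV_coord/= mxE unlift_none.
Qed.

Lemma measurable_rV_uncons n :
  measurable_fun [set: 'rV[R]_n.+1] (@rV_uncons n).
Proof.
apply: measurable_fun_pair; first exact: (@measurable_rV_coord n.+1).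
apply: measurable_fun_rV => i.
rewrite (_ : _ \o _ = rV_coord (lift ord0 i)); first exact: measurable_rV_coord.
by apply/funext => x; rewrite /rV_coord/= mxE.
Qed.

End measurable_rV_lemmas.

Section lebesgue_rV.
Context {R : realType}.
Local Open Scope ereal_scope.

Section cons.
Context n (mu : {sigma_finite_measure set 'rV[R]_n -> \bar R}).

Definition lebesgue_cons : set 'rV[R]_n.+1 -> \bar R :=
  pushforward (@lebesgue_measure R \x mu) (@rV_cons R n).

Let lebesgue_cons0 : lebesgue_cons set0 = 0.
Proof. by rewrite /lebesgue_cons/pushforward preimage_set0 measure0. Qed.

Let lebesgue_cons_ge0 A : 0 <= lebesgue_cons A.
Proof. by rewrite /lebesgue_cons/pushforward measure_ge0. Qed.

Let lebesgue_cons_additive : semi_sigma_additive lebesgue_cons.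
Proof.
move=> F mF tF mUF; rewrite /lebesgue_cons /pushforward preimage_bigcup.
have mcons X : measurable X -> measurable (@rV_cons R n @^-1` X).
  by move=> mX; rewrite -[X in measurable X]setTI; exact: measurable_rV_cons.
apply: measure_semi_sigma_additive.
- by move=> i; exact: mcons.
- apply/trivIsetP => /= i j _ _ ij; rewrite -preimage_setI.
  by move/trivIsetP : tF => /(_ _ _ _ _ ij) ->//; rewrite preimage_set0.
- by rewrite -preimage_bigcup; exact: mcons.
Qed.

HB.instance Definition _ := isMeasure.Build _ _ _ lebesgue_cons
  lebesgue_cons0 lebesgue_cons_ge0 lebesgue_cons_additive.

Let lebesgue_cons_sigma_finite : sigma_finite setT lebesgue_cons.
Proof.
have /sigma_finiteP[F [TF ndF Foo]] := sigma_finiteT (@lebesgue_measure R).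
have /sigma_finiteP[G [TG ndG Goo]] := sigma_finiteT mu.
exists (fun k => @rV_uncons R n @^-1` (F k `*` G k)).
  apply/esym/seteqP; split=> // x _.
  have [i _ Fi] : (\bigcup_i F i) (rV_uncons x).1 by rewrite -TF.
  have [j _ Gj] : (\bigcup_j G j) (rV_uncons x).2 by rewrite -TG.
  exists (maxn i j) => //; split => /=.
  - by move: Fi; exact/subsetPset/ndF/leq_maxl.
  - by move: Gj; exact/subsetPset/ndG/leq_maxr.
move=> k; have [? ?] := Foo k; have [? ?] := Goo k; split.
  rewrite -[X in measurable X]setTI; apply: measurable_rV_uncons => //.
  exact: measurableX.
rewrite /lebesgue_cons /pushforward -comp_preimage.
rewrite (_ : _ \o _ = id); last by apply/funext => p /=; rewrite rV_consK.
by rewrite /= product_measure1E// lte_mul_pinfty// ge0_fin_numE.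
Qed.

HB.instance Definition _ := Measure_isSigmaFinite.Build _ _ _ lebesgue_cons
  lebesgue_cons_sigma_finite.

End cons.

(* The n-fold product of the one-dimensional Lebesgue measure. *)
Fixpoint lebesgue_rV n : {sigma_finite_measure set 'rV[R]_n -> \bar R} :=
  match n with
  | 0 => \d_(0%R : 'rV[R]_0)
  | n.+1 => lebesgue_cons (lebesgue_rV n)
  end.

Lemma lebesgue_rV_box n (A : 'I_n -> set R) :
  (forall i, measurable (A i)) ->
  lebesgue_rV n [set x | forall i, A i (x ord0 i)] =
  \prod_(i < n) lebesgue_measure (A i).
Proof.
elim: n A => [|n IHn] A mA.
  by rewrite big_ord0 /= diracE mem_set//= => -[].
rewrite big_ord_recl -IHn//.
have mB : measurable [set y : 'rV[R]_n | forall i, A (lift ord0 i) (y ord0 i)].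
  rewrite (_ : mkset _ =
      \bigcap_(i in [set: 'I_n]) (rV_coord i @^-1` A (lift ord0 i))).
    apply: fin_bigcap_measurable => // i _.
    by rewrite -[X in measurable X]setTI; exact: measurable_rV_coord.
  by apply/seteqP; split => [x Ax i _|x Ax i]; [exact: Ax|exact: (Ax i)].
rewrite -product_measure1E//=; last exact: mA.
rewrite /lebesgue_cons /pushforward; congr (_ _).
apply/seteqP; split => -[a y] /=.
  move=> Aay; split=> [|i].
    by have := Aay ord0; rewrite mxE unlift_none.
  by have := Aay (lift ord0 i); rewrite mxE liftK.
move=> [Aa Ay] i; case: (unliftP ord0 i) => [j|] ->.
  by rewrite mxE liftK; exact: Ay.
by rewrite mxE unlift_none.
Qed.

End lebesgue_rV.

(* The norm `|x| of the library on 'rV[R]_n is the sup norm. *)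
Definition enorm {R : realType} n (x : 'rV[R]_n) : R :=
  Num.sqrt (\sum_(i < n) x ord0 i ^+ 2).

Section fractional_schroedinger.
Context {R : realType} {N : nat}.
Implicit Types (s p eps omega : R) (V u phi : 'rV[R]_N -> R).
Local Notation leb := (@lebesgue_rV R N).

Definition crit_exp s : R := 2 * N%:R / (N%:R - 2 * s).

Definition p_star s omega : R :=
  if 2 * s < omega then 2 + 2 * s / (N%:R - 2 * s)
  else 2 + omega / (N%:R + 2 * s - omega).

(* The integrand vanishes on the (negligible) diagonal since 0 / 0 = 0. *)
Definition gagliardo s u phi : \bar R :=
  (\int[leb \x leb]_z
    ((u z.1 - u z.2) * (phi z.1 - phi z.2) /
     enorm (z.1 - z.2) `^ (N%:R + 2 * s))%:E)%E.

Definition HsV s V : set ('rV[R]_N -> R) :=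
  [set u | u \in Lfun leb (crit_exp s)%:E /\
    (gagliardo s u u + \int[leb]_x (V x * u x ^+ 2)%:E < +oo)%E].

(* The equation is between extended reals.  For u and phi in HsV s V the left
   side is finite; the right one is infinite as soon as its integrand is not
   integrable (oo - oo = -oo), so the equation implies integrability. *)
Definition weak_solution eps s V p u : Prop :=
  HsV s V u /\
  forall phi, HsV s V phi ->
    ((eps `^ (2 * s))%:E * gagliardo s u phi +
       \int[leb]_x (V x * u x * phi x)%:E =
     \int[leb]_x (`|u x| `^ (p - 2) * u x * phi x)%:E)%E.

Definition positive_weak_solution eps s V p u : Prop :=
  weak_solution eps s V p u /\ {ae leb, forall x, 0 < u x}.

Definition continuous_representative u v : Prop :=
  continuous v /\ {ae leb, forall x, v x = u x}.

End fractional_schroedinger.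
Arguments crit_exp {R} N s.
Arguments p_star {R} N s omega.

(* Main.v *)
Require Import Defs.
From HB Require Import structures.
From mathcomp Require Import all_boot all_order all_algebra.
From mathcomp Require Import all_classical all_reals all_analysis.
From mathcomp Require Import measurable_realfun ring lra.

Set Implicit Arguments.
Unset Strict Implicit.
Unset Printing Implicit Defensive.

Import Order.TTheory GRing.Theory Num.Theory.
Import numFieldNormedType.Exports.

Local Open Scope classical_set_scope.
Local Open Scope ring_scope.

(** Write [E(f, g)] for the Gagliardo form and [B_r] for the balls centred at 0.
    The equation is used in two weakened forms, against nonnegative bounded test
    functions of bounded support built from [v] itself: [v] is a supersolution,
    [eps ^ (2 s) * E(v, phi) + \int V v phi >= 0], and where [V <= v ^ (p - 2)]
    even [E(v, phi) >= 0].  All estimates come from comparing [v] with the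
    paraboloid [eta x = max 0 (1 - |x - c| ^ 2 / r ^ 2)].  Its second differences
    are bounded below, so that [E(g, eta) <= C r ^ (- 2 s) \int_(B(c, r)) g] for
    all bounded [g >= 0] ([gagliardo_cutoff_le]).  This one-sided bound is the only
    computation with the singular kernel, and it has two consequences.

    The first is a barrier ([barrier]).  Test with [phi = (h eta - v)_+].  If [phi]
    does not vanish, then the mass [m] of [v] near the origin, at distance at most
    [L] from [c], acts on the contact set [phi > 0] through the tail of the kernel
    with intensity [m (r + L) ^ (- n - 2 s)], whereas the cutoff, together with a
    potential of size [r ^ (- 2 s)], counteracts with at most
    [C h r ^ (- 2 s)].  Hence [v c >= h] for [h] a small multiple of
    [m r ^ (2 s) (r + L) ^ (- n - 2 s)].  In particular [v] dominates a multiple of its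
    truncated mean over a ball of radius comparable with [|c|] if [V] is at most [|c| ^ (- 2 s)] around
    [c] ([barrier_ball_mass]).

    The second is a balance of flux ([level_flux_le]).  Test with
    [phi = (1 - v / k)_+ eta] and [c = 0].  If [v >= k] on a ball, then [v] sends a
    flux from there into the set [v <= k / 2].  Either the potential absorbs it
    outside the ball, or it is carried to the scale [r] of the cutoff, and then
    [\int_(B_r) min v k >= C r ^ (2 s)]: the mass of [|x| ^ (- (n - 2 s))], found
    without a fundamental solution.

    If [V] decays like [|x| ^ (- omega)] with [omega <= 2 s], the barrier is applied
    with [r ~ |c| ^ (omega / 2 s)], up to a constant the largest radius for which [V]
    is at most [r ^ (- 2 s)] on the ball ([lower_bound_of_slow_decay]).  If
    [omega > 2 s], then [v >= k] on [B_r] implies [v >= k t ^ (- mu)] on [B_(t r)]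
    for some [t] between 2 and a constant, for any given [mu > n - 2 s]
    ([growth_step]): either half of a larger ball lies above [k / 2] and the barrier
    concludes directly, or the flux is substantial, too large to be absorbed by a
    potential of size [r ^ (- omega)].  Iterating gives the decay [|x| ^ (- mu)]
    ([lower_bound_of_fast_decay]).  If moreover [(n - 2 s) (p - 2) < omega], a choice
    of [mu] with [mu (p - 2) < omega] shows that [V <= v ^ (p - 2)] far away.  Then
    nothing is absorbed any more, a flux through one fixed level reaches all scales, and
    the barrier turns the resulting mass [r ^ (2 s)] into the sharp decay
    [|x| ^ (- (n - 2 s))] ([lower_bound_of_reaction]). *)

(** * Affine changes of variables *)

Section affine1.
Context {R : realType}.
Local Open Scope ereal_scope.

Lemma measurable_affine1 (b a : R) :
  measurable_fun [set: R] (fun t => b + a * t)%R.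
Proof. by apply: measurable_funD => //; exact: measurable_funM. Qed.

(** The right-hand side is a measure in [A] that agrees with the left-hand side on
    half-open intervals. *)
Lemma lebesgue_measure_affine (b a : R) (A : set R) :
  (a != 0)%R -> measurable A ->
  lebesgue_measure A =
  (`|a|%R)%:E * lebesgue_measure ((fun t : R => b + a * t)%R @^-1` A).
Proof.
move=> a0 mA; have na0 : (0 <= `|a|)%R by [].
pose aff := (fun t => b + a * t)%R : measurableTypeR R -> measurableTypeR R.
pose mu1 := [the measure _ _ of pushforward lebesgue_measure aff].
pose mu := [the measure _ _ of mscale (NngNum na0) (mu1 (measurable_affine1 b a))].
suff : lebesgue_measure A = mu A by [].
apply: (@lebesgue_measure_unique R mu _ A mA) => X /ocitvP[->|[[c d]/= cd ->]].
  by rewrite !measure0.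
rewrite /mu /mscale /= /pushforward lebesgue_measure_itv /= lte_fin cd.
have [a_gt0|a_lt0|/eqP] := ltgtP a 0%R; last by rewrite (negbTE a0).
- rewrite (_ : _ @^-1` _ = `[((d - b) / a)%R, ((c - b) / a)%R[%classic).
    rewrite lebesgue_measure_itv /= lte_fin ltr_nM2r ?invr_lt0// ltrD2r cd.
    by rewrite -EFinD -EFinM ltr0_norm//; congr EFin; field.
  apply/seteqP; split => t /=; rewrite !in_itv/= /aff.
    by rewrite ler_ndivrMr// ltr_ndivlMr//; lra.
  by rewrite ler_ndivrMr// ltr_ndivlMr//; lra.
- rewrite (_ : _ @^-1` _ = `]((c - b) / a)%R, ((d - b) / a)%R]%classic).
    rewrite lebesgue_measure_itv /= lte_fin ltr_pM2r ?invr_gt0// ltrD2r cd.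
    by rewrite -EFinD -EFinM gtr0_norm//; congr EFin; field.
  apply/seteqP; split => t /=; rewrite !in_itv/= /aff.
    by rewrite ler_pdivlMr// ltr_pdivrMr//; lra.
  by rewrite ler_pdivlMr// ltr_pdivrMr//; lra.
Qed.

Lemma ge0_integral_affine1 (b a : R) (f : R -> \bar R) : (a != 0)%R ->
  measurable_fun [set: R] f -> (forall x, 0 <= f x) ->
  \int[lebesgue_measure]_x f (b + a * x)%R =
  (`|a|^-1%R)%:E * \int[lebesgue_measure]_x f x.
Proof.
move=> a0 mf f0; have na0 : (0 <= `|a|)%R by [].
pose aff := (fun t => b + a * t)%R : measurableTypeR R -> measurableTypeR R.
pose mu1 := [the measure _ _ of pushforward lebesgue_measure aff].
pose mu := [the measure _ _ of mscale (NngNum na0) (mu1 (measurable_affine1 b a))].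
rewrite [X in _ * X](_ : _ = \int[mu]_x f x); last first.
  apply: eq_measure_integral => A mA _.
  by rewrite /mu /mscale /=; exact: lebesgue_measure_affine.
rewrite ge0_integral_mscale//= /mu1 ge0_integral_pushforward//.
  rewrite preimage_setT muleA -EFinM mulVf ?normr_eq0// mul1e.
  by apply: eq_integral.
exact: measurable_affine1.
Qed.
End affine1.

Section affine_rV.
Context {R : realType}.
Implicit Types n : nat.

Lemma measurable_rV_affine n (b : 'rV[R]_n) (a : R) :
  measurable_fun [set: 'rV[R]_n] (fun x => b + a *: x).
Proof.
apply: measurable_fun_rV => i.
rewrite (_ : _ \o _ = (fun x => b ord0 i + a * rV_coord i x)); last first.
  by apply/funext => x; rewrite /rV_coord /= !mxE.
apply: measurable_funD => //; apply: measurable_funM => //.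
exact: measurable_rV_coord.
Qed.

Local Open Scope ereal_scope.

Lemma ge0_integral_rV_cons n (f : 'rV[R]_n.+1 -> \bar R) :
  measurable_fun [set: 'rV[R]_n.+1] f -> (forall x, 0 <= f x) ->
  \int[lebesgue_rV n.+1]_x f x =
  \int[lebesgue_measure]_t \int[lebesgue_rV n]_y f (rV_cons (t, y)).
Proof.
move=> mf f0.
transitivity (\int[lebesgue_measure \x lebesgue_rV n]_z f (rV_cons z)).
  by rewrite /= /lebesgue_cons ge0_integral_pushforward//;
    exact: measurable_rV_cons.
rewrite fubini_tonelli1//.
by apply: measurableT_comp => //; exact: measurable_rV_cons.
Qed.

(** The measure is an iterated product, and the affine map acts on each coordinate
    separately. *)
Lemma ge0_integral_affine n (b : 'rV[R]_n) (a : R) (f : 'rV[R]_n -> \bar R) :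
  (a != 0)%R -> measurable_fun [set: 'rV[R]_n] f -> (forall x, 0 <= f x) ->
  \int[lebesgue_rV n]_x f (b + a *: x)%R =
  (`|a| ^- n)%:E * \int[lebesgue_rV n]_x f x.
Proof.
move=> a0; elim: n b f => [|n IHn] b f mf f0.
  rewrite expr0 invr1 mul1e; apply: eq_integral => x _; congr f.
  by apply/rowP => -[].
have mg : measurable_fun [set: R * 'rV[R]_n] (f \o @rV_cons R n).
  by apply: measurableT_comp => //; exact: measurable_rV_cons.
have bE (t : R) (y : 'rV[R]_n) : (b + a *: rV_cons (t, y) =
    rV_cons ((rV_uncons b).1 + a * t, (rV_uncons b).2 + a *: y))%R.
  apply/rowP => i; rewrite !mxE /=; case: (unliftP ord0 i) => [j|] -> /=.
    by rewrite !mxE.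
  by [].
rewrite ge0_integral_rV_cons//; last first.
  by apply: measurableT_comp => //; exact: measurable_rV_affine.
rewrite [in RHS]ge0_integral_rV_cons//.
set F := fun t : R => \int[lebesgue_rV n]_y f (rV_cons (t, y)).
have mF : measurable_fun [set: R] F.
  exact: (measurable_fun_fubini_tonelli_F (m2 := lebesgue_rV n) _ mg (fun z => f0 _)).
have F0 x : 0 <= F x by apply: integral_ge0.
transitivity (\int[lebesgue_measure]_t
   ((`|a| ^- n)%:E * F ((rV_uncons b).1 + a * t)%R)).
  apply: eq_integral => t _.
  under eq_integral do rewrite bE.
  rewrite (IHn (rV_uncons b).2 (fun y => f (rV_cons ((rV_uncons b).1 + a * t, y)%R)))//.
  exact: (measurableT_comp mg).
have an0 : (0 <= `|a| ^- n)%R by rewrite invr_ge0 exprn_ge0.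
rewrite ge0_integralZl//; last first.
  by apply: (measurableT_comp mF); exact: measurable_affine1.
rewrite (ge0_integral_affine1 _ _ mF)// muleA -EFinM.
by rewrite -invfM -exprSr.
Qed.

Lemma ge0_integral_dilation n (a : R) (f : 'rV[R]_n -> \bar R) :
  (a != 0)%R -> measurable_fun [set: 'rV[R]_n] f -> (forall x, 0 <= f x) ->
  \int[lebesgue_rV n]_x f (a *: x)%R =
  (`|a| ^- n)%:E * \int[lebesgue_rV n]_x f x.
Proof.
move=> a0 mf f0; rewrite -(ge0_integral_affine 0%R a0 mf f0).
by apply: eq_integral => x _; rewrite add0r.
Qed.

Lemma ge0_integral_reflection n (b : 'rV[R]_n) (f : 'rV[R]_n -> \bar R) :
  measurable_fun [set: 'rV[R]_n] f -> (forall x, 0 <= f x) ->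
  \int[lebesgue_rV n]_x f (b - x)%R = \int[lebesgue_rV n]_x f x.
Proof.
move=> mf f0; have a0 : (-1 != 0 :> R)%R by rewrite oppr_eq0 oner_neq0.
have := ge0_integral_affine b a0 mf f0.
rewrite normrN1 expr1n invr1 mul1e => <-.
by apply: eq_integral => x _; rewrite scaleN1r.
Qed.

End affine_rV.

(** * Continuous functions *)
Section continuous_rV.
Context {R : realType} {n : nat}.
Implicit Types (x y : 'rV[R]_n) (f : 'rV[R]_n -> R).

Lemma measurable_box (A : 'I_n -> set R) : (forall i, measurable (A i)) ->
  measurable [set x : 'rV[R]_n | forall i, A i (x ord0 i)].
Proof.
move=> mA; rewrite (_ : mkset _ = \bigcap_(i in [set: 'I_n]) (rV_coord i @^-1` A i)).
  apply: fin_bigcap_measurable => // i _.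
  by rewrite -[X in measurable X]setTI; exact: measurable_rV_coord.
by apply/seteqP; split => [x Ax i _|x Ax i]; [exact: Ax|exact: (Ax i)].
Qed.

Let grid (m : nat) (q : 'rV[int]_n) : 'rV[R]_n :=
  \row_i ((q ord0 i)%:~R / m.+1%:R).

Let grid_index (m : nat) (x : 'rV[R]_n) : 'rV[int]_n :=
  \row_i Num.floor (x ord0 i * m.+1%:R).

Let grid_cell m (q : 'rV[int]_n) :
  measurable [set x | grid_index m x = q].
Proof.
pose I i : set R :=
  `[(q ord0 i)%:~R / m.+1%:R, (q ord0 i + 1)%:~R / m.+1%:R[%classic.
have IE (t : R) i : I i t <-> (Num.floor (t * m.+1%:R) == q ord0 i).
  by rewrite /I /= in_itv/= ler_pdivrMr// ltr_pdivlMr// floor_eq.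
rewrite (_ : mkset _ = [set x : 'rV[R]_n | forall i, I i (x ord0 i)]).
  by apply: measurable_box => i; exact: measurable_itv.
apply/seteqP; split => x /=.
  by move=> xq i; apply/IE; rewrite -xq mxE.
by move=> xq; apply/rowP => i; rewrite mxE; apply/eqP/IE.
Qed.

Let grid_cvg x : (fun m => grid m (grid_index m x)) @ \oo --> x.
Proof.
apply/cvg_ballP => e e0.
near=> m; split => // i j; rewrite (ord1 i) !mxE.
rewrite -ball_normE /ball_/=.
set t := x ord0 j.
have /andP[l1 l2] := floor_itv (t * m.+1%:R).
rewrite -ler_pdivrMr// -?ltr_pdivlMr// in l1 l2.
rewrite ger0_norm ?subr_ge0// ltrBlDr (lt_trans l2)//.
rewrite intrD mulrDl mul1r addrC ltrD2r.
by near: m; exact: (near_infty_natSinv_lt (PosNum e0)).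
Unshelve. all: by end_near.
Qed.

(** The sigma-algebra is generated by the coordinates, so that openness has to be
    traded for countability: a continuous function is the pointwise limit of its
    values at the points of finer and finer grids, which are countably many. *)
Lemma continuous_measurable_rV f : continuous f -> measurable_fun [set: 'rV[R]_n] f.
Proof.
move=> cf; apply: (@measurable_fun_cvg _ _ _ _
  (fun m x => f (grid m (grid_index m x)))) => [m|x _]; last first.
  by apply: continuous_cvg; [exact: cf | exact: grid_cvg].
move=> _ Y mY; rewrite setTI.
pose cell (q : 'rV[int]_n) :=
  if `[< Y (f (grid m q)) >] then [set x | grid_index m x = q] else set0.
rewrite (_ : _ @^-1` _ = \bigcup_k oapp cell set0 (unpickle k)).
  apply: bigcup_measurable => k _; case: (unpickle k) => //= q.
  by rewrite /cell; case: ifP.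
apply/seteqP; split => x /=.
  move=> Yx; exists (pickle (grid_index m x)) => //.
  by rewrite pickleK /= /cell asboolT.
move=> [k _]; case: (unpickle k) => //= q; rewrite /cell.
by case: asboolP => // Yq /= ->.
Qed.

(** Sets of full measure are dense, because a nonempty open set contains a box of
    positive measure. *)
Lemma ae_ge0_continuous f : continuous f ->
  {ae lebesgue_rV n, forall x, 0 <= f x} -> forall x, 0 <= f x.
Proof.
move=> cf [A [mA A0 fA]] x; rewrite leNgt; apply/negP => fx.
have /nbhs_ballP[e /= e0 fe] : \forall y \near x, f y < 0.
  exact: (cvgr_lt _ (cf x) _ fx).
pose B i : set R := `](x ord0 i - e)%R, (x ord0 i + e)%R[%classic.
have mB i : measurable (B i) by exact: measurable_itv.
have BA : [set y : 'rV[R]_n | forall i, B i (y ord0 i)] `<=` A.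
  move=> y /= By; apply: fA => /=; apply/negP; rewrite -ltNge; apply: fe.
  split=> // i j; rewrite (ord1 i) -ball_normE /ball_ /= ltr_norml.
  by have := By j; rewrite /B /= in_itv/= => /andP[? ?]; lra.
have := le_measure (lebesgue_rV n) _ _ BA.
rewrite !inE => /(_ (measurable_box mB) mA).
rewrite [leRHS]A0 [leLHS](lebesgue_rV_box mB) leNgt => /negP; apply.
under eq_bigr => i _.
  rewrite lebesgue_measure_itv /= lte_fin.
  rewrite (_ : _ < _ = true); last lra.
  rewrite -EFinB (_ : x ord0 i + e - (x ord0 i - e) = 2 * e); last by lra.
  over.
rewrite prodEFin lte_fin prodr_gt0// => i _; lra.
Qed.

End continuous_rV.

(** * Euclidean norm and balls *)
Section euclidean_norm.
Context {R : realType} {n : nat}.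
Implicit Types (x y z c : 'rV[R]_n) (a r : R).

Lemma enorm_sqr x : enorm x ^+ 2 = \sum_(i < n) x ord0 i ^+ 2.
Proof. by rewrite sqr_sqrtr// sumr_ge0// => i _; exact: sqr_ge0. Qed.

Lemma enorm_ge0 x : 0 <= enorm x. Proof. exact: sqrtr_ge0. Qed.

Lemma enormZ a x : enorm (a *: x) = `|a| * enorm x.
Proof.
rewrite /enorm -sqrtr_sqr -sqrtrM ?sqr_ge0// mulr_sumr; congr (Num.sqrt _).
by apply: eq_bigr => i _; rewrite mxE exprMn.
Qed.

Lemma enormN x : enorm (- x) = enorm x.
Proof. by rewrite -scaleN1r enormZ normrN1 mul1r. Qed.

Lemma enorm_distC x y : enorm (x - y) = enorm (y - x).
Proof. by rewrite -enormN opprB. Qed.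

Lemma enorm0 : enorm (0 : 'rV[R]_n) = 0.
Proof. by rewrite -(scale0r 0) enormZ normr0 mul0r. Qed.

Lemma normr_coord_le_enorm x i : `|x ord0 i| <= enorm x.
Proof.
rewrite -ler_sqr ?nnegrE ?enorm_ge0// real_normK ?num_real// enorm_sqr.
by rewrite (bigD1 i)//= lerDl sumr_ge0// => j _; exact: sqr_ge0.
Qed.

Lemma enorm_eq0 x : (enorm x == 0) = (x == 0).
Proof.
apply/eqP/eqP => [x0|->]; last exact: enorm0.
apply/rowP => i; rewrite mxE; apply/eqP; rewrite -normr_le0 -x0.
exact: normr_coord_le_enorm.
Qed.

Let dot x y := \sum_(i < n) x ord0 i * y ord0 i.

Let enorm_sqrD a x y :
  enorm (x + a *: y) ^+ 2 = enorm x ^+ 2 + 2 * a * dot x y + a ^+ 2 * enorm y ^+ 2.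
Proof.
rewrite !enorm_sqr /dot !mulr_sumr -!big_split/=; apply: eq_bigr => i _.
by rewrite !mxE; ring.
Qed.

Let dot_le x y : dot x y <= enorm x * enorm y.
Proof.
have [->|x0] := eqVneq x 0.
  by rewrite /dot enorm0 mul0r big1// => i _; rewrite mxE mul0r.
have [->|y0] := eqVneq y 0.
  by rewrite /dot enorm0 mulr0 big1// => i _; rewrite mxE mulr0.
have xp : 0 < enorm x by rewrite lt_neqAle enorm_ge0 eq_sym enorm_eq0 x0.
have yp : 0 < enorm y by rewrite lt_neqAle enorm_ge0 eq_sym enorm_eq0 y0.
(* The difference of the two vectors, rescaled to the same length. *)
have := sqr_ge0 (enorm (x + (- (enorm x / enorm y)) *: y)).
rewrite enorm_sqrD.
rewrite [X in 0 <= X](_ : _ =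
  2 * (enorm x / enorm y) * (enorm x * enorm y - dot x y)); last by field; lra.
by rewrite pmulr_rge0 ?subr_ge0// mulr_gt0// divr_gt0.
Qed.

Lemma enormD_le x y : enorm (x + y) <= enorm x + enorm y.
Proof.
rewrite -ler_sqr ?nnegrE ?addr_ge0 ?enorm_ge0// -[y in X in X <= _]scale1r enorm_sqrD.
by have := dot_le x y; lra.
Qed.

Lemma enormB_le x y : enorm x - enorm y <= enorm (x - y).
Proof. by rewrite lerBlDr -{1}(subrK y x) enormD_le. Qed.

Lemma enorm_parallelogram x z :
  enorm (x + z) ^+ 2 + enorm (x - z) ^+ 2 = 2 * enorm x ^+ 2 + 2 * enorm z ^+ 2.
Proof.
by rewrite -[z in x + z]scale1r -[x - z]/(x + - z) -scaleN1r !enorm_sqrD; ring.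
Qed.

Lemma measurable_enorm : measurable_fun [set: 'rV[R]_n] (@enorm R n).
Proof.
have msqrt : measurable_fun [set: R] (@Num.sqrt R).
  by apply: continuous_measurable_fun; exact: sqrt_continuous.
apply: (measurableT_comp msqrt).
apply: measurable_sum => i; apply: measurable_funX.
exact: measurable_rV_coord.
Qed.

Lemma measurable_rV_sub d (T : measurableType d) (f g : T -> 'rV[R]_n) :
  measurable_fun setT f -> measurable_fun setT g ->
  measurable_fun setT (fun t => f t - g t).
Proof.
move=> mf mg; apply: measurable_fun_rV => i.
rewrite (_ : _ \o _ = (fun t => rV_coord i (f t) - rV_coord i (g t))).
  by apply: measurable_funB; apply: measurableT_comp => //;
    exact: measurable_rV_coord.
by apply/funext => t; rewrite /rV_coord /= !mxE.
Qed.

Lemma continuous_distance c : continuous (fun x => enorm (x - c)).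
Proof.
move=> x; apply: (@continuous_comp _ _ _ _ (@Num.sqrt R)); last exact: sqrt_continuous.
apply: (continuous_big (op := +%R)) => [|i _ y]; first exact: add_continuous.
apply: (@continuous_comp _ _ _ (fun x => (x - c) ord0 i) (fun t => t ^+ 2)).
  rewrite (_ : (fun x => _) = (fun x : 'rV[R]_n => x ord0 i - c ord0 i)).
    exact: (cvgB (@coord_continuous R 1 n ord0 i y) (cvg_cst (c ord0 i))).
  by apply/funext => z; rewrite !mxE.
exact: exprn_continuous.
Qed.

Definition eball c r : set 'rV[R]_n := [set x | enorm (x - c) < r].

Lemma measurable_eball c r : measurable (eball c r).
Proof.
rewrite -[X in measurable X]setTI.
have mf : measurable_fun [set: 'rV[R]_n] (fun x => enorm (x - c)).
  apply: (measurableT_comp measurable_enorm); apply: measurable_rV_sub => //.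
rewrite (_ : eball c r = (fun x => enorm (x - c)) @^-1` `]-oo, r[).
  by apply: mf => //; exact: measurable_itv.
by apply/seteqP; split => x /=; rewrite in_itv/=.
Qed.

Lemma measurable_sublevel_ball c r (f : 'rV[R]_n -> R) a : measurable_fun setT f ->
  measurable (eball c r `&` [set x | f x <= a]).
Proof.
move=> mf; apply: measurableI; first exact: measurable_eball.
rewrite -[X in measurable X]setTI (_ : mkset _ = f @^-1` `]-oo, a]).
  by apply: mf => //; exact: measurable_itv.
by apply/seteqP; split => x /=; rewrite in_itv/=.
Qed.

End euclidean_norm.

Section ball_measure.
Context {R : realType} {n : nat}.
Local Open Scope ereal_scope.
Implicit Types (c : 'rV[R]_n) (r : R).

Let unit_ball_lt_pinfty : lebesgue_rV n (eball (0 : 'rV[R]_n) 1) < +oo.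
Proof.
pose B (i : 'I_n) : set R := `](-1)%R, 1%R[%classic.
have mB i : measurable (B i) by exact: measurable_itv.
apply: (@le_lt_trans _ _ (lebesgue_rV n [set x : 'rV[R]_n | forall i, B i (x ord0 i)])).
  apply: le_measure; rewrite ?inE.
  - exact: measurable_eball.
  - exact: measurable_box.
  - move=> x /=; rewrite /eball /= subr0 => x1 i.
    by rewrite /B /= in_itv/= -ltr_norml (le_lt_trans (normr_coord_le_enorm _ _)).
rewrite lebesgue_rV_box//.
under eq_bigr => i _.
  rewrite lebesgue_measure_itv /= lte_fin (_ : _ < _ = true)%R; last lra.
  rewrite -EFinB; over.
by rewrite prodEFin ltry.
Qed.

Let unit_ball_gt0 : 0 < lebesgue_rV n (eball (0 : 'rV[R]_n) 1).
Proof.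
(* A box of half side [1 / (n + 1)] is in the unit ball, as [n < (n + 1) ^ 2];
   this also covers [n = 0]. *)
pose e : R := (n.+1%:R^-1)%R.
have e0 : (0 < e)%R by rewrite invr_gt0.
pose B (i : 'I_n) : set R := `](- e)%R, e[%classic.
have mB i : measurable (B i) by exact: measurable_itv.
apply: (@lt_le_trans _ _ (lebesgue_rV n [set x : 'rV[R]_n | forall i, B i (x ord0 i)])).
  rewrite lebesgue_rV_box//.
  under eq_bigr => i _.
    rewrite lebesgue_measure_itv /= lte_fin (_ : _ < _ = true)%R; last lra.
    rewrite -EFinB; over.
  by rewrite prodEFin lte_fin prodr_gt0// => i _; lra.
apply: le_measure; rewrite ?inE.
- exact: measurable_box.
- exact: measurable_eball.
move=> x /= Bx; rewrite /eball /= subr0 -(@ltr_pXn2r _ 2)// ?nnegrE ?enorm_ge0//.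
rewrite expr1n enorm_sqr.
apply: (@le_lt_trans _ _ (\sum_(i < n) e ^+ 2)%R).
  apply: ler_sum => i _; have := Bx i; rewrite /B /= in_itv/= => ?; nra.
rewrite sumr_const card_ord -[X in (X < _)%R]mulr_natl.
rewrite /e exprVn -[ltRHS](@divff _ (n.+1%:R ^+ 2)%R) ?expf_neq0// ltr_pM2r.
  by rewrite -natrX ltr_nat -mulnn leq_pmulr.
by rewrite invr_gt0 exprn_gt0.
Qed.

Definition ball_volume : R := fine (lebesgue_rV n (eball (0 : 'rV[R]_n) 1)).

Lemma ball_volume_gt0 : (0 < ball_volume)%R.
Proof. by rewrite fine_gt0// unit_ball_gt0 unit_ball_lt_pinfty. Qed.

Lemma lebesgue_eball c r : (0 < r)%R ->
  lebesgue_rV n (eball c r) = (ball_volume * r ^+ n)%:E.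
Proof.
move=> r0; have rn0 : (0 < r ^+ n)%R by rewrite exprn_gt0.
pose f x : \bar R := (\1_(eball c r) x)%:E.
have f0 x : 0 <= f x by rewrite lee_fin.
have mf : measurable_fun [set: 'rV[R]_n] f.
  apply/measurable_EFinP; apply: measurable_indic; exact: measurable_eball.
have := ge0_integral_affine c (lt0r_neq0 r0) mf f0.
rewrite [X in _ = _ * X]integral_indic ?setIT//; last exact: measurable_eball.
rewrite (_ : \int[_]_x _ = lebesgue_rV n (eball (0 : 'rV[R]_n) 1)); last first.
  rewrite -[eball 0 1]setIT -integral_indic//; last exact: measurable_eball.
  apply: eq_integral => x _; rewrite /f !indicE; congr ((nat_of_bool _)%:R%:E).
  apply/idP/idP; rewrite !inE /eball /= addrAC subrr add0r subr0 enormZ gtr0_norm//.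
    by rewrite gtr_pMr.
  by rewrite gtr_pMr.
rewrite gtr0_norm// => bE.
rewrite EFinM /ball_volume fineK ?ge0_fin_numE// bE muleAC -EFinM mulVf ?gt_eqF//.
by rewrite mul1e.
Qed.

End ball_measure.
Arguments ball_volume R n : clear implicits.

(** * The fractional kernel and its moment *)
Section kernel_moment.
Context {R : realType} {n : nat}.
Implicit Types (z : 'rV[R]_n).

(** The step is a geometric series in disguise: a dilation by [t] turns the
    truncation at one scale into the truncation at the previous one, so the
    integrals obey [I (i + 1) <= I 1 + theta * I i]. *)
Lemma selfsimilar_integral_lty (g : nat -> 'rV[R]_n -> R) (f : 'rV[R]_n -> R)
    (t c M : R) :
  t != 0 -> 0 <= c -> c / `|t| ^+ n < 1 ->
  (forall i, measurable_fun setT (g i)) -> (forall i z, 0 <= g i z) ->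
  (forall z, g 0%N z = 0) ->
  (forall i z, g i.+1 z <= g 1%N z + c * g i (t *: z)) ->
  (\int[lebesgue_rV n]_z (g 1%N z)%:E <= M%:E)%E ->
  (forall z, g ^~ z @ \oo --> f z) ->
  (\int[lebesgue_rV n]_z (f z)%:E < +oo)%E.
Proof.
move=> t0 c0 th1 mg g0 g00 gS gM gf.
set th := c / `|t| ^+ n in th1.
have th0 : 0 <= th by rewrite divr_ge0// exprn_ge0.
have M0 : 0 <= M.
  by rewrite -lee_fin (le_trans _ gM)// integral_ge0// => z _; rewrite lee_fin.
have IM i : (\int[lebesgue_rV n]_z (g i z)%:E <= (M / (1 - th))%:E)%E.
  elim: i => [|i IHi].
    under eq_integral do rewrite g00.
    by rewrite integral0 lee_fin divr_ge0// subr_ge0 ltW.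
  have mgt : measurable_fun setT (fun z => g i (t *: z)).
    apply: (measurableT_comp (mg i)).
    have := measurable_rV_affine (0 : 'rV[R]_n) t.
    by under eq_fun do rewrite add0r.
  apply: (@le_trans _ _ (\int[lebesgue_rV n]_z
      ((g 1%N z)%:E + c%:E * (g i (t *: z))%:E))%E).
    apply: ge0_le_integral => //.
    - by move=> z _; rewrite lee_fin.
    - exact/measurable_EFinP.
    - apply: emeasurable_funD; first exact/measurable_EFinP.
      by apply: measurable_funeM; exact/measurable_EFinP.
    - by move=> z _; rewrite -EFinM -EFinD lee_fin.
  rewrite ge0_integralD//.
  - rewrite ge0_integralZl//.
    + rewrite (ge0_integral_dilation t0 (f := fun z => (g i z)%:E)); last 2 first.
        exact/measurable_EFinP.
        by move=> z; rewrite lee_fin.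
      rewrite muleA -EFinM -/th (_ : M / (1 - th) = M + th * (M / (1 - th))); last first.
        by field; lra.
      rewrite EFinD leeD// (EFinM th); apply: lee_wpmul2l; rewrite ?lee_fin//.
    + exact/measurable_EFinP.
    + by move=> z _; rewrite lee_fin.
  - by move=> z _; rewrite lee_fin.
  - exact/measurable_EFinP.
  - by move=> z _; rewrite -EFinM lee_fin mulr_ge0.
  - by apply: measurable_funeM; exact/measurable_EFinP.
apply: (@le_lt_trans _ _ (M / (1 - th))%:E); last exact: ltry.
have <- : (\int[lebesgue_rV n]_z limn_einf (fun i => (g i z)%:E) =
          \int[lebesgue_rV n]_z (f z)%:E)%E.
  apply: eq_integral => z _.
  have gfz : (g i z)%:E @[i --> \oo] --> (f z)%:E by exact/cvg_EFin/gf/nearW.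
  rewrite is_cvg_limn_einfE; first exact/cvg_lim.
  by apply/cvg_ex; eexists; exact: gfz.
apply: (le_trans (fatou _ _ _ _)) => //.
- by move=> i; exact/measurable_EFinP.
- by move=> i z _; rewrite lee_fin.
rewrite limn_einf_lim; apply: lime_le; first exact: is_cvg_einfs.
apply: nearW => i; apply: (le_trans _ (IM i)).
by apply: ge_ereal_inf; exists (\int[lebesgue_rV n]_z (g i z)%:E)%E => //; exists i => /=.
Qed.

Variable s : R.
Hypothesis s01 : 0 < s < 1.
Let q := n%:R + 2 * s.

Definition frac_kernel z : R := (enorm z `^ q)^-1.

Lemma frac_kernel_ge0 z : 0 <= frac_kernel z.
Proof. by rewrite invr_ge0 powR_ge0. Qed.

Let q_gt0 : 0 < q.
Proof. by have /andP[? _] := s01; have : 0 <= n%:R :> R by []; rewrite /q; lra. Qed.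

Lemma frac_kernel0 : frac_kernel 0 = 0.
Proof. by rewrite /frac_kernel enorm0 powR0 ?gt_eqF// invr0. Qed.

Lemma frac_kernelN z : frac_kernel (- z) = frac_kernel z.
Proof. by rewrite /frac_kernel enormN. Qed.

Lemma frac_kernelZ a z : frac_kernel (a *: z) = (`|a| `^ q)^-1 * frac_kernel z.
Proof. by rewrite /frac_kernel enormZ powRM ?enorm_ge0// invfM. Qed.

Lemma measurable_frac_kernel : measurable_fun setT frac_kernel.
Proof.
rewrite (_ : frac_kernel = (@powR R ^~ (- q)) \o (@enorm R n)).
  by apply: measurableT_comp => //; exact: measurable_enorm.
by apply/funext => z; rewrite /frac_kernel /= powRN.
Qed.

Lemma le_frac_kernel z r : z != 0 -> enorm z <= r -> (r `^ q)^-1 <= frac_kernel z.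
Proof.
move=> z0 zr; have zp : 0 < enorm z by rewrite lt_neqAle enorm_ge0 eq_sym enorm_eq0 z0.
have rp := lt_le_trans zp zr.
rewrite lef_pV2 ?posrE ?powR_gt0//.
by apply: (ge0_ler_powR (ltW q_gt0)) => //; rewrite nnegrE ltW.
Qed.

Lemma frac_kernel_le z r : 0 < r -> r <= enorm z -> frac_kernel z <= (r `^ q)^-1.
Proof.
move=> rp zr; have zp := lt_le_trans rp zr.
rewrite lef_pV2 ?posrE ?powR_gt0//.
by apply: (ge0_ler_powR (ltW q_gt0)) => //; rewrite nnegrE ltW.
Qed.

Let annulus a b : set 'rV[R]_n := [set z | a <= enorm z < b].

Let measurable_annulus a b : measurable (annulus a b).
Proof.
rewrite -[X in measurable X]setTI (_ : annulus a b = @enorm R n @^-1` `[a, b[).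
  by apply: measurable_enorm => //; exact: measurable_itv.
by apply/seteqP; split => x /=; rewrite in_itv/=.
Qed.

Let annulus_integral_le (h : 'rV[R]_n -> R) a b M :
  0 <= M -> 0 < b -> measurable_fun setT h -> (forall z, 0 <= h z) ->
  (forall z, a <= enorm z < b -> h z <= M) ->
  (\int[lebesgue_rV n]_z (\1_(annulus a b) z * h z)%:E
     <= (M * (ball_volume R n * b ^+ n))%:E)%E.
Proof.
move=> M0 b0 mh h0 hM; rewrite EFinM -(lebesgue_eball 0 b0).
rewrite -integral_cst//; last exact: measurable_eball.
rewrite [leRHS]integral_mkcond; apply: ge0_le_integral => //.
- by move=> z _; rewrite lee_fin mulr_ge0.
- by apply/measurable_EFinP/measurable_funM => //; exact: measurable_indic.
- apply/(measurable_restrictT _ _).1; first exact: measurable_eball.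
  exact: measurable_cst.
- move=> z _; rewrite /patch; case: ifPn => zb; rewrite lee_fin indicE.
    have [za|] := boolP (_ \in _); last by rewrite mul0r.
    by rewrite mul1r; apply: hM; rewrite inE in za.
  rewrite memNset ?mul0r// => /= /andP[_ zb'].
  by move: zb; rewrite notin_setE /eball /= subr0.
Qed.

Let two_powR_gt1 (r : R) : 0 < r -> 1 < 2 `^ r.
Proof.
move=> r0; rewrite -[ltLHS](congr1 (fun f => f r) (powR1 R)).
by apply: gt0_ltr_powR; rewrite ?nnegrE// ltr1n.
Qed.

Let two_powR_q : 2 `^ q = 2 ^+ n * 2 `^ (2 * s).
Proof. by rewrite /q powRD ?powR_mulrn//; apply/implyP. Qed.

(** The dyadic annuli outside the unit ball contribute a geometric series of ratio
    [2 ^ (- 2 s)]. *)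
Let outer_part_lty :
  (\int[lebesgue_rV n]_z (\1_(~` eball 0 1) z * frac_kernel z)%:E < +oo)%E.
Proof.
pose g i z := \1_(annulus 1 (2 ^+ i)) z * frac_kernel z.
have /andP[s0 s1] := s01.
apply: (@selfsimilar_integral_lty g _ 2^-1 (2 `^ q)^-1 (1 * (ball_volume R n * 2 ^+ n))).
- by rewrite invr_eq0.
- by rewrite invr_ge0 powR_ge0.
- rewrite gtr0_norm// exprVn invrK two_powR_q invfM mulrAC mulVf ?mul1r ?expf_neq0//.
  by rewrite invf_lt1 ?powR_gt0// two_powR_gt1// mulr_gt0.
- by move=> i; apply: measurable_funM => //; exact: measurable_frac_kernel.
- by move=> i z; rewrite mulr_ge0 ?frac_kernel_ge0.
- move=> z; rewrite /g indicE memNset ?mul0r//= => /andP[z1].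
  by rewrite expr0 ltNge z1.
- move=> i z; rewrite /g frac_kernelZ gtr0_norm// mulrCA !mulrA -mulrDl.
  rewrite ler_wpM2r ?frac_kernel_ge0//.
  rewrite [X in _ + X](_ : _ = \1_(annulus 1 (2 ^+ i)) (2^-1 *: z)); last first.
    by rewrite -mulrA -invfM -powRM// divff// powR1 invr1 mulr1.
  rewrite !indicE -natrD ler_nat.
  have [|] := boolP (z \in annulus 1 (2 ^+ i.+1)); last by [].
  rewrite inE /= => /andP[z1 z2].
  have [z3|z3] := ltP (enorm z) 2.
    by have -> : z \in annulus 1 (2 ^+ 1) by rewrite inE /annulus /= expr1 z1.
  have -> : 2^-1 *: z \in annulus 1 (2 ^+ i); last by rewrite addn1.
  rewrite inE /annulus /= enormZ gtr0_norm//.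
  rewrite exprS in z2; apply/andP; split; lra.
- rewrite /g expr1; apply: annulus_integral_le => //.
  + exact: measurable_frac_kernel.
  + exact: frac_kernel_ge0.
  + move=> z /andP[z1 _]; rewrite (le_trans (frac_kernel_le _ z1))//.
    by rewrite powR1 invr1.
- move=> z; apply: cvg_near_cst.
  have [k zk] : exists k, enorm z < 2 ^+ k.
    exists (Num.trunc (enorm z)).+1; apply: (lt_trans (truncnS_gt _)).
    by rewrite -natrX ltr_nat ltn_expl.
  exists k => // i /= ki; rewrite /g !indicE; congr (_%:R * _); congr nat_of_bool.
  apply/idP/idP; rewrite !inE /annulus /eball /= subr0.
    by move=> /andP[z1 _]; apply/negP; rewrite -leNgt.
  move=> /negP; rewrite -leNgt => -> /=; rewrite (lt_le_trans zk)//.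
  by rewrite ler_eXn2l ?ltr1n.
Qed.

(** Towards the origin the factor [|z| ^ 2] makes the dyadic annuli contribute a
    geometric series of ratio [2 ^ (2 s - 2)]. *)
Let inner_part_lty :
  (\int[lebesgue_rV n]_z (\1_(eball 0 1) z * (enorm z ^+ 2 * frac_kernel z))%:E
    < +oo)%E.
Proof.
pose h z := enorm z ^+ 2 * frac_kernel z.
have h0 z : 0 <= h z by rewrite mulr_ge0 ?sqr_ge0 ?frac_kernel_ge0.
have mh : measurable_fun setT h.
  apply: measurable_funM; last exact: measurable_frac_kernel.
  by apply: measurable_funX; exact: measurable_enorm.
pose g i z := \1_(annulus (2 ^- i) 1) z * h z.
have /andP[s0 s1] := s01.
apply: (@selfsimilar_integral_lty g _ 2 (2 `^ q / 4)
  (1 * (2^-1 `^ q)^-1 * (ball_volume R n * 1 ^+ n))).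
- by [].
- by rewrite divr_ge0// powR_ge0.
- rewrite gtr0_norm// two_powR_q.
  rewrite (_ : _ / _ / _ = 2 `^ (2 * s) / 4); last by field; rewrite expf_neq0.
  have -> : (4 : R) = 2 `^ (2 * s) * 2 `^ (2 - 2 * s).
    rewrite -powRD; last by rewrite pnatr_eq0 implybT.
    by rewrite addrC subrK powR_mulrn// -natrX.
  rewrite ltr_pdivrMr ?mulr_gt0 ?powR_gt0// mul1r.
  by rewrite ltr_pMr ?powR_gt0// two_powR_gt1//; lra.
- by move=> i; apply: measurable_funM => //; exact: measurable_indic.
- by move=> i z; rewrite mulr_ge0.
- move=> z; rewrite /g indicE memNset ?mul0r//= => /andP[].
  by rewrite expr0 invr1 => z1; rewrite ltNge z1.
- move=> i z.
  have -> : 2 `^ q / 4 * g i (2 *: z) = \1_(annulus (2 ^- i) 1) (2 *: z) * h z.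
    rewrite /g /h enormZ frac_kernelZ gtr0_norm//; field.
    by rewrite gt_eqF// powR_gt0.
  rewrite -mulrDl ler_wpM2r// !indicE -natrD ler_nat.
  have [|] := boolP (z \in annulus (2 ^- i.+1) 1); last by [].
  rewrite inE /= => /andP[z1 z2].
  have [z3|z3] := leP 2^-1 (enorm z).
    by have -> : z \in annulus (2 ^- 1) 1 by rewrite inE /annulus /= expr1 z2 andbT.
  have -> : 2 *: z \in annulus (2 ^- i) 1; last by rewrite addn1.
  rewrite inE /annulus /= enormZ gtr0_norm//.
  rewrite exprS invfM in z1; apply/andP; split; lra.
- rewrite /g; apply: annulus_integral_le => //.
  move=> z /andP[]; rewrite expr1 => z1 z2.
  rewrite /h ler_pM ?sqr_ge0 ?frac_kernel_ge0//.
    by rewrite expr_le1 ?enorm_ge0// ltW.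
  exact: frac_kernel_le.
- move=> z; rewrite -/(h z); apply: cvg_near_cst.
  have [->|z0] := eqVneq z 0.
    by apply: nearW => i; rewrite /g /h enorm0 expr0n mul0r !mulr0.
  have zp : 0 < enorm z by rewrite lt_neqAle enorm_ge0 eq_sym enorm_eq0 z0.
  have [k zk] : exists k, (enorm z)^-1 < 2 ^+ k.
    exists (Num.trunc (enorm z)^-1).+1; apply: (lt_trans (truncnS_gt _)).
    by rewrite -natrX ltr_nat ltn_expl.
  exists k => // i /= ki; rewrite /g !indicE; congr (_%:R * _); congr nat_of_bool.
  apply/idP/idP; rewrite !inE /annulus /eball /= subr0.
    by move=> /andP[].
  move=> ->; rewrite andbT -[leRHS]invrK lef_pV2 ?posrE ?exprn_gt0 ?invr_gt0//.
  by rewrite (le_trans (ltW zk))// ler_eXn2l ?ltr1n.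
Qed.

Lemma frac_moment_lty :
  (\int[lebesgue_rV n]_z (Num.min 1 (enorm z ^+ 2) * frac_kernel z)%:E < +oo)%E.
Proof.
apply: le_lt_trans (lte_add_pinfty inner_part_lty outer_part_lty).
have mk := measurable_frac_kernel.
have me : measurable_fun setT (fun z : 'rV[R]_n => enorm z ^+ 2).
  by apply: measurable_funX; exact: measurable_enorm.
have mi : measurable (eball (0 : 'rV[R]_n) 1) by exact: measurable_eball.
rewrite -ge0_integralD//.
- apply: ge0_le_integral => //.
  + by move=> z _; rewrite lee_fin mulr_ge0 ?frac_kernel_ge0// le_min ler01 sqr_ge0.
  + apply/measurable_EFinP/measurable_funM => //.
    exact: measurable_minr.
  + by apply: emeasurable_funD; apply/measurable_EFinP/measurable_funM => //;
      [exact: measurable_funM|apply: measurable_indic; exact: measurableC].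
  + move=> z _; rewrite -EFinD lee_fin mulrA -mulrDl ler_wpM2r ?frac_kernel_ge0//.
    rewrite !indicE in_setC; case: (z \in _); rewrite ?mul1r ?mul0r ?addr0 ?add0r.
      by rewrite ge_min lexx orbT.
    by rewrite ge_min lexx.
- move=> z _; rewrite lee_fin mulr_ge0//.
  by rewrite mulr_ge0 ?frac_kernel_ge0 ?sqr_ge0.
- by apply/measurable_EFinP/measurable_funM => //; exact: measurable_funM.
- by move=> z _; rewrite lee_fin mulr_ge0 ?frac_kernel_ge0.
- apply/measurable_EFinP/measurable_funM => //.
  by apply: measurable_indic; exact: measurableC.
Qed.

(** The kernel is that of a Levy measure, and this is the moment whose finiteness
    characterizes Levy measures; it bounds the fractional Laplacian of functions
    with bounded second differences. *)
Definition frac_moment : R :=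
  fine (\int[lebesgue_rV n]_z (Num.min 1 (enorm z ^+ 2) * frac_kernel z)%:E).

Lemma frac_moment_ge0 : 0 <= frac_moment.
Proof.
rewrite fine_ge0// integral_ge0// => z _.
by rewrite lee_fin mulr_ge0 ?frac_kernel_ge0// le_min ler01 sqr_ge0.
Qed.

(** The kernel is homogeneous of degree [- n - 2 s] and the measure of degree [n]. *)
Lemma frac_moment_scaled r : 0 < r ->
  (\int[lebesgue_rV n]_z
     (Num.min 1 ((enorm z / r) ^+ 2) * frac_kernel z)%:E =
  (frac_moment / r `^ (2 * s))%:E)%E.
Proof.
move=> r0; have rn0 : r^-1 != 0 by rewrite invr_eq0 gt_eqF.
have mk := measurable_frac_kernel.
have me : measurable_fun setT (fun z : 'rV[R]_n => Num.min 1 (enorm z ^+ 2)).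
  by apply: measurable_minr => //; apply: measurable_funX; exact: measurable_enorm.
pose f z := Num.min 1 (enorm z ^+ 2) * frac_kernel z.
have f0 z : 0 <= f z by rewrite mulr_ge0 ?frac_kernel_ge0// le_min ler01 sqr_ge0.
have mf : measurable_fun setT f by apply: measurable_funM.
have rp : 0 < r `^ q by rewrite powR_gt0.
transitivity (\int[lebesgue_rV n]_z ((r `^ q)^-1%:E * (f (r^-1 *: z))%:E))%E.
  apply: eq_integral => z _; rewrite -EFinM /f enormZ frac_kernelZ.
  rewrite gtr0_norm ?invr_gt0//.
  have -> : r^-1 `^ q = (r `^ q)^-1.
    by apply: (mulfI (lt0r_neq0 rp)); rewrite divff ?gt_eqF//;
      rewrite -powRM ?invr_ge0 ?ltW// divff ?gt_eqF// powR1.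
  rewrite invrK (mulrC r^-1) [in RHS]mulrCA (mulrA (_^-1) (r `^ q)) mulVf ?gt_eqF//.
  by rewrite mul1r.
rewrite ge0_integralZl//.
- rewrite (ge0_integral_dilation rn0 (f := fun z => (f z)%:E)); last 2 first.
    exact/measurable_EFinP.
    by move=> z; rewrite lee_fin.
  rewrite -[X in (_ * (_ * X))%E]fineK.
    rewrite -!EFinM -/frac_moment gtr0_norm ?invr_gt0// exprVn invrK.
    rewrite /q powRD ?powR_mulrn ?ltW//; last by apply/implyP; rewrite gt_eqF.
    congr EFin; field; rewrite expf_neq0 ?gt_eqF//= powR_gt0//.
  rewrite ge0_fin_numE; first exact: frac_moment_lty.
  by apply: integral_ge0 => z _; rewrite lee_fin.
- apply/measurable_EFinP; apply: (measurableT_comp mf).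
  have := measurable_rV_affine (0 : 'rV[R]_n) r^-1.
  by under eq_fun do rewrite add0r.
- by move=> z _; rewrite lee_fin.
- by rewrite lee_fin invr_ge0 ltW.
Qed.

End kernel_moment.
Arguments frac_moment {R} n s.

(** * The paraboloid cutoff *)
Section cutoff.
Context {R : realType} {n : nat}.
Implicit Types (x y z c : 'rV[R]_n) (r : R).

Definition cutoff c r x : R := Num.max 0 (1 - (enorm (x - c) / r) ^+ 2).

Lemma cutoff_ge0 c r x : 0 <= cutoff c r x.
Proof. by rewrite /cutoff le_max lexx. Qed.

Lemma cutoff_le1 c r x : cutoff c r x <= 1.
Proof. by rewrite /cutoff ge_max ler01 lerBlDr lerDl sqr_ge0. Qed.

Lemma cutoff_center c r : cutoff c r c = 1.
Proof. by rewrite /cutoff subrr enorm0 mul0r expr0n/= subr0 max_r. Qed.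

Lemma cutoff_eq0 c r x : 0 < r -> r <= enorm (x - c) -> cutoff c r x = 0.
Proof.
move=> r0 rx; rewrite /cutoff max_l// subr_le0 -[leLHS](expr1n _ 2).
by rewrite ler_pXn2r ?nnegrE ?divr_ge0 ?enorm_ge0 ?(ltW r0)// ler_pdivlMr// mul1r.
Qed.

Lemma cutoff_le_indic c r x : 0 < r -> cutoff c r x <= \1_(eball c r) x.
Proof.
move=> r0; rewrite indicE; case: (boolP (_ \in _)) => [_|]; first exact: cutoff_le1.
by rewrite notin_setE /eball /= => /negP; rewrite -leNgt => /(cutoff_eq0 r0) ->.
Qed.

Lemma cutoff_half c r x : 0 < r -> 2 * enorm (x - c) <= r -> 2^-1 <= cutoff c r x.
Proof.
move=> r0 xr; rewrite /cutoff le_max; apply/orP; right.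
have : enorm (x - c) / r <= 2^-1 by rewrite ler_pdivrMr// mulrC ler_pdivlMr//; lra.
have : 0 <= enorm (x - c) / r by rewrite divr_ge0 ?enorm_ge0// ltW.
move: (_ / r) => t; nra.
Qed.

(** On its support the cutoff is a concave paraboloid with Hessian [- 2 / r ^ 2],
    and elsewhere it is at its minimum: its second differences are bounded below
    by those of the paraboloid on the support, and nonnegative elsewhere. *)
Lemma cutoff_second_difference c r x z : 0 < r ->
  2 * cutoff c r x <= cutoff c r (x + z) + cutoff c r (x - z) +
    2 * (\1_(eball c r) x * Num.min 1 ((enorm z / r) ^+ 2)).
Proof.
move=> r0; rewrite indicE; case: (boolP (_ \in _)) => [|]; last first.
  rewrite notin_setE /eball /= => /negP; rewrite -leNgt => /(cutoff_eq0 r0) ->.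
  by rewrite mulr0 mul0r mulr0 addr0 addr_ge0 ?cutoff_ge0.
rewrite inE /eball /= mul1r => xr.
have cx : cutoff c r x = 1 - (enorm (x - c) / r) ^+ 2.
  rewrite /cutoff max_r// subr_ge0 -[leRHS](expr1n _ 2).
  by rewrite ler_pXn2r ?nnegrE ?divr_ge0 ?enorm_ge0 ?(ltW r0)// ler_pdivrMr// mul1r ltW.
have [|_] := leP 1 ((enorm z / r) ^+ 2).
  move=> _; rewrite mulr1.
  have := cutoff_ge0 c r (x + z); have := cutoff_ge0 c r (x - z).
  by have := cutoff_le1 c r x; lra.
have c1 : 1 - (enorm (x + z - c) / r) ^+ 2 <= cutoff c r (x + z).
  by rewrite /cutoff le_max lexx orbT.
have c2 : 1 - (enorm (x - z - c) / r) ^+ 2 <= cutoff c r (x - z).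
  by rewrite /cutoff le_max lexx orbT.
have := enorm_parallelogram (x - c) z.
rewrite [x - c + z]addrAC [x - c - z]addrAC cx.
move: c1 c2; rewrite !exprMn => c1 c2 pl.
have ri : 0 <= r^-1 ^+ 2 by rewrite sqr_ge0.
have := congr1 (fun t => t * r^-1 ^+ 2) pl; rewrite /= !mulrDl.
lra.
Qed.

Lemma cutoff_lipschitz c r x y : 0 < r ->
  `|cutoff c r x - cutoff c r y| <= 2 * (enorm (x - y) / r).
Proof.
move=> r0; wlog xy : x y / enorm (x - c) <= enorm (y - c).
  move=> H; have /orP[] := le_total (enorm (x - c)) (enorm (y - c)); first exact: H.
  by move/H; rewrite distrC enorm_distC.
set a := enorm (x - c) / r; set b := enorm (y - c) / r.
have a0 : 0 <= a by rewrite divr_ge0 ?enorm_ge0// ltW.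
have ab : a <= b by rewrite ler_pM2r ?invr_gt0.
have d : b - a <= enorm (x - y) / r.
  rewrite -mulrBl ler_pM2r ?invr_gt0// [enorm (x - y)]enorm_distC.
  have := enormB_le (y - c) (x - c).
  by rewrite (_ : y - c - (x - c) = y - x)// opprB addrA subrK.
apply: (@le_trans _ _ (2 * (b - a))); last by rewrite ler_pM2l.
rewrite /cutoff -/a -/b ger0_norm.
  have [a1|a1] := leP 1 a.
    rewrite max_l; last nra.
    by rewrite max_l; [lra|nra].
  rewrite max_r; last nra.
  have [b1|b1] := leP 1 b; first by rewrite max_l; nra.
  by rewrite max_r; nra.
rewrite subr_ge0 ge_max !le_max lexx /=; apply/orP; right; nra.
Qed.

Lemma measurable_distance c : measurable_fun setT (fun x => enorm (x - c)).
Proof. by apply: (measurableT_comp measurable_enorm); exact: measurable_rV_sub. Qed.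

Lemma measurable_cutoff c r : measurable_fun setT (cutoff c r).
Proof.
apply: measurable_maxr => //; apply: measurable_funB => //.
apply: measurable_funX; apply: measurable_funM => //; exact: measurable_distance.
Qed.

Lemma continuous_cutoff c r : continuous (cutoff c r).
Proof.
have c2 : continuous (fun x => (enorm (x - c) / r) ^+ 2).
  move=> x; apply: (@continuous_comp _ _ _ (fun x => enorm (x - c) / r) (fun t => t ^+ 2)).
    exact: (cvgM (@continuous_distance R n c x) (cvg_cst r^-1)).
  exact: exprn_continuous.
have cf : continuous (fun x => 1 - (enorm (x - c) / r) ^+ 2).
  by move=> x; apply: (cvgB (F := nbhs x)); [exact: cvg_cst|exact: c2].
move=> x; apply: (@continuous_max R _ (cst 0) (fun x => 1 - (enorm (x - c) / r) ^+ 2)).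
  exact: cst_continuous.
exact: cf.
Qed.

End cutoff.

(** * Double integrals *)
Section double_integrals.
Context {R : realType} {n : nat}.
Local Notation leb := (@lebesgue_rV R n).
Local Notation X := ('rV[R]_n).
Local Open Scope ereal_scope.

Lemma measurable_swap_rV (f : X * X -> \bar R) : measurable_fun setT f ->
  measurable_fun setT (fun z => f (z.2, z.1)).
Proof.
by move=> mf; apply: (measurableT_comp mf); apply: measurable_fun_pair.
Qed.

Lemma ge0_integral_swap (f : X * X -> \bar R) : measurable_fun setT f ->
  (forall z, 0 <= f z) ->
  \int[leb \x leb]_z f (z.2, z.1) = \int[leb \x leb]_z f z.
Proof.
move=> mf f0; rewrite fubini_tonelli1//; last exact: measurable_swap_rV.
by rewrite fubini_tonelli2.
Qed.

Lemma measurable_diff : measurable_fun [set: X * X] (fun z => z.1 - z.2)%R.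
Proof. exact: measurable_rV_sub. Qed.

Lemma ge0_integral_convolution (g h : X -> R) :
  measurable_fun setT g -> measurable_fun setT h ->
  (forall x, 0 <= g x)%R -> (forall x, 0 <= h x)%R ->
  \int[leb \x leb]_z (g z.1 * h (z.1 - z.2)%R)%:E =
  \int[leb]_x (g x)%:E * \int[leb]_x (h x)%:E.
Proof.
move=> mg mh g0 h0.
have mh' : measurable_fun setT (EFin \o h) by exact/measurable_EFinP.
have I0 : 0 <= \int[leb]_x (h x)%:E by apply: integral_ge0 => x _; rewrite lee_fin.
rewrite fubini_tonelli1; last 2 first.
- apply/measurable_EFinP/measurable_funM; apply: measurableT_comp => //.
  exact: measurable_diff.
- by move=> z; rewrite lee_fin mulr_ge0.
rewrite -ge0_integralZr//; last 2 first.
- exact/measurable_EFinP.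
- by move=> x _; rewrite lee_fin.
apply: eq_integral => x _; rewrite /fubini_F /=.
rewrite -(ge0_integral_reflection x mh'); last by move=> y; rewrite lee_fin.
rewrite -ge0_integralZl ?lee_fin//.
- apply: (measurableT_comp mh'); apply: measurable_rV_sub => //.
- by move=> y _; rewrite lee_fin.
Qed.

End double_integrals.

(** * Functions of finite energy *)
Section energy.
Context {R : realType} {n : nat} {s : R}.
Hypothesis s01 : (0 < s < 1)%R.
Local Notation leb := (@lebesgue_rV R n).
Local Notation X := ('rV[R]_n).
Local Notation K := (@frac_kernel R n s).
Implicit Types (f g u v : X -> R) (c x y : X) (r a b : R).

Definition energy_density u v (z : X * X) : R :=
  (u z.1 - u z.2) * (v z.1 - v z.2) * K (z.1 - z.2).

Lemma gagliardoE u v : gagliardo s u v = (\int[leb \x leb]_z (energy_density u v z)%:E)%E.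
Proof. by []. Qed.

Definition finite_energy u : Prop :=
  measurable_fun setT u /\ (gagliardo s u u < +oo)%E.

Lemma measurable_kernel_diff :
  measurable_fun [set: X * X] (fun z => K (z.1 - z.2)).
Proof.
by apply: measurableT_comp; [exact: measurable_frac_kernel|exact: measurable_diff].
Qed.

Lemma measurable_increment u : measurable_fun setT u ->
  measurable_fun [set: X * X] (fun z => u z.1 - u z.2).
Proof. by move=> mu; apply: measurable_funB; exact: measurableT_comp. Qed.

Lemma measurable_energy_density u v :
  measurable_fun setT u -> measurable_fun setT v ->
  measurable_fun setT (energy_density u v).
Proof.
move=> mu mv; apply: measurable_funM; last exact: measurable_kernel_diff.
by apply: measurable_funM; exact: measurable_increment.
Qed.

Lemma energy_density_ge0 u (z : X * X) : 0 <= energy_density u u z.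
Proof. by rewrite /energy_density mulr_ge0 ?frac_kernel_ge0// -expr2 sqr_ge0. Qed.

(** Cauchy-Schwarz is applied pointwise, in the form [|p q| <= p ^ 2 + q ^ 2]. *)
Lemma integrable_energy_density u v : finite_energy u -> finite_energy v ->
  (leb \x leb)%E.-integrable setT (EFin \o energy_density u v).
Proof.
move=> [mu uoo] [mv voo].
have iE w : measurable_fun setT w -> (gagliardo s w w < +oo)%E ->
    (leb \x leb)%E.-integrable setT (EFin \o energy_density w w).
  move=> mw woo; apply/integrableP; split.
    by apply/measurable_EFinP; exact: measurable_energy_density.
  rewrite (_ : (\int[_]_(_ in _) _)%E = gagliardo s w w)//.
  apply: eq_integral => z _.
  by rewrite /= ger0_norm// energy_density_ge0.
have := integrableD measurableT (iE _ mu uoo) (iE _ mv voo).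
apply: le_integrable => //.
  by apply/measurable_EFinP; exact: measurable_energy_density.
move=> z _; rewrite /= lee_fin [leRHS]ger0_norm ?addr_ge0 ?energy_density_ge0//.
rewrite /energy_density -mulrDl normrM (ger0_norm (frac_kernel_ge0 _ _)).
rewrite ler_wpM2r ?frac_kernel_ge0// ler_norml.
move: (u _ - _) (v _ - _) => p q.
by apply/andP; split; have := sqr_ge0 (p + q); have := sqr_ge0 (p - q); nra.
Qed.

(** The increments are controlled one pair of points at a time: this covers Lipschitz
    functions of [u] and [v], their products when bounded, and positive parts. *)
Lemma finite_energy_le u v f a b : finite_energy u -> finite_energy v ->
  measurable_fun setT f ->
  (forall x y, `|f x - f y| <= a * `|u x - u y| + b * `|v x - v y|) ->
  finite_energy f.
Proof.
move=> Eu Ev mf fab; split => //.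
have Iu := integrable_energy_density Eu Eu.
have Iv := integrable_energy_density Ev Ev.
have := integrableD measurableT (integrableZl measurableT (2 * a ^+ 2) Iu)
  (integrableZl measurableT (2 * b ^+ 2) Iv).
move=> /integrableP[mI]; apply: le_lt_trans.
apply: ge0_le_integral => //.
- by move=> z _; rewrite lee_fin energy_density_ge0.
- by apply/measurable_EFinP; exact: measurable_energy_density.
- exact: measurableT_comp.
- move=> z _; rewrite /= -?EFinM -?EFinD lee_fin.
  apply: le_trans (ler_norm _).
  rewrite /energy_density !mulrA -mulrDl ler_wpM2r ?frac_kernel_ge0//.
  have := fab z.1 z.2.
  rewrite -!mulrA -!expr2 -(real_normK (num_real (f _ - _))) -(real_normK (num_real (u _ - _)))
    -(real_normK (num_real (v _ - _))).
  move: `|f _ - _| (normr_ge0 (f z.1 - f z.2)) => F F0.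
  move: `|u _ - _| (normr_ge0 (u z.1 - u z.2)) => U U0.
  move: `|v _ - _| (normr_ge0 (v z.1 - v z.2)) => W W0 FUW.
  apply: (@le_trans _ _ ((a * U + b * W) ^+ 2)); first by rewrite ler_pXn2r// nnegrE (le_trans F0).
  have := sqr_ge0 (a * U - b * W); lra.
Qed.

Let sqr_increment_le (p q t : R) : 0 <= p -> 0 <= q -> p <= 1 -> q <= 1 -> 0 <= t ->
  `|p - q| <= 2 * t -> (p - q) ^+ 2 <= 4 * Num.min 1 (t ^+ 2).
Proof.
move=> p0 q0 p1 q1 t0 pqt.
have d1 : `|p - q| <= 1 by rewrite ler_norml; apply/andP; split; lra.
rewrite -(real_normK (num_real (p - q))); have [_|_] := leP 1 (t ^+ 2).
  by rewrite mulr1 (@le_trans _ _ 1)// ?expr_le1//; lra.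
rewrite (_ : 4 * t ^+ 2 = (2 * t) ^+ 2); last by ring.
by rewrite ler_pXn2r// nnegrE mulr_ge0.
Qed.

Let indic_bound (a b : bool) (p q m : R) : 0 <= m -> p <= a%:R -> q <= b%:R ->
  0 <= p -> 0 <= q -> (p - q) ^+ 2 <= 4 * m ->
  (p - q) ^+ 2 <= 4 * ((a%:R + b%:R) * m).
Proof.
case: a; case: b => /= m0 pa qb p0 q0 pq_le; try lra.
have -> : p = 0 by lra.
have -> : q = 0 by lra.
by rewrite subrr expr0n/=; lra.
Qed.

(** The square of the increment is at most a multiple of [min 1 ((|x - y| / r) ^ 2)],
    and vanishes unless one of the two points is in the ball.  The bound [F] charges
    it to that point. *)
Lemma finite_energy_cutoff c r : 0 < r -> finite_energy (cutoff c r).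
Proof.
move=> r0; split; first exact: measurable_cutoff.
have mB : measurable (eball c r) by exact: measurable_eball.
have mi : measurable_fun setT (fun z : X => Num.min 1 ((enorm z / r) ^+ 2) * K z).
  apply: measurable_funM; last exact: measurable_frac_kernel.
  apply: measurable_minr => //; apply: measurable_funX; apply: measurable_funM => //.
  exact: measurable_enorm.
pose h (z : X) := Num.min 1 ((enorm z / r) ^+ 2) * K z.
have h0 z : 0 <= h z by rewrite mulr_ge0 ?frac_kernel_ge0// le_min ler01 sqr_ge0.
have hN z : h (- z) = h z by rewrite /h enormN frac_kernelN.
pose F (z : X * X) := 4 * (\1_(eball c r) z.1 * h (z.1 - z.2)).
have F0 z : 0 <= F z by rewrite /F mulr_ge0// mulr_ge0.
have mF : measurable_fun setT F.
  do 2!apply: measurable_funM => //.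
    by apply: measurableT_comp => //; exact: measurable_indic.
  by apply: measurableT_comp => //; exact: measurable_diff.
have dom x y : energy_density (cutoff c r) (cutoff c r) (x, y) <= F (x, y) + F (y, x).
  have FE : F (x, y) + F (y, x) = 4 * ((\1_(eball c r) x + \1_(eball c r) y) *
      Num.min 1 ((enorm (x - y) / r) ^+ 2)) * K (x - y).
    by rewrite /F /= -[in h (y - x)](opprB x y) hN /h; ring.
  rewrite FE /energy_density /= ler_wpM2r ?frac_kernel_ge0//.
  have := cutoff_lipschitz c x y r0.
  have := cutoff_le_indic c x r0; have := cutoff_le_indic c y r0.
  have := cutoff_ge0 c r x; have := cutoff_ge0 c r y.
  have t0 : 0 <= enorm (x - y) / r by rewrite divr_ge0 ?enorm_ge0// ltW.
  move: t0; move: (enorm _ / r) => t t0.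
  have := cutoff_le1 c r x; have := cutoff_le1 c r y.
  move: (cutoff c r x) (cutoff c r y) => p q q1 p1 q0 p0 qB pB pqt.
  have pq_le : (p - q) ^+ 2 <= 4 * Num.min 1 (t ^+ 2) by exact: sqr_increment_le.
  have m0 : 0 <= Num.min 1 (t ^+ 2) by rewrite le_min ler01 sqr_ge0.
  by rewrite -expr2 !indicE in qB pB *; exact: indic_bound.
have Foo : (\int[leb \x leb]_z (F z)%:E < +oo)%E.
  under eq_integral do rewrite EFinM.
  rewrite ge0_integralZl//.
  - rewrite (ge0_integral_convolution (g := \1_(eball c r)))//.
    rewrite integral_indic// setIT (frac_moment_scaled s01 r0).
    rewrite [X in (_ * (X * _))%E](lebesgue_eball c r0).
    by rewrite -!EFinM ltry.
  - apply/measurable_EFinP; apply: measurable_funM => //.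
      by apply: measurableT_comp => //; exact: measurable_indic.
    by apply: measurableT_comp => //; exact: measurable_diff.
  - by move=> z _; rewrite lee_fin mulr_ge0.
clearbody F.
have mFs : measurable_fun setT (fun z => F (z.2, z.1)).
  by apply: (measurableT_comp mF); apply: measurable_fun_pair.
apply: (@le_lt_trans _ _ (\int[leb \x leb]_z ((F z)%:E + (F (z.2, z.1))%:E))%E).
  apply: ge0_le_integral => //.
  - by move=> z _; rewrite lee_fin energy_density_ge0.
  - by apply/measurable_EFinP; apply: measurable_energy_density; exact: measurable_cutoff.
  - apply: emeasurable_funD; apply/measurable_EFinP; [exact: mF|exact: mFs].
  - by move=> [x y] _; rewrite -EFinD lee_fin; exact: dom.
rewrite ge0_integralD//.
- rewrite (ge0_integral_swap (f := EFin \o F)).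
  + exact: lte_add_pinfty.
  + by apply/measurable_EFinP; exact: mF.
  + by move=> z; rewrite lee_fin; exact: F0.
- by move=> z _; rewrite lee_fin; exact: F0.
- by apply/measurable_EFinP; exact: mF.
- by move=> z _; rewrite lee_fin; exact: F0.
- by apply/measurable_EFinP; exact: mFs.
Qed.

End energy.
Arguments energy_density {R n} s u v z.
Arguments finite_energy {R n} s u.

(** * Fractional Laplacian of the cutoff *)

(** Second differences are integrated in this form to avoid subtracting integrals
    that may be infinite. *)
Lemma ge0_le_integralDD d (T : measurableType d) (R : realType)
    (mu : {measure set T -> \bar R}) (f f1 f2 f3 : T -> \bar R) :
  measurable_fun setT f -> measurable_fun setT f1 -> measurable_fun setT f2 ->
  measurable_fun setT f3 ->
  (forall x, 0 <= f x)%E -> (forall x, 0 <= f1 x)%E -> (forall x, 0 <= f2 x)%E ->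
  (forall x, 0 <= f3 x)%E ->
  (forall x, f x + f x <= f1 x + f2 x + f3 x)%E ->
  (\int[mu]_x f x + \int[mu]_x f x <=
   \int[mu]_x f1 x + \int[mu]_x f2 x + \int[mu]_x f3 x)%E.
Proof.
move=> mf mf1 mf2 mf3 f0 f10 f20 f30 le_f.
have m12 : measurable_fun setT (fun x => f1 x + f2 x)%E by exact: emeasurable_funD.
have f120 x : (0 <= f1 x + f2 x)%E by exact: adde_ge0.
rewrite -(ge0_integralD _ measurableT (fun x _ => f0 x) mf (fun x _ => f0 x) mf).
rewrite -(ge0_integralD _ measurableT (fun x _ => f10 x) mf1 (fun x _ => f20 x) mf2).
rewrite -(ge0_integralD _ measurableT (fun x _ => f120 x) m12 (fun x _ => f30 x) mf3).
apply: ge0_le_integral => //.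
- by move=> x _; exact: adde_ge0.
- exact: emeasurable_funD.
- exact: emeasurable_funD.
Qed.

Section cutoff_energy.
Context {R : realType} {n : nat} {s : R}.
Hypothesis s01 : (0 < s < 1)%R.
Local Notation leb := (@lebesgue_rV R n).
Local Notation X := ('rV[R]_n).
Local Notation K := (@frac_kernel R n s).
Implicit Types (f g u v : X -> R) (c x y : X) (r a b : R).

Let far m : set X := [set z | m.+1%:R^-1 <= enorm z].

(** Away from the diagonal the kernel is integrable, and the increments can be
    expanded into their terms. *)
Let Km m (z : X) : R := \1_(far m) z * K z.

Let measurable_far m : measurable (far m).
Proof.
rewrite -[X in measurable X]setTI.
rewrite (_ : far m = @enorm R n @^-1` `[m.+1%:R^-1, +oo[).
  by apply: measurable_enorm => //; exact: measurable_itv.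
by apply/seteqP; split => x /=; rewrite in_itv/= andbT.
Qed.

Let Km_ge0 m z : 0 <= Km m z.
Proof. by rewrite mulr_ge0// frac_kernel_ge0. Qed.

Let measurable_Km m : measurable_fun setT (Km m).
Proof.
apply: measurable_funM; first exact: measurable_indic.
exact: measurable_frac_kernel.
Qed.

Let KmN m z : Km m (- z) = Km m z.
Proof.
rewrite /Km frac_kernelN !indicE; congr (_%:R * _); congr nat_of_bool.
by apply/idP/idP; rewrite !inE /far /= enormN.
Qed.

Let Km_le m z : Km m z <= K z.
Proof. by rewrite /Km ler_piMl ?frac_kernel_ge0// indicE lern1 leq_b1. Qed.

Let Km_lty m : (\int[leb]_z (Km m z)%:E < +oo)%E.
Proof.
have m0 : (0 : R) < m.+1%:R^-1 by rewrite invr_gt0.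
apply: (@le_lt_trans _ _ (\int[leb]_z
    (Num.min 1 ((enorm z / m.+1%:R^-1) ^+ 2) * K z)%:E)%E); last first.
  by rewrite frac_moment_scaled// ltry.
apply: ge0_le_integral => //.
- by move=> z _; rewrite lee_fin.
- exact/measurable_EFinP.
- apply/measurable_EFinP/measurable_funM; last exact: measurable_frac_kernel.
  apply: measurable_minr => //; apply: measurable_funX; apply: measurable_funM => //.
  exact: measurable_enorm.
- move=> z _; rewrite lee_fin ler_wpM2r ?frac_kernel_ge0// le_min !indicE.
  have [|_] := boolP (z \in far m); last by rewrite ler01 sqr_ge0.
  rewrite inE /far /= => mz; rewrite lexx/= expr_ge1 ?divr_ge0 ?enorm_ge0 ?(ltW m0)//.
  by rewrite ler_pdivlMr// mul1r.
Qed.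

Section truncated.
Variables (g : X -> R) (c : X) (r M : R) (m : nat).
Hypothesis r0 : 0 < r.
Hypothesis mg : measurable_fun setT g.
Hypothesis g0M : forall x, 0 <= g x <= M.
Local Notation eta := (cutoff c r).

Let g0 x : 0 <= g x. Proof. by have /andP[] := g0M x. Qed.
Let gM x : g x <= M. Proof. by have /andP[] := g0M x. Qed.
Let M0 : 0 <= M. Proof. by have /andP[/le_trans + /[dup] h _] := g0M 0; apply. Qed.

(** By symmetry the form with kernel [Km m] is twice the integral of [A - B]. *)
Let A (z : X * X) := g z.1 * eta z.1 * Km m (z.1 - z.2).
Let B (z : X * X) := g z.1 * eta z.2 * Km m (z.1 - z.2).
Let C := (frac_moment n s / r `^ (2 * s))%:E.

Let eta0 x : 0 <= eta x. Proof. exact: cutoff_ge0. Qed.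
Let A0 z : 0 <= A z. Proof. by rewrite /A mulr_ge0// mulr_ge0. Qed.
Let B0 z : 0 <= B z. Proof. by rewrite /B mulr_ge0// mulr_ge0. Qed.

Let meta : measurable_fun setT eta. Proof. exact: measurable_cutoff. Qed.

Let mKd : measurable_fun [set: X * X] (fun z => Km m (z.1 - z.2)).
Proof. by apply: measurableT_comp => //; exact: measurable_diff. Qed.

Let mA : measurable_fun setT A.
Proof.
apply: measurable_funM; last exact: mKd.
by apply: measurable_funM; apply: measurableT_comp.
Qed.

Let mB : measurable_fun setT B.
Proof.
apply: measurable_funM; last exact: mKd.
by apply: measurable_funM; apply: measurableT_comp.
Qed.

Let int_cutoff_kernel_lty :
  (\int[leb \x leb]_z (M * eta z.1 * Km m (z.1 - z.2)%R)%:E < +oo)%E.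
Proof.
rewrite (ge0_integral_convolution (g := fun x => M * eta x) (h := Km m))//.
- apply: lte_mul_pinfty.
  + by apply: integral_ge0 => x _; rewrite lee_fin mulr_ge0.
  + rewrite ge0_fin_numE; last by apply: integral_ge0 => x _; rewrite lee_fin mulr_ge0.
    apply: (@le_lt_trans _ _ (\int[leb]_(x in eball c r) (cst M%:E x))%E).
      rewrite [leRHS]integral_mkcond; apply: ge0_le_integral => //.
      * by move=> x _; rewrite lee_fin mulr_ge0.
      * exact/measurable_EFinP/measurable_funM.
      * apply/(measurable_restrictT _ _).1; first exact: measurable_eball.
        exact: measurable_cst.
      * move=> x _; have := cutoff_le_indic c x r0.
        rewrite /patch indicE; case: (x \in _) => /= ex; rewrite lee_fin.
          by rewrite ler_piMr.
        by rewrite (le_trans (ler_wpM2l M0 ex))// mulr0.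
    rewrite integral_cst//; last exact: measurable_eball.
    by rewrite [X in (_ * X)%E](lebesgue_eball c r0) -EFinM ltry.
  + exact: Km_lty.
- exact: measurable_funM.
- by move=> x; rewrite mulr_ge0.
Qed.

Let int_A_lty : (\int[leb \x leb]_z (A z)%:E < +oo)%E.
Proof.
apply: le_lt_trans int_cutoff_kernel_lty; apply: ge0_le_integral => //.
- by move=> z _; rewrite lee_fin.
- exact/measurable_EFinP.
- apply/measurable_EFinP/measurable_funM; last exact: mKd.
  by apply: measurable_funM => //; apply: measurableT_comp.
- by move=> z _; rewrite lee_fin ler_wpM2r// ler_wpM2r.
Qed.

Let int_B_lty : (\int[leb \x leb]_z (B z)%:E < +oo)%E.
Proof.
apply: le_lt_trans int_cutoff_kernel_lty.
have mF : measurable_fun [set: X * X] (fun z => (M * eta z.1 * Km m (z.1 - z.2)%R)%:E).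
  apply/measurable_EFinP/measurable_funM; last exact: mKd.
  by apply: measurable_funM => //; apply: measurableT_comp.
have F0 (z : X * X) : (0 <= (M * eta z.1 * Km m (z.1 - z.2)%R)%:E)%E.
  by rewrite lee_fin mulr_ge0// mulr_ge0.
rewrite -[leRHS](ge0_integral_swap mF F0).
apply: ge0_le_integral.
- exact: measurableT.
- by move=> z _; rewrite lee_fin.
- exact/measurable_EFinP.
- exact: (measurable_swap_rV mF).
- move=> z _; rewrite lee_fin /= /B -(opprB z.1 z.2) KmN.
  by rewrite ler_wpM2r// ler_wpM2r.
Qed.

Let weighted_le (e1 e2 e3 w p q k k' : R) : 2 * e1 <= e2 + e3 + 2 * (p * w) ->
  0 <= p -> 0 <= w -> 0 <= q -> 0 <= k -> k <= k' ->
  q * e1 * k + q * e1 * k <= q * e2 * k + q * e3 * k + 2 * (p * q) * (w * k').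
Proof.
move=> e123 p0 w0 q0 k0 kk'.
have qk0 : 0 <= q * k by exact: mulr_ge0.
have h1 : 0 <= (q * k) * (e2 + e3 + 2 * (p * w) - 2 * e1).
  by rewrite mulr_ge0// subr_ge0.
have h2 : 0 <= (p * q * w) * (k' - k).
  by rewrite mulr_ge0 ?subr_ge0// mulr_ge0// mulr_ge0.
lra.
Qed.

Let second_difference_le x z :
  g x * eta x * Km m z + g x * eta x * Km m z <=
  g x * eta (x + z) * Km m z + g x * eta (x - z) * Km m z +
  2 * (\1_(eball c r) x * g x) * (Num.min 1 ((enorm z / r) ^+ 2) * K z).
Proof.
apply: weighted_le.
- exact: cutoff_second_difference.
- by rewrite indicE.
- by rewrite le_min ler01 sqr_ge0.
- exact: g0.
- exact: Km_ge0.
- exact: Km_le.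
Qed.

(** Pairing the increments [z] and [- z] trades the first differences of the
    cutoff for second differences: for fixed [x], the integral of [B] is the same
    with [eta (x + z)] and with [eta (x - z)]. *)
Let int_A_le : (\int[leb \x leb]_z (A z)%:E + \int[leb \x leb]_z (A z)%:E <=
  \int[leb \x leb]_z (B z)%:E + \int[leb \x leb]_z (B z)%:E +
  2%:E * C * \int[leb]_x (\1_(eball c r) x * g x)%:E)%E.
Proof.
have mAE : measurable_fun setT (EFin \o A) by exact/measurable_EFinP.
have mBE : measurable_fun setT (EFin \o B) by exact/measurable_EFinP.
have AE0 z : (0 <= (EFin \o A) z)%E by rewrite lee_fin.
have BE0 z : (0 <= (EFin \o B) z)%E by rewrite lee_fin.
have mFA := measurable_fun_fubini_tonelli_F (m2 := leb) _ mAE AE0.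
have mFB := measurable_fun_fubini_tonelli_F (m2 := leb) _ mBE BE0.
have FA0 x : (0 <= fubini_F leb (EFin \o A) x)%E by apply: integral_ge0.
have FB0 x : (0 <= fubini_F leb (EFin \o B) x)%E by apply: integral_ge0.
have mB1 : measurable_fun setT (fun x => (\1_(eball c r) x * g x)%:E).
  apply/measurable_EFinP/measurable_funM => //; apply: measurable_indic.
  exact: measurable_eball.
have C0 : (0 <= C)%E by rewrite lee_fin divr_ge0 ?frac_moment_ge0 ?powR_ge0.
have B10 x : (0 <= (\1_(eball c r) x * g x)%:E)%E by rewrite lee_fin mulr_ge0.
have w0 x : (0 <= (2 * (\1_(eball c r) x * g x))%:E)%E.
  by rewrite lee_fin pmulr_rge0// -lee_fin; exact: B10.
rewrite (fubini_tonelli1 _ mAE AE0) (fubini_tonelli1 _ mBE BE0).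
rewrite -ge0_integralZl//; last by rewrite mule_ge0.
apply: ge0_le_integralDD.
- exact: mFA.
- exact: mFB.
- exact: mFB.
- exact: measurable_funeM.
- exact: FA0.
- exact: FB0.
- exact: FB0.
- by move=> x; rewrite mule_ge0// mule_ge0.
move=> x.
have mxz : measurable_fun setT (fun z : X => eta (x - z)).
  by apply: measurableT_comp => //; exact: measurable_rV_sub.
have mxz' : measurable_fun setT (fun z : X => eta (x + z)).
  apply: measurableT_comp => //; have := measurable_rV_affine x 1.
  by under eq_fun do rewrite scale1r.
pose a z := (g x * eta x * Km m z)%:E.
pose b z := (g x * eta (x - z) * Km m z)%:E.
pose b' z := (g x * eta (x + z) * Km m z)%:E.
pose h z := (Num.min 1 ((enorm z / r) ^+ 2) * K z)%:E.
have ma : measurable_fun setT a by apply/measurable_EFinP/measurable_funM.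
have mb : measurable_fun setT b.
  by apply/measurable_EFinP/measurable_funM => //; exact: measurable_funM.
have mb' : measurable_fun setT b'.
  by apply/measurable_EFinP/measurable_funM => //; exact: measurable_funM.
have mh : measurable_fun setT h.
  apply/measurable_EFinP/measurable_funM; last exact: measurable_frac_kernel.
  apply: measurable_minr => //; apply: measurable_funX; apply: measurable_funM => //.
  exact: measurable_enorm.
have a0 z : (0 <= a z)%E by rewrite lee_fin mulr_ge0// mulr_ge0.
have b0 z : (0 <= b z)%E by rewrite lee_fin mulr_ge0// mulr_ge0.
have b'0 z : (0 <= b' z)%E by rewrite lee_fin mulr_ge0// mulr_ge0.
have h0 z : (0 <= h z)%E.
  by rewrite lee_fin mulr_ge0 ?frac_kernel_ge0// le_min ler01 sqr_ge0.
have -> : fubini_F leb (EFin \o A) x = (\int[leb]_z a z)%E.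
  rewrite -(ge0_integral_reflection x ma a0); apply: eq_integral => y _.
  by rewrite /A /a.
have Eb : fubini_F leb (EFin \o B) x = (\int[leb]_z b z)%E.
  rewrite -(ge0_integral_reflection x mb b0); apply: eq_integral => y _.
  by rewrite /B /b /= subKr.
have Eb' : (\int[leb]_z b z)%E = (\int[leb]_z b' z)%E.
  rewrite -(ge0_integral_reflection 0 mb b0); apply: eq_integral => y _.
  by rewrite /b /b' sub0r opprK KmN.
rewrite Eb [X in (_ <= X + _ + _)%E]Eb'.
have -> : (2%:E * C * (\1_(eball c r) x * g x)%:E =
    (2 * (\1_(eball c r) x * g x))%:E * \int[leb]_z h z)%E.
  by rewrite (frac_moment_scaled s01 r0) -!EFinM; congr EFin; ring.
rewrite -(ge0_integralZl leb measurableT mh (fun z _ => h0 z) (w0 x)).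
apply: ge0_le_integralDD.
- exact: ma.
- exact: mb'.
- exact: mb.
- exact: measurable_funeM.
- exact: a0.
- exact: b'0.
- exact: b0.
- by move=> z; exact: mule_ge0 (w0 x) (h0 z).
by move=> z; rewrite /a /b /b' /h -EFinM -!EFinD lee_fin; exact: second_difference_le.
Qed.

Let int_swap (F : X * X -> R) : measurable_fun setT F -> (forall z, 0 <= F z) ->
  (\int[leb \x leb]_z (F z)%:E < +oo)%E ->
  (leb \x leb)%E.-integrable setT (fun z => (F z + F (z.2, z.1))%:E) /\
  (\int[leb \x leb]_z (F z + F (z.2, z.1))%:E =
    \int[leb \x leb]_z (F z)%:E + \int[leb \x leb]_z (F z)%:E)%E.
Proof.
move=> mF F0 Foo.
have mFE : measurable_fun setT (EFin \o F) by exact/measurable_EFinP.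
have FE0 z : (0 <= (EFin \o F) z)%E by rewrite lee_fin.
have mFs : measurable_fun setT (fun z => (F (z.2, z.1))%:E).
  exact: (measurable_swap_rV mFE).
have E : (\int[leb \x leb]_z (F z + F (z.2, z.1))%:E =
    \int[leb \x leb]_z (F z)%:E + \int[leb \x leb]_z (F z)%:E)%E.
  rewrite -[X in (_ = _ + X)%E](ge0_integral_swap mFE FE0) -ge0_integralD//.
  by move=> z _; rewrite lee_fin.
split=> //; apply/integrableP; split; first exact: (emeasurable_funD mFE mFs).
rewrite (_ : (\int[_]_(_ in _) _)%E =
  (\int[leb \x leb]_z (F z + F (z.2, z.1))%:E)%E); last first.
  by apply: eq_integral => z _; rewrite /= ger0_norm// addr_ge0.
by rewrite E lte_add_pinfty.
Qed.

Lemma truncated_gagliardo_cutoff_le :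
  (\int[leb \x leb]_z ((g z.1 - g z.2) * (eta z.1 - eta z.2) * Km m (z.1 - z.2))%:E <=
   2%:E * C * \int[leb]_x (\1_(eball c r) x * g x)%:E)%E.
Proof.
have [iA EA] := int_swap mA A0 int_A_lty.
have [iB EB] := int_swap mB B0 int_B_lty.
rewrite (_ : (\int[_]_z _)%E =
   (\int[leb \x leb]_z ((A z + A (z.2, z.1))%:E - (B z + B (z.2, z.1))%:E))%E); last first.
  apply: eq_integral => z _; rewrite -EFinB; congr EFin.
  by rewrite /A /B /= -(opprB z.1 z.2) KmN; ring.
rewrite integralB// EA EB leeBlDr; last first.
  rewrite ge0_fin_numE; first exact: lte_add_pinfty.
  by rewrite adde_ge0//; apply: integral_ge0 => z _; rewrite lee_fin.
by rewrite [leRHS]addeC; exact: int_A_le.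
Qed.

End truncated.

(** One-sided bound for the fractional Laplacian of the cutoff, in weak form: it
    is at most a constant times [r ^ (- 2 s)] inside the support and nonpositive
    outside.  The singularity is handled by removing a small neighbourhood of
    the diagonal, whose contribution tends to 0 by dominated convergence. *)
Lemma gagliardo_cutoff_le g c r (M : R) : 0 < r ->
  finite_energy s g -> (forall x, 0 <= g x <= M) ->
  (gagliardo s g (cutoff c r) <=
   (2 * (frac_moment n s / r `^ (2 * s)))%:E *
   \int[leb]_x (\1_(eball c r) x * g x)%:E)%E.
Proof.
move=> r0 Eg gM; have [mg _] := Eg.
have Eeta := finite_energy_cutoff s01 c r0.
have /integrable_abse iE := integrable_energy_density Eg Eeta.
pose F m (z : X * X) :=
  ((g z.1 - g z.2) * (cutoff c r z.1 - cutoff c r z.2) * Km m (z.1 - z.2))%:E.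
have mF m : measurable_fun setT (F m).
  apply/measurable_EFinP/measurable_funM.
    by apply: measurable_funM; apply: measurable_increment => //; exact: measurable_cutoff.
  by apply: measurableT_comp => //; exact: measurable_diff.
have FE z : F ^~ z @ \oo --> (energy_density s g (cutoff c r) z)%:E.
  apply: cvg_near_cst; have [z12|z12] := eqVneq (z.1 - z.2) 0.
    apply: nearW => m; rewrite /F /energy_density z12.
    by rewrite /Km frac_kernel0// !mulr0.
  have zp : 0 < enorm (z.1 - z.2) by rewrite lt_neqAle enorm_ge0 eq_sym enorm_eq0 z12.
  near=> m; rewrite /F /energy_density /Km indicE mem_set ?mul1r// /far /= ltW//.
  by near: m; exact: (near_infty_natSinv_lt (PosNum zp)).
have dom m (z : X * X) :
    (`|F m z| <= (abse \o (EFin \o energy_density s g (cutoff c r))) z)%E.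
  rewrite /F /energy_density /= lee_fin normrM [leRHS]normrM ler_wpM2l//.
  by rewrite (ger0_norm (Km_ge0 _ _)) (ger0_norm (frac_kernel_ge0 _ _)) Km_le.
have fin (z : X * X) :
    (abse \o (EFin \o energy_density s g (cutoff c r))) z \is a fin_num by [].
have FI := dominated_cvg measurableT mF (fun z _ => FE z) (fun z _ => fin z)
  iE (fun m z _ => dom m z).
rewrite gagliardoE -(cvg_lim _ FI)//; apply: lime_le.
  by apply/cvg_ex; eexists; exact: FI.
apply: nearW => m; rewrite EFinM.
exact: truncated_gagliardo_cutoff_le gM.
Unshelve. all: by end_near.
Qed.

End cutoff_energy.

(** * Flux through a level *)
Section level_truncation.
Context {R : realType}.
Implicit Types (a b k : R).

(** [above k] is a nonincreasing profile vanishing above [k], by which test functions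
    are multiplied, and [below k] is its primitive vanishing at 0, which is concave
    and constant above [k]: a differentiable substitute for [min t k]. *)
Definition above k a : R := Num.max 0 (1 - a / k).
Definition below k a : R := k / 2 * (1 - above k a ^+ 2).

Lemma above_ge0 k a : 0 <= above k a.
Proof. by rewrite le_max lexx. Qed.

Lemma above_le1 k a : 0 < k -> 0 <= a -> above k a <= 1.
Proof.
by move=> k0 a0; rewrite ge_max ler01 lerBlDr lerDl divr_ge0// ltW.
Qed.

Lemma above_eq0 k a : 0 < k -> k <= a -> above k a = 0.
Proof. by move=> k0 ka; rewrite /above max_l// subr_le0 ler_pdivlMr// mul1r. Qed.

Lemma above_lipschitz k a b : 0 < k -> `|above k a - above k b| <= k^-1 * `|a - b|.
Proof.
move=> k0.
wlog ab : a b / a <= b.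
  move=> H; have /orP[/H//|/H] := le_total a b.
  by rewrite distrC (distrC b).
have kab : a / k <= b / k by rewrite ler_pM2r ?invr_gt0.
rewrite [`|a - b|]ler0_norm ?subr_le0// opprB mulrC mulrBl.
rewrite /above; move: kab; move: (a / k) (b / k) => t u tu.
by rewrite ger0_norm; have [?|?] := leP 0 (1 - t); have [?|?] := leP 0 (1 - u); lra.
Qed.

Lemma below_ge0 k a : 0 < k -> 0 <= a -> 0 <= below k a.
Proof.
move=> k0 a0; rewrite mulr_ge0 ?divr_ge0 ?(ltW k0)// subr_ge0.
by rewrite expr_le1 ?above_ge0// above_le1.
Qed.

Lemma below_le_min k a : 0 < k -> 0 <= a -> below k a <= Num.min a k.
Proof.
move=> k0 a0; rewrite le_min /below; have f0 := above_ge0 k a.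
have f1 : k * (1 - above k a) <= a.
  have : 1 - a / k <= above k a by rewrite le_max lexx orbT.
  by rewrite lerBlDr -lerBlDl ler_pdivlMr// mulrC.
move: (above k a) f0 f1 (above_le1 k0 a0) => f f0 f1 f2.
by apply/andP; split; nra.
Qed.

Lemma below_le k a : 0 < k -> 0 <= a -> below k a <= k.
Proof.
by move=> k0 a0; rewrite (le_trans (below_le_min k0 a0))// ge_min lexx orbT.
Qed.

Lemma below_lipschitz k a b : 0 < k -> 0 <= a -> 0 <= b ->
  `|below k a - below k b| <= `|a - b|.
Proof.
move=> k0 a0 b0; have := above_lipschitz a b k0.
have := above_ge0 k a; have := above_ge0 k b.
have := above_le1 k0 a0; have := above_le1 k0 b0.
rewrite /below; move: (above k a) (above k b) => f g g1 f1 g0 f0 fg.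
rewrite (_ : _ - _ = (k / 2 * (f + g)) * (g - f)); last by ring.
rewrite normrM ger0_norm ?mulr_ge0 ?addr_ge0 ?divr_ge0 ?(ltW k0)//.
have kfg : k * `|f - g| <= `|a - b| by rewrite mulrC -ler_pdivlMr// mulrC.
rewrite distrC; apply: le_trans kfg; rewrite ler_wpM2r//.
nra.
Qed.

(** Concavity of [below k], whose derivative is [above k]. *)
Let below_concave k a b : 0 < k -> 0 <= a ->
  below k b - below k a <= above k a * (b - a).
Proof.
move=> k0 a0.
have gb : k * (1 - above k b) <= b.
  have : 1 - b / k <= above k b by rewrite le_max lexx orbT.
  by rewrite lerBlDr -lerBlDl ler_pdivlMr// mulrC.
have ga : above k a * a = above k a * (k * (1 - above k a)).
  have [ka|ka] := leP k a; first by rewrite above_eq0// !mul0r.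
  congr (_ * _); rewrite /above max_r; first by field; lra.
  by rewrite subr_ge0 ler_pdivrMr// mul1r ltW.
have f0 := above_ge0 k a.
rewrite mulrBr ga /below; move: (above k a) (above k b) f0 gb => f g f0 gb.
have h1 : f * (k * (1 - g)) <= f * b by rewrite ler_wpM2l.
have h2 : 0 <= k * (f - g) ^+ 2 by rewrite mulr_ge0 ?sqr_ge0// ltW.
lra.
Qed.

Let below_gap k a b : 0 < k -> k <= a -> 0 <= b -> b <= k / 2 ->
  k / 8 <= below k a - below k b.
Proof.
move=> k0 ka b0 bk; rewrite /below (above_eq0 k0 ka).
have : 2^-1 <= above k b.
  by rewrite le_max; apply/orP; right; rewrite lerBrDr -lerBrDl ler_pdivrMr//; lra.
move: (above k b) => g g2.
have : 0 <= k * ((g - 2^-1) * (g + 2^-1)).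
  by rewrite mulr_ge0 ?(ltW k0)// mulr_ge0//; lra.
lra.
Qed.

(** By concavity of [below k], testing [u] with [above k u * eta] gives at most the
    result of testing [below k u] with [eta].  The difference is a flux through the
    level [k]; between points where [u >= k] and points where [u <= k / 2] it is
    bounded below. *)
Lemma above_increment_le k a b (t t' : R) : 0 < k -> 0 <= a -> 0 <= b -> 0 <= t -> 0 <= t' ->
  (a - b) * (above k a * t - above k b * t') +
    k / 8 * (t * (k <= a)%R%:R * (b <= k / 2)%R%:R) <=
  (below k a - below k b) * (t - t').
Proof.
move=> k0 a0 b0 t0 t'0.
have c1 : t' * (below k a - below k b) <= t' * (above k b * (a - b)).
  by rewrite ler_wpM2l// below_concave.
have c2 : t * (below k b - below k a) <= t * (above k a * (b - a)).
  by rewrite ler_wpM2l// below_concave.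
have [ka|_] := leP k a; last by rewrite mulr0 mul0r mulr0 addr0; lra.
have [bk|_] := leP b (k / 2); last by rewrite !mulr0 addr0; lra.
have c3 : t * (k / 8) <= t * (below k a - below k b).
  by rewrite ler_wpM2l// below_gap.
rewrite !mulr1 (above_eq0 k0 ka) mul0r sub0r; lra.
Qed.

End level_truncation.

Section defect.
Context {R : realType} {n : nat} {s : R}.
Hypothesis s01 : (0 < s < 1)%R.
Local Notation leb := (@lebesgue_rV R n).
Local Notation X := ('rV[R]_n).
Local Notation K := (@frac_kernel R n s).
Implicit Types (f g u v : X -> R) (c x y : X) (r k h : R).

Lemma gagliardo_fin_num u v : finite_energy s u -> finite_energy s v ->
  gagliardo s u v \is a fin_num.
Proof.
move=> Eu Ev; rewrite gagliardoE.
exact: (integrable_fin_num measurableT (integrable_energy_density Eu Ev)).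
Qed.

(** Pointwise inequalities between energy densities are integrated without losing
    the defect [W], which is the gain in both applications. *)
Lemma gagliardo_defect u1 v1 u2 v2 (W : X * X -> R) (a : R) :
  finite_energy s u1 -> finite_energy s v1 ->
  finite_energy s u2 -> finite_energy s v2 ->
  measurable_fun setT W -> (forall z, 0 <= W z) ->
  (forall z, W z + energy_density s u1 v1 z <= a * energy_density s u2 v2 z) ->
  (\int[leb \x leb]_z (W z)%:E + gagliardo s u1 v1 <= a%:E * gagliardo s u2 v2)%E.
Proof.
move=> Eu1 Ev1 Eu2 Ev2 mW W0 leW.
have i1 := integrable_energy_density Eu1 Ev1.
have i2 := integrableZl measurableT a (integrable_energy_density Eu2 Ev2).
rewrite -leeBrDr; last exact: gagliardo_fin_num.
have -> : (a%:E * gagliardo s u2 v2 - gagliardo s u1 v1 =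
  \int[leb \x leb]_z (a%:E * (energy_density s u2 v2 z)%:E - (energy_density s u1 v1 z)%:E))%E.
  rewrite integralB//; congr (_ - _)%E.
  by rewrite integralZl//; exact: integrable_energy_density.
have /integrableP[mi _] := integrableB measurableT i2 i1.
apply: ge0_le_integral => //.
- by move=> z _; rewrite lee_fin.
- exact/measurable_EFinP.
- by move=> z _; rewrite -EFinM -EFinB lee_fin lerBrDr.
Qed.

Lemma ge0_integral_tensor (f g : X -> R) :
  measurable_fun setT f -> measurable_fun setT g ->
  (forall x, 0 <= f x) -> (forall x, 0 <= g x) ->
  (\int[leb \x leb]_z (f z.1 * g z.2)%:E =
   \int[leb]_x (f x)%:E * \int[leb]_x (g x)%:E)%E.
Proof.
move=> mf mg f0 g0.
have I0 : (0 <= \int[leb]_x (g x)%:E)%E by apply: integral_ge0 => x _; rewrite lee_fin.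
rewrite fubini_tonelli1; last 2 first.
- by apply/measurable_EFinP/measurable_funM; exact: measurableT_comp.
- by move=> z; rewrite lee_fin mulr_ge0.
rewrite -ge0_integralZr//; last 2 first.
- exact/measurable_EFinP.
- by move=> x _; rewrite lee_fin.
apply: eq_integral => x _; rewrite /fubini_F /=.
rewrite -ge0_integralZl ?lee_fin//.
- exact/measurable_EFinP.
- by move=> y _; rewrite lee_fin.
Qed.

Variable v : X -> R.
Hypothesis Ev : finite_energy s v.
Hypothesis v0 : forall x, 0 <= v x.

Let mv : measurable_fun setT v. Proof. by case: Ev. Qed.

Section level.
Variables (k r : R).
Hypotheses (k0 : 0 < k) (r0 : 0 < r).

(** The cutoff is switched off where [v] exceeds [k], so as not to see the absorption
    there. *)
Definition level_test x : R := above k (v x) * cutoff 0 r x.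

Lemma level_test_bound x : 0 <= level_test x <= \1_(eball 0 r) x.
Proof.
rewrite mulr_ge0 ?above_ge0 ?cutoff_ge0//= (le_trans _ (cutoff_le_indic 0 x r0))//.
by rewrite ler_piMl ?cutoff_ge0// above_le1.
Qed.

Let measurable_above : measurable_fun setT (fun x => above k (v x)).
Proof.
by apply: measurable_maxr => //; apply: measurable_funB => //; exact: measurable_funM.
Qed.

Let product_increment (p p' t t' d d' : R) : 0 <= p' -> p' <= 1 -> 0 <= t -> t <= 1 ->
  `|p - p'| <= d -> `|t - t'| <= d' -> `|p * t - p' * t'| <= d + 1 * d'.
Proof.
move=> p'0 p'1 t0 t1 pd td.
rewrite (_ : p * t - p' * t' = (p - p') * t + p' * (t - t')); last by ring.
rewrite (le_trans (ler_normD _ _))// !normrM (ger0_norm t0) (ger0_norm p'0).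
by apply: lerD; [rewrite (le_trans _ pd)// ler_piMr|rewrite ler_pM].
Qed.

Lemma finite_energy_level_test : finite_energy s level_test.
Proof.
have Eeta := finite_energy_cutoff s01 (0 : X) r0.
apply: (finite_energy_le (a := k^-1) (b := 1) Ev Eeta).
  by apply: measurable_funM => //; exact: measurable_cutoff.
move=> x y; apply: product_increment.
- exact: above_ge0.
- exact: above_le1.
- exact: cutoff_ge0.
- exact: cutoff_le1.
- exact: above_lipschitz.
- exact: lexx.
Qed.

(** The set [v <= k / 2] in the ball of radius [r2] receives a flux from the ball of
    radius [r1], along distances of at most [r1 + r2].  For a supersolution
    [E(v, level_test)] is at least minus the absorption, so what is not absorbed is
    accounted for by the mass at the scale [r] of the cutoff. *)
Lemma level_flux_le r1 r2 : 0 < r1 -> 2 * r1 <= r -> 0 < r2 ->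
  (forall x, enorm x < r1 -> k <= v x) ->
  ((k / 16 * (ball_volume R n * r1 ^+ n) / (r1 + r2) `^ (n%:R + 2 * s))%:E *
     leb (eball 0 r2 `&` [set y | v y <= k / 2]%R) + gagliardo s v level_test <=
   (2 * (frac_moment n s / r `^ (2 * s)))%:E *
     \int[leb]_x (\1_(eball 0 r) x * Num.min (v x) k)%:E)%E.
Proof.
move=> r10 r1r r20 kv.
pose S := eball (0 : X) r2 `&` [set y | v y <= k / 2]%R.
pose q := n%:R + 2 * s.
(* The flux across the gap is [k / 8], and the cutoff at least 1 / 2 as [2 r1 <= r]. *)
pose w := k / 16 * ((r1 + r2) `^ q)^-1.
have flux_le x y : w * (\1_(eball 0 r1) x * \1_S y) <=
    k / 8 * (cutoff 0 r x * (k <= v x)%R%:R * (v y <= k / 2)%R%:R) * K (x - y).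
  have rhs0 : 0 <= k / 8 * (cutoff 0 r x * (k <= v x)%R%:R * (v y <= k / 2)%R%:R) * K (x - y).
    apply: mulr_ge0; last exact: frac_kernel_ge0.
    apply: mulr_ge0; first by apply: divr_ge0 => //; exact: ltW.
    by apply: mulr_ge0 => //; apply: mulr_ge0 => //; exact: cutoff_ge0.
  rewrite !indicE; have [xB|_] := boolP (x \in _); last by rewrite mul0r mulr0.
  have [yS|_] := boolP (y \in _); last by rewrite !mulr0.
  move: xB yS; rewrite !inE /S /eball /= !subr0 => xB [yB yk] {rhs0}.
  have vx := kv x xB; rewrite vx yk !mulr1 /w.
  have xy : x - y != 0.
    apply/eqP => /subr0_eq xy; have : v x <= k / 2 by rewrite xy.
    by apply/negP; rewrite -ltNge (lt_le_trans _ vx)// ltr_pdivrMr// ltr_pMr// ltr1n.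
  have dxy : enorm (x - y) <= r1 + r2.
    by rewrite (le_trans (enormD_le _ _))// enormN lerD// ltW.
  have Kxy := le_frac_kernel s01 xy dxy.
  have hx : 2^-1 <= cutoff 0 r x.
    by apply: cutoff_half => //; rewrite subr0; lra.
  have -> : k / 16 / (r1 + r2) `^ q = k / 8 * 2^-1 * ((r1 + r2) `^ q)^-1.
    by field; rewrite gt_eqF// powR_gt0//; lra.
  apply: ler_pM => //.
  - by apply: mulr_ge0 => //; apply: divr_ge0 => //; exact: ltW.
  - by rewrite invr_ge0 powR_ge0.
  - by rewrite ler_wpM2l// divr_ge0// ltW.
have mS : measurable S by exact: measurable_sublevel_ball.
have mB : measurable (eball (0 : X) r1) by exact: measurable_eball.
have w0 : 0 <= w.
  apply: mulr_ge0; last by rewrite invr_ge0; exact: powR_ge0.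
  by apply: divr_ge0 => //; exact: ltW.
pose W (z : X * X) := w * (\1_(eball 0 r1) z.1 * \1_S z.2).
have mBS : measurable_fun setT (fun z : X * X => \1_(eball 0 r1) z.1 * \1_S z.2 : R).
  by apply: measurable_funM; apply: measurableT_comp => //; exact: measurable_indic.
have mW : measurable_fun setT W by exact: measurable_funM.
have W0 z : 0 <= W z by rewrite /W mulr_ge0// mulr_ge0.
have EW : (\int[leb \x leb]_z (W z)%:E = (k / 16 * (ball_volume R n * r1 ^+ n) /
    (r1 + r2) `^ q)%:E * leb S)%E.
  under eq_integral do rewrite EFinM.
  rewrite ge0_integralZl//.
  - rewrite (ge0_integral_tensor (f := \1_(eball 0 r1)) (g := \1_S))//.
    rewrite !integral_indic// !setIT [X in (_ * (X * _))%E](lebesgue_eball 0 r10).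
    by rewrite muleA -EFinM /w; congr (_%:E * _)%E; ring.
  - exact/measurable_EFinP.
pose g x := below k (v x).
have mg : measurable_fun setT g.
  by apply: measurable_funM => //; apply: measurable_funB => //; exact: measurable_funX.
have Eg : finite_energy s g.
  apply: (finite_energy_le (a := 1) (b := 0) Ev Ev mg) => x y.
  by rewrite mul1r mul0r addr0; exact: below_lipschitz.
have Eeta := finite_energy_cutoff s01 (0 : X) r0.
have WD z : W z + energy_density s v level_test z <=
    1 * energy_density s g (cutoff 0 r) z.
  case: z => x y; rewrite mul1r.
  have := ler_wpM2r (frac_kernel_ge0 s (x - y))
    (above_increment_le k0 (v0 x) (v0 y) (cutoff_ge0 0 r x) (cutoff_ge0 0 r y)).
  rewrite /energy_density /= mulrDl; apply: le_trans; rewrite addrC lerD2l.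
  exact: flux_le.
have := gagliardo_defect Ev finite_energy_level_test Eg Eeta mW W0 WD.
rewrite EW mul1e => /le_trans; apply.
have gk x : 0 <= g x <= k by rewrite /g below_ge0//= below_le.
apply: (le_trans (gagliardo_cutoff_le s01 0 r0 Eg gk)).
apply: lee_wpmul2l.
  by rewrite lee_fin mulr_ge0// divr_ge0 ?frac_moment_ge0 ?powR_ge0.
apply: ge0_le_integral => //.
- by move=> x _; rewrite lee_fin mulr_ge0//; have /andP[] := gk x.
- apply/measurable_EFinP/measurable_funM => //; apply: measurable_indic.
  exact: measurable_eball.
- apply/measurable_EFinP/measurable_funM; last exact: measurable_minr.
  apply: measurable_indic; exact: measurable_eball.
- by move=> x _; rewrite lee_fin ler_wpM2l// below_le_min.
Qed.

End level.
End defect.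

(** * Contact with the cutoff *)
Section contact.
Context {R : realType} {n : nat} {s : R}.
Hypothesis s01 : (0 < s < 1)%R.
Local Notation leb := (@lebesgue_rV R n).
Local Notation X := ('rV[R]_n).
Local Notation K := (@frac_kernel R n s).
Variable v : X -> R.
Hypothesis Ev : finite_energy s v.
Hypothesis v0 : forall x, 0 <= v x.
Variables (c : X) (r h : R).
Hypotheses (r0 : 0 < r) (h0 : 0 < h).

Let mv : measurable_fun setT v. Proof. by case: Ev. Qed.
Let meta : measurable_fun setT (cutoff c r). Proof. exact: measurable_cutoff. Qed.
Let Eeta : finite_energy s (cutoff c r). Proof. exact: finite_energy_cutoff. Qed.

Definition contact_test x : R := Num.max 0 (h * cutoff c r x - v x).

Let slack x : R := Num.max 0 (v x - h * cutoff c r x).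

Lemma contact_test_bound x : 0 <= contact_test x <= h * \1_(eball c r) x.
Proof.
rewrite le_max lexx /= ge_max; apply/andP; split.
  by apply: mulr_ge0 => //; exact: ltW.
rewrite lerBlDr (@le_trans _ _ (h * \1_(eball c r) x))//.
  by rewrite ler_wpM2l ?(ltW h0)// cutoff_le_indic.
by rewrite lerDl.
Qed.

Lemma contact_test_gt0 x : 0 < contact_test x -> eball c r x /\ v x < h.
Proof.
rewrite lt_max ltxx /= subr_gt0 => vh; split.
  rewrite /eball /= ltNge; apply/negP => /(cutoff_eq0 r0) e0.
  by move: vh; rewrite e0 mulr0 ltNge v0.
by rewrite (lt_le_trans vh)// ler_piMr ?(ltW h0)// cutoff_le1.
Qed.

Lemma measurable_contact_test : measurable_fun setT contact_test.
Proof. by apply: measurable_maxr => //; apply: measurable_funB => //; exact: measurable_funM. Qed.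

Let max0_lipschitz (a b : R) : `|Num.max 0 a - Num.max 0 b| <= `|a - b|.
Proof.
wlog ab : a b / a <= b.
  by move=> H; have /orP[/H//|/H] := le_total a b; rewrite distrC (distrC b).
rewrite [leRHS]ler0_norm ?subr_le0// ler0_norm ?subr_le0.
  by have [?|?] := leP 0 a; have [?|?] := leP 0 b; lra.
by rewrite ge_max !le_max lexx ab orbT.
Qed.

Lemma finite_energy_contact_test : finite_energy s contact_test.
Proof.
apply: (finite_energy_le (a := h) (b := 1) Eeta Ev measurable_contact_test) => x y.
rewrite (le_trans (max0_lipschitz _ _))// mul1r.
rewrite (_ : _ - _ = h * (cutoff c r x - cutoff c r y) - (v x - v y)); last by ring.
by rewrite (le_trans (ler_normB _ _))// normrM (gtr0_norm h0).
Qed.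

(** Here [a, b] are the values of [v] at two points and [p, q] those of [h eta].
    With [phi = (h eta - v)_+] and [psi = (v - h eta)_+] one has
    [v = h eta - phi + psi] and [phi psi = 0], so that
    [(v x - v y) (phi x - phi y)] is the increment of [h eta] against that of [phi]
    minus [(phi x - phi y) ^ 2 + phi x psi y + phi y psi x].  One of the cross terms
    is kept as the gain. *)
Let contact_increment_le (a b p q k : R) : 0 <= k ->
  Num.max 0 (p - a) * Num.max 0 (b - q) * k +
    (a - b) * (Num.max 0 (p - a) - Num.max 0 (q - b)) * k <=
  (Num.max 0 (p - a) - Num.max 0 (q - b)) * (p - q) * k.
Proof.
move=> k0; rewrite -mulrDl ler_wpM2r//.
have E (t : R) : t = Num.max 0 t - Num.max 0 (- t).
  by have [?|?] := leP 0 t; have [?|?] := leP 0 (- t); lra.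
have P (t : R) : Num.max 0 t * Num.max 0 (- t) = 0.
  by have [?|?] := leP 0 t; have [?|?] := leP 0 (- t); nra.
have M (t : R) : 0 <= Num.max 0 t by rewrite le_max lexx.
have := E (p - a); have := P (p - a); have := E (q - b); have := P (q - b).
rewrite !opprB.
have := M (p - a); have := M (a - p); have := M (q - b); have := M (b - q).
move: (Num.max 0 (p - a)) (Num.max 0 (a - p)) (Num.max 0 (q - b)) (Num.max 0 (b - q)).
move=> f g f' g' g'0 f'0 g0 f0 P' E' P0 E0.
have -> : a - b = p - q - (f - g) + (f' - g') by lra.
have := mulr_ge0 g0 f'0; have := sqr_ge0 (f - f'); nra.
Qed.

(** Every point of the contact set interacts with the mass of [psi = (v - h eta)_+] in
    the ball of radius [L]; this mass is at least [m] minus the integral of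
    [h eta]. *)
Lemma contact_flux_le L m : r <= L -> 0 <= m - h * (ball_volume R n * r ^+ n) ->
  (m%:E <= \int[leb]_x (\1_(eball c L) x * v x)%:E)%E ->
  (((m - h * (ball_volume R n * r ^+ n)) / (r + L) `^ (n%:R + 2 * s))%:E *
     \int[leb]_x (contact_test x)%:E + gagliardo s v contact_test <=
   (h * (2 * (frac_moment n s / r `^ (2 * s))))%:E *
     \int[leb]_x (contact_test x)%:E)%E.
Proof.
move=> rL; set d := m - _ => d0 mL.
have L0 : 0 < L by exact: lt_le_trans rL.
pose q := n%:R + 2 * s; pose w := ((r + L) `^ q)^-1.
have w0 : 0 <= w by rewrite invr_ge0; exact: powR_ge0.
have mL1 : measurable_fun setT (\1_(eball c L) : X -> R).
  by apply: measurable_indic; exact: measurable_eball.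
have mr1 : measurable_fun setT (\1_(eball c r) : X -> R).
  by apply: measurable_indic; exact: measurable_eball.
have mslack : measurable_fun setT slack.
  by apply: measurable_maxr => //; apply: measurable_funB => //; exact: measurable_funM.
pose psi x := \1_(eball c L) x * slack x.
have mpsi : measurable_fun setT psi by exact: measurable_funM.
have psi0 x : 0 <= psi x by rewrite mulr_ge0// le_max lexx.
have phi0 x : 0 <= contact_test x by have /andP[] := contact_test_bound x.
have Iphi0 : (0 <= \int[leb]_x (contact_test x)%:E)%E.
  by apply: integral_ge0 => x _; rewrite lee_fin.
have dpsi : (d%:E <= \int[leb]_x (psi x)%:E)%E.
  rewrite /d EFinB leeBlDr//; apply: (le_trans mL).
  have -> : ((h * (ball_volume R n * r ^+ n))%:E = \int[leb]_x (h * \1_(eball c r) x)%:E)%E.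
    under eq_integral do rewrite EFinM.
    rewrite ge0_integralZl// ?lee_fin ?(ltW h0)//; last exact/measurable_EFinP.
    rewrite integral_indic//; last exact: measurable_eball.
    by rewrite setIT [X in (_ * X)%E](lebesgue_eball c r0) EFinM.
  rewrite -ge0_integralD//.
  - apply: ge0_le_integral => //.
    + by move=> x _; rewrite lee_fin mulr_ge0.
    + exact/measurable_EFinP/measurable_funM.
    + apply: emeasurable_funD; apply/measurable_EFinP => //; exact: measurable_funM.
    + move=> x _; rewrite -EFinD lee_fin /psi /slack.
      have e1 := cutoff_le_indic c x r0; have e2 := cutoff_ge0 c r x.
      rewrite !indicE in e1 *.
      have he : h * cutoff c r x <= h * (x \in eball c r)%:R by rewrite ler_wpM2l// ltW.
      case: (x \in eball c L); last by rewrite !mul0r add0r mulr_ge0// ltW.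
      rewrite !mul1r; have : v x - h * cutoff c r x <= Num.max 0 (v x - h * cutoff c r x).
        by rewrite le_max lexx orbT.
      by move=> sl; rewrite -lerBlDr (le_trans _ sl)// lerD2l lerN2.
  - by move=> x _; rewrite lee_fin.
  - exact/measurable_EFinP.
  - by move=> x _; rewrite lee_fin mulr_ge0// ltW.
  - exact/measurable_EFinP/measurable_funM.
pose W (z : X * X) := w * (contact_test z.1 * psi z.2).
have mphi := measurable_contact_test.
have mPP : measurable_fun setT (fun z : X * X => contact_test z.1 * psi z.2).
  by apply: measurable_funM; exact: measurableT_comp.
have mW : measurable_fun setT W by exact: measurable_funM.
have W0 z : 0 <= W z by rewrite /W mulr_ge0// mulr_ge0.
have WK x y : W (x, y) <= contact_test x * slack y * K (x - y).
  rewrite /W /= /psi.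
  have sl0 : 0 <= slack y by rewrite le_max lexx.
  have rhs0 : 0 <= contact_test x * slack y * K (x - y).
    by apply: mulr_ge0; [exact: mulr_ge0|exact: frac_kernel_ge0].
  have := phi0 x; rewrite le_eqVlt => /predU1P[<-|phix]; first by rewrite !mul0r mulr0.
  rewrite indicE; have [yL|_] := boolP (y \in _); last by rewrite mul0r !mulr0.
  rewrite mul1r mulrC; have [xy|xy] := eqVneq (x - y) 0.
    move/subr0_eq : xy => <-; rewrite [slack x]max_l ?mulr0 ?mul0r//.
    by move: phix; rewrite lt_max ltxx/= subr_gt0 subr_le0 => /ltW.
  rewrite ler_wpM2l//; first exact: mulr_ge0.
  apply: le_frac_kernel => //.
  have [xr _] := contact_test_gt0 phix.
  rewrite (_ : x - y = (x - c) + (c - y)); last by rewrite addrA subrK.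
  rewrite (le_trans (enormD_le _ _))// [enorm (c - y)]enorm_distC lerD// ltW//.
  by move: yL; rewrite inE.
have WD z : W z + energy_density s v contact_test z <=
    h * energy_density s contact_test (cutoff c r) z.
  case: z => x y; apply: (@le_trans _ _
    (contact_test x * slack y * K (x - y) + energy_density s v contact_test (x, y))).
    by rewrite lerD2r; exact: WK.
  have := contact_increment_le (v x) (v y) (h * cutoff c r x) (h * cutoff c r y)
    (frac_kernel_ge0 s (x - y)).
  rewrite /energy_density /= => /le_trans; apply.
  by rewrite -mulrBr mulrCA !mulrA.
have Ephi := finite_energy_contact_test.
have := gagliardo_defect Ev Ephi Ephi Eeta mW W0 WD.
have -> : (\int[leb \x leb]_z (W z)%:E =
    w%:E * (\int[leb]_x (contact_test x)%:E * \int[leb]_x (psi x)%:E))%E.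
  under eq_integral do rewrite EFinM.
  rewrite ge0_integralZl//.
  - by rewrite ge0_integral_tensor.
  - exact/measurable_EFinP.
  - by move=> z _; rewrite lee_fin mulr_ge0.
have bound x : 0 <= contact_test x <= h.
  have /andP[-> /le_trans->//] := contact_test_bound x.
  by rewrite ler_piMr ?(ltW h0)// indicE lern1 leq_b1.
have key := gagliardo_cutoff_le s01 c r0 Ephi bound.
have Phi_dw : ((d / (r + L) `^ q)%:E * \int[leb]_x (contact_test x)%:E <=
    w%:E * (\int[leb]_x (contact_test x)%:E * \int[leb]_x (psi x)%:E))%E.
  rewrite mulrC EFinM -muleA; apply: lee_wpmul2l; first by rewrite lee_fin.
  by rewrite muleC; apply: lee_wpmul2l.
move=> H; apply: (le_trans (leeD Phi_dw (lexx _))); apply: (le_trans H).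
rewrite (EFinM h) -muleA; apply: lee_wpmul2l; first by rewrite lee_fin ltW.
apply: (le_trans key); apply: lee_wpmul2l.
  by rewrite lee_fin mulr_ge0// divr_ge0 ?frac_moment_ge0 ?powR_ge0.
apply: ge0_le_integral => //.
- by move=> x _; rewrite lee_fin mulr_ge0.
- apply/measurable_EFinP; exact: measurable_funM.
- exact/measurable_EFinP.
- by move=> x _; rewrite lee_fin ler_piMl// indicE lern1 leq_b1.
Qed.

End contact.

(** * Powers *)
Section powR_facts.
Context {R : realType}.
Implicit Types (a b p x : R).

Lemma powR_le a b p : 0 <= p -> 0 <= a -> a <= b -> a `^ p <= b `^ p.
Proof.
by move=> p0 a0 ab; apply: ge0_ler_powR; rewrite ?nnegrE ?(le_trans a0 ab).
Qed.

Lemma powR_half a p : 0 <= a -> (a / 2) `^ p = a `^ p / 2 `^ p.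
Proof.
by move=> a0; rewrite powRM// -[in LHS]powR_inv1// -powRrM mulN1r powRN.
Qed.

Lemma powR_eventually_ge p b : 0 < p ->
  exists2 r, 1 <= r & forall x, r <= x -> b <= x `^ p.
Proof.
move=> p0; exists (Num.max 1 (`|b| `^ p^-1)); first by rewrite le_max lexx.
move=> x; rewrite ge_max => /andP[x1 bx].
rewrite (le_trans (ler_norm b))// -[leLHS]powRr1// -(mulVf (lt0r_neq0 p0)) powRrM.
by apply: powR_le; rewrite ?powR_ge0// ltW.
Qed.

End powR_facts.

(** * Barriers for supersolutions *)
Section supersolution.
Context {R : realType} {n : nat}.
Variables (s e : R) (V v : 'rV[R]_n -> R).
Local Notation leb := (@lebesgue_rV R n).
Local Notation X := ('rV[R]_n).
Local Notation beta := (ball_volume R n).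
Local Notation kappa := (frac_moment n s).
Local Notation q := (n%:R + 2 * s).

(** With test functions of bounded support both terms are meaningful although nothing
    is known about the integrability of [V v]. *)
Definition weak_supersolution : Prop :=
  forall (phi : X -> R) c (r M : R), 0 < r -> finite_energy s phi ->
    (forall x, 0 <= phi x <= M * \1_(eball c r) x) ->
    (0 <= e%:E * gagliardo s v phi + \int[leb]_x (V x * v x * phi x)%:E)%E.

Hypotheses (s01 : 0 < s < 1) (e0 : 0 < e).
Hypotheses (mV : measurable_fun setT V) (V0 : forall x, 0 <= V x).
Hypotheses (Ev : finite_energy s v) (cv : continuous v) (v0 : forall x, 0 <= v x).
Hypothesis super : weak_supersolution.

Let mv : measurable_fun setT v. Proof. by case: Ev. Qed.

Let m1 c r : measurable_fun setT (\1_(eball c r) : X -> R).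
Proof. by apply: measurable_indic; exact: measurable_eball. Qed.

Let absorption_measurable (phi : X -> R) : measurable_fun setT phi ->
  measurable_fun setT (fun x => (V x * v x * phi x)%:E).
Proof. by move=> mphi; apply/measurable_EFinP/measurable_funM => //; exact: measurable_funM. Qed.

Let super_fine (phi : X -> R) c (r M E : R) : 0 < r -> finite_energy s phi ->
  (forall x, 0 <= phi x <= M * \1_(eball c r) x) ->
  (\int[leb]_x (V x * v x * phi x)%:E <= E%:E)%E ->
  - (E / e) <= fine (gagliardo s v phi).
Proof.
move=> r0 Ephi phiM VE; have := super r0 Ephi phiM.
rewrite -(fineK (gagliardo_fin_num Ev Ephi)).
move: (fine (gagliardo s v phi)) => g H.
have := le_trans H (leeD (lexx (e%:E * g%:E)%E) VE).
rewrite -EFinM -EFinD lee_fin => egE.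
by rewrite -mulNr ler_pdivrMr// mulrC -subr_ge0 opprK.
Qed.

Let barrier_real (P g h m w rn a b : R) : 0 < P -> 0 < w -> 0 < h ->
  (m - h * rn) * w * P + g <= h * a * P -> - (h * b * P) <= g ->
  h * (rn * w + a + b) < m * w -> False.
Proof.
move=> P0 w0 h0 H1 H2; rewrite ltNge => /negP; apply.
by rewrite -(ler_pM2r P0); lra.
Qed.

(** To be used with [t = r ^ (2 s)], [rn = r ^ n] and [Q = (r + L) ^ (n + 2 s)]: the
    smallness condition on [h] leaves mass outside the barrier, and makes its
    flux exceed what the cutoff and the potential drain. *)
Let barrier_const (h b a m t Q rn : R) : 0 < h -> 0 <= b -> 0 <= a ->
  0 < t -> 0 < Q -> 0 <= rn -> rn * t <= Q -> h * (1 + b + a) <= m * t / Q ->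
  0 <= m - h * (b * rn) /\ h * (b * rn * Q^-1 + a / t) < m * Q^-1.
Proof.
move=> h0 b0 a0 t0 Q0 rn0 rntQ; rewrite ler_pdivlMr// => hm.
have h1 : h * b * (rn * t) <= h * b * Q by rewrite ler_wpM2l// mulr_ge0// ltW.
have hQ : 0 < h * Q by exact: mulr_gt0.
have haQ : 0 <= h * a * Q by rewrite mulr_ge0 ?(ltW Q0)// mulr_ge0// ltW.
have h2 : h * (b * rn * t + a * Q) < m * t by lra.
split.
  rewrite -(pmulr_lge0 _ t0); lra.
rewrite -(ltr_pM2r Q0) -(ltr_pM2r t0) divfK ?gt_eqF//.
rewrite (_ : h * _ * Q * t = h * (b * rn * t + a * Q))//; field.
by rewrite !gt_eqF.
Qed.

(** Comparison with [h] times the cutoff centred at [c]: the mass of [v] near the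
    origin feeds the contact set, where the cutoff and the potential can only
    drain a multiple of [h * r ^ (- 2 s)].  So the contact set is negligible, and
    [v >= h * eta] everywhere by continuity.  Where [v] is at least [h] there is no
    contact, and the size of the potential does not matter. *)
Lemma barrier c (r r' L h m A : R) : 0 < r -> r <= L -> enorm c + r' <= L ->
  0 < h -> 0 <= A ->
  (forall x, enorm (x - c) < r -> V x <= A / r `^ (2 * s) \/ h <= v x) ->
  (m%:E <= \int[leb]_x (\1_(eball 0 r') x * v x)%:E)%E ->
  h * (1 + beta + 2 * kappa + A / e) <= m * r `^ (2 * s) / (r + L) `^ q ->
  h <= v c.
Proof.
move=> r0 rL cL h0 A0 Vh mass hm.
have L0 : 0 < L by exact: lt_le_trans rL.
have rL0 : 0 < r + L by exact: addr_gt0.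
pose phi := contact_test v c r h.
have phiM := contact_test_bound v0 c r0 h0 : forall x, 0 <= phi x <= _.
have phi0 x : 0 <= phi x by have /andP[] := phiM x.
have Ephi : finite_energy s phi by exact: finite_energy_contact_test.
have mphi : measurable_fun setT phi by case: Ephi.
have r2s : 0 < r `^ (2 * s) by exact: powR_gt0.
have w0 : 0 < ((r + L) `^ q)^-1 by rewrite invr_gt0; exact: powR_gt0.
have massL : (m%:E <= \int[leb]_x (\1_(eball c L) x * v x)%:E)%E.
  apply: (le_trans mass); apply: ge0_le_integral => //.
  - by move=> x _; rewrite lee_fin mulr_ge0.
  - exact/measurable_EFinP/measurable_funM.
  - exact/measurable_EFinP/measurable_funM.
  - move=> x _; rewrite lee_fin ler_wpM2r// !indicE ler_nat.
    have [|] := boolP (x \in eball 0 r'); last by [].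
    rewrite inE /eball /= subr0 => xr'.
    suff -> : x \in eball c L by [].
    rewrite inE /eball /= (le_lt_trans (enormD_le _ _))// enormN.
    by rewrite addrC (lt_le_trans _ cL)// ltrD2l.
pose P := fine (\int[leb]_x (phi x)%:E).
have Poo : (\int[leb]_x (phi x)%:E < +oo)%E.
  apply: (@le_lt_trans _ _ (\int[leb]_x (h * \1_(eball c r) x)%:E)%E).
    apply: ge0_le_integral => //.
    - by move=> x _; rewrite lee_fin.
    - exact/measurable_EFinP.
    - exact/measurable_EFinP/measurable_funM.
    - by move=> x _; rewrite lee_fin; have /andP[] := phiM x.
  under eq_integral do rewrite EFinM.
  rewrite ge0_integralZl// ?lee_fin ?(ltW h0)//; last exact/measurable_EFinP.
  rewrite integral_indic//; last exact: measurable_eball.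
  by rewrite setIT [X in (_ * X)%E](lebesgue_eball c r0) -EFinM ltry.
have PE : (\int[leb]_x (phi x)%:E = P%:E)%E.
  rewrite /P fineK// ge0_fin_numE//.
  by apply: integral_ge0 => x _; rewrite lee_fin.
have P0 : 0 <= P by rewrite -lee_fin -PE; apply: integral_ge0 => x _; rewrite lee_fin.
have rnQ : r ^+ n * r `^ (2 * s) <= (r + L) `^ q.
  rewrite -powR_mulrn ?(ltW r0)// -powRD; last by rewrite (gt_eqF r0) implybT.
  apply: ge0_ler_powR; rewrite ?nnegrE ?(ltW r0) ?(ltW rL0) ?lerDl ?(ltW L0)//.
  by have /andP[s0 _] := s01; rewrite addr_ge0// mulr_ge0// ltW.
have kA0 : 0 <= 2 * kappa + A / e.
  apply: addr_ge0; first by apply: mulr_ge0 => //; exact: frac_moment_ge0.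
  by apply: divr_ge0 => //; exact: ltW.
rewrite -addrA in hm.
have [d0 hlt] := barrier_const h0 (ltW ball_volume_gt0) kA0 r2s
  (powR_gt0 q rL0) (exprn_ge0 n (ltW r0)) rnQ hm.
have [Ple0|Pgt0] := leP P 0; last first.
  exfalso.
  have VE : (\int[leb]_x (V x * v x * phi x)%:E <= (A / r `^ (2 * s) * h * P)%:E)%E.
    rewrite EFinM -PE -ge0_integralZl//; last 3 first.
    - exact/measurable_EFinP.
    - by move=> x _; rewrite lee_fin.
    - by rewrite lee_fin mulr_ge0 ?divr_ge0// ltW.
    apply: ge0_le_integral => //.
    - by move=> x _; rewrite lee_fin mulr_ge0// mulr_ge0.
    - exact: absorption_measurable.
    - by apply: measurable_funeM; exact/measurable_EFinP.
    - move=> x _; rewrite -EFinM lee_fin.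
      have := phi0 x; rewrite le_eqVlt => /predU1P[<-|phix]; first by rewrite !mulr0.
      have [xr vh] := contact_test_gt0 v0 r0 h0 phix.
      rewrite ler_pM2r//; case: (Vh x xr) => [Vx|]; last by rewrite leNgt vh.
      by rewrite ler_pM// ltW.
  have G := super_fine r0 Ephi phiM VE.
  have := contact_flux_le s01 Ev v0 r0 h0 rL d0 massL.
  rewrite -/phi PE -(fineK (gagliardo_fin_num Ev Ephi)) -!EFinM -EFinD lee_fin.
  move: G; move: (fine (gagliardo s v phi)) => g G H.
  apply: (barrier_real Pgt0 w0 h0 H (b := A / r `^ (2 * s) / e)).
    by rewrite (_ : h * _ * P = A / r `^ (2 * s) * h * P / e)//; ring.
  rewrite (_ : _ * ((r + L) `^ q)^-1 + _ + _ =
    beta * r ^+ n * ((r + L) `^ q)^-1 + (2 * kappa + A / e) / r `^ (2 * s))//.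
  by field; rewrite !gt_eqF//; exact: powR_gt0.
have P_eq0 : (\int[leb]_(x in setT) `|(phi x)%:E| = 0)%E.
  rewrite (_ : (\int[_]_(_ in _) _)%E = (\int[leb]_x (phi x)%:E)%E).
    by rewrite PE (_ : P = 0)//; apply/eqP; rewrite eq_le Ple0.
  by apply: eq_integral => x _; rewrite gee0_abs// lee_fin.
have mphiE : measurable_fun setT (EFin \o phi) by exact/measurable_EFinP.
have phi_ae := (ae_eq_integral_abs leb measurableT mphiE).1 P_eq0.
suff : 0 <= v c - h * cutoff c r c by rewrite cutoff_center mulr1 subr_ge0.
apply: (ae_ge0_continuous (f := fun x => v x - h * cutoff c r x)).
  move=> x; apply: (cvgB (F := nbhs x)); first exact: cv.
  by apply: (cvgM (F := nbhs x)); [exact: cvg_cst|exact: continuous_cutoff].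
apply: filterS phi_ae => x /(_ I) /= [phix].
rewrite subr_ge0 -subr_le0 -phix /phi /contact_test.
by rewrite le_max lexx orbT.
Qed.

(** The truncation at [k] is the one that comes with the flux through the level [k]. *)
Definition ball_mass k r : R := fine (\int[leb]_x (\1_(eball 0 r) x * Num.min (v x) k)%:E).

Section ball_mass_facts.
Variables (k r : R).
Hypotheses (k0 : 0 < k) (r0 : 0 < r).

Let mmin : measurable_fun setT (fun x => Num.min (v x) k).
Proof. exact: measurable_minr. Qed.

Let min0 x : 0 <= Num.min (v x) k.
Proof. by rewrite le_min v0 ltW. Qed.

Let int_le : (\int[leb]_x (\1_(eball 0 r) x * Num.min (v x) k)%:E <=
  (k * (beta * r ^+ n))%:E)%E.
Proof.
apply: (@le_trans _ _ (\int[leb]_x (k%:E * (\1_(eball 0 r) x)%:E))%E).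
  apply: ge0_le_integral => //.
  - by move=> x _; rewrite lee_fin mulr_ge0.
  - exact/measurable_EFinP/measurable_funM.
  - by apply: measurable_funeM; exact/measurable_EFinP.
  - by move=> x _; rewrite -EFinM lee_fin mulrC ler_wpM2r// ge_min lexx orbT.
rewrite ge0_integralZl// ?lee_fin ?(ltW k0)//; last exact/measurable_EFinP.
rewrite integral_indic//; last exact: measurable_eball.
by rewrite setIT [X in (_ * X)%E](lebesgue_eball 0 r0) -EFinM.
Qed.

Lemma ball_massE :
  (\int[leb]_x (\1_(eball 0 r) x * Num.min (v x) k)%:E = (ball_mass k r)%:E)%E.
Proof.
rewrite /ball_mass fineK// ge0_fin_numE; first exact: le_lt_trans int_le (ltry _).
by apply: integral_ge0 => x _; rewrite lee_fin mulr_ge0.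
Qed.

Lemma ball_mass_le : ball_mass k r <= k * (beta * r ^+ n).
Proof. by rewrite -lee_fin -ball_massE. Qed.

Lemma ball_mass_ge0 : 0 <= ball_mass k r.
Proof.
rewrite -lee_fin -ball_massE; apply: integral_ge0 => x _.
by rewrite lee_fin mulr_ge0.
Qed.

Lemma ball_mass_le_integral :
  ((ball_mass k r)%:E <= \int[leb]_x (\1_(eball 0 r) x * v x)%:E)%E.
Proof.
rewrite -ball_massE; apply: ge0_le_integral => //.
- by move=> x _; rewrite lee_fin mulr_ge0.
- exact/measurable_EFinP/measurable_funM.
- exact/measurable_EFinP/measurable_funM.
- by move=> x _; rewrite lee_fin ler_wpM2l// ge_min lexx.
Qed.

End ball_mass_facts.

(** Where the potential is at most the scale-invariant [r ^ (- 2 s)], or [v] is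
    already at least [k], [v] dominates a multiple of its mean, truncated at [k], over
    a comparable ball. *)
Lemma barrier_ball_mass A : 0 <= A -> exists2 C, 0 < C &
  forall x k rho r, 0 < k -> 0 < rho -> rho / 2 <= r -> r <= rho -> enorm x <= rho ->
    (forall y, enorm (y - x) < r -> V y <= A / r `^ (2 * s) \/ k <= v y) ->
    C * ball_mass k rho / rho ^+ n <= v x.
Proof.
move=> A0; have /andP[s0 s1] := s01.
have beta0 : 0 < beta := ball_volume_gt0.
pose C0 := 1 + beta + 2 * kappa + A / e.
have C00 : 0 < C0.
  rewrite /C0 -!addrA; apply: ltr_pwDl => //.
  apply: addr_ge0; first exact: ltW.
  apply: addr_ge0; first by apply: mulr_ge0 => //; exact: frac_moment_ge0.
  by apply: divr_ge0 => //; exact: ltW.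
have q0 : 0 <= q by rewrite addr_ge0// mulr_ge0// ltW.
pose C1 := (2 `^ (2 * s) * 3 `^ q * C0)^-1.
have C10 : 0 < C1 by rewrite invr_gt0 !mulr_gt0// powR_gt0.
(* The factor [beta^-1] keeps the barrier below [k], and [C1] is what [barrier]
   requires with [L = 2 rho], where [r + L <= 3 rho] and [rho / 2 <= r]. *)
exists (Num.min beta^-1 C1); first by rewrite lt_min invr_gt0 beta0.
set C := Num.min _ _ => x k rho r k0 rho0 rho_r r_rho xrho Vr.
have r0 : 0 < r by apply: lt_le_trans rho_r; exact: divr_gt0.
have C_ge0 : 0 <= C by rewrite /C le_min invr_ge0 !ltW.
have mass0 := ball_mass_ge0 k0 rho0.
have [->|massN0] := eqVneq (ball_mass k rho) 0; first by rewrite mulr0 mul0r.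
have massp : 0 < ball_mass k rho by rewrite lt_neqAle eq_sym massN0.
have rn0 : 0 < rho ^+ n by exact: exprn_gt0.
set h := C * _ / _.
have h0 : 0 < h by rewrite divr_gt0// mulr_gt0// /C lt_min invr_gt0 beta0.
have hk : h <= k.
  rewrite ler_pdivrMr//; apply: (@le_trans _ _ (beta^-1 * (k * (beta * rho ^+ n)))).
    by rewrite ler_pM ?ball_mass_le// /C ge_min lexx.
  by rewrite [leLHS](_ : _ = k * rho ^+ n)//; field; rewrite gt_eqF.
apply: (@barrier x r rho (2 * rho) h (ball_mass k rho) A) => //.
- by lra.
- by lra.
- by move=> y yr; case: (Vr y yr) => [|/(le_trans hk)]; [left|right].
- exact: ball_mass_le_integral.
rewrite -/C0.
apply: (@le_trans _ _ (ball_mass k rho * (rho `^ (2 * s) / 2 `^ (2 * s)) / (3 * rho) `^ q)); last first.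
  have rs : rho `^ (2 * s) / 2 `^ (2 * s) <= r `^ (2 * s).
    rewrite -[X in _ * X]powR_inv1 ?powR_ge0// -powRAC powR_inv1// -powRM ?(ltW rho0)//.
    by apply: powR_le => //; [exact: mulr_ge0 (ltW _)|exact: divr_ge0 (ltW _) _].
  apply: ler_pM.
  - by rewrite mulr_ge0// divr_ge0 ?powR_ge0.
  - by rewrite invr_ge0 powR_ge0.
  - by rewrite ler_wpM2l.
  - rewrite lef_pV2 ?posrE ?powR_gt0//; [|lra|lra].
    by apply: powR_le => //; lra.
have -> : (3 * rho) `^ q = 3 `^ q * (rho ^+ n * rho `^ (2 * s)).
  rewrite powRM// ?(ltW rho0)// (@powRD _ rho) ?powR_mulrn ?(ltW rho0)//.
  by rewrite (gt_eqF rho0) implybT.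
rewrite (_ : ball_mass _ _ * _ / _ = C1 * C0 * ball_mass k rho / rho ^+ n); last first.
  rewrite /C1; field.
  by rewrite !gt_eqF ?powR_gt0.
rewrite /h mulrAC ler_pM2r ?invr_gt0// mulrAC ler_pM2r//.
by rewrite ler_pM2r// /C ge_min lexx orbT.
Qed.

(** * Slowly decaying potentials *)
(** At distance [a = 1 + |x|] the potential is at most a multiple of
    [r ^ (- 2 s)] on the ball of radius [r ~ a ^ (omega / 2 s)], so that the mass
    near the origin, seen through the kernel, yields [r ^ (2 s) * a ^ (- (n + 2 s))]. *)
Lemma lower_bound_of_slow_decay (omega D m0 : R) : 0 <= omega -> omega <= 2 * s -> 0 <= D ->
  (forall x, V x <= D / (1 + enorm x) `^ omega) ->
  0 < m0 -> (m0%:E <= \int[leb]_x (\1_(eball 0 1) x * v x)%:E)%E ->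
  exists2 C, 0 < C & forall x, C / (1 + enorm x) `^ (q - omega) <= v x.
Proof.
move=> om0 oms D0 VD m00 mass; have /andP[s0 s1] := s01.
have s2 : 0 < 2 * s by exact: mulr_gt0.
have q0 : 0 <= q by rewrite addr_ge0// ltW.
pose A := D * 2 `^ omega / 2 `^ (2 * s).
have A0 : 0 <= A by rewrite divr_ge0 ?powR_ge0// mulr_ge0// powR_ge0.
pose C0 := 1 + beta + 2 * kappa + A / e.
have C00 : 0 < C0.
  rewrite /C0 -!addrA; apply: ltr_pwDl => //.
  apply: addr_ge0; first by apply: ltW; exact: ball_volume_gt0.
  apply: addr_ge0; first by apply: mulr_ge0 => //; exact: frac_moment_ge0.
  by apply: divr_ge0 => //; exact: ltW.
exists (m0 / (2 `^ (2 * s) * 2 `^ q * C0)).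
  by rewrite divr_gt0// !mulr_gt0// powR_gt0.
move=> x; set h := _ / _.
pose a := 1 + enorm x.
have a1 : 1 <= a by rewrite lerDl enorm_ge0.
have a0 : 0 < a by exact: lt_le_trans a1.
pose r := a `^ (omega / (2 * s)) / 2.
have r0 : 0 < r by rewrite divr_gt0// powR_gt0.
have ra : r <= a / 2.
  rewrite ler_pM2r ?invr_gt0// -[leRHS]powRr1 ?(ltW a0)//.
  by apply: ler_powR => //; rewrite ler_pdivrMr// mul1r.
have r2s : r `^ (2 * s) = a `^ omega / 2 `^ (2 * s).
  by rewrite powR_half ?powR_ge0// -powRrM divfK ?gt_eqF.
have aq : a `^ (q - omega) = a `^ q / a `^ omega.
  by rewrite powRB// (gt_eqF a0) implybT.
have h0 : 0 < h by rewrite divr_gt0 ?powR_gt0// divr_gt0// !mulr_gt0// powR_gt0.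
apply: (@barrier x r 1 a h m0 A) => //.
- by rewrite (le_trans ra)// ler_piMr ?(ltW a0)// invf_le1// ler1n.
- by rewrite addrC.
- move=> y yr; left; rewrite (le_trans (VD y))// r2s /A.
  have ya : a / 2 <= 1 + enorm y.
    have : enorm x - enorm y <= enorm (x - y) by exact: enormB_le.
    rewrite enorm_distC => xy; rewrite /a in ra *; lra.
  rewrite (_ : _ / (_ / _) = D * (2 `^ omega / a `^ omega)); last first.
    by field; rewrite !gt_eqF ?powR_gt0.
  rewrite ler_wpM2l// -invf_div -powR_half ?(ltW a0)//.
  have ha0 : 0 < a / 2 by exact: divr_gt0.
  rewrite lef_pV2 ?posrE ?powR_gt0//; last exact: lt_le_trans ya.
  by apply: powR_le => //; exact: ltW.
rewrite -/C0 r2s /h aq.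
apply: (@le_trans _ _ (m0 * (a `^ omega / 2 `^ (2 * s)) / (2 `^ q * a `^ q))); last first.
  apply: ler_wpM2l.
    by rewrite mulr_ge0 ?(ltW m00)// divr_ge0 ?powR_ge0.
  rewrite lef_pV2 ?posrE ?mulr_gt0 ?powR_gt0//; last by lra.
  rewrite -powRM ?(ltW a0)//; apply: powR_le => //; lra.
rewrite [leLHS](_ : _ = m0 * (a `^ omega / 2 `^ (2 * s)) / (2 `^ q * a `^ q))//.
by field; rewrite !gt_eqF ?powR_gt0.
Qed.

Lemma unit_ball_mass_gt0 : {ae leb, forall x, 0 < v x} -> 0 < ball_mass 1 1.
Proof.
move=> vpos; rewrite lt_neqAle eq_sym (ball_mass_ge0 ltr01 ltr01) andbT.
apply/eqP => mass0.
have mmin : measurable_fun setT (fun x => \1_(eball 0 1) x * Num.min (v x) 1).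
  by apply: measurable_funM => //; exact: measurable_minr.
have mE : measurable_fun setT (EFin \o (fun x => \1_(eball 0 1) x * Num.min (v x) 1)).
  exact/measurable_EFinP.
have I0 : (\int[leb]_(x in setT) `|(\1_(eball 0 1) x * Num.min (v x) 1)%:E| = 0)%E.
  transitivity (\int[leb]_x (\1_(eball 0 1) x * Num.min (v x) 1)%:E)%E.
    apply: eq_integral => x _; rewrite gee0_abs// lee_fin mulr_ge0//.
    by rewrite le_min v0 ler01.
  by rewrite (ball_massE ltr01 ltr01) mass0.
have ae0 := (ae_eq_integral_abs leb measurableT mE).1 I0.
have : {ae leb, forall x, ~ eball 0 1 x}.
  apply: filterS2 vpos ae0 => x vx /(_ I) /= [xE] xB.
  move: xE; rewrite indicE mem_set// mul1r => m0.
  by have : 0 < Num.min (v x) 1 by [rewrite lt_min vx ltr01]; rewrite m0 ltxx.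
move=> [N [mN N0 BN]].
have : (leb (eball 0 1) <= leb N)%E.
  apply: le_measure; rewrite ?inE//; first exact: measurable_eball.
  by move=> x xB; apply: BN => /= nB; exact: nB.
rewrite [leRHS]N0 [leLHS](lebesgue_eball 0 ltr01) expr1n mulr1 lee_fin leNgt.
by rewrite ball_volume_gt0.
Qed.

(** * Growth from one scale to the next *)
Lemma flux_ball_mass_le (k r r1 r2 E : R) : 0 < k -> 0 < r1 -> 2 * r1 <= r -> 0 < r2 ->
  (forall x, enorm x < r1 -> k <= v x) ->
  - E <= fine (gagliardo s v (level_test v k r)) ->
  ((k / 16 * (beta * r1 ^+ n) / (r1 + r2) `^ q)%:E *
     leb (eball 0 r2 `&` [set y | v y <= k / 2]%R) <=
   (2 * (kappa / r `^ (2 * s)) * ball_mass k r + E)%:E)%E.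
Proof.
move=> k0 r10 r1r r20 kv gE.
have r0 : 0 < r by apply: lt_le_trans r1r; exact: mulr_gt0.
have Et := finite_energy_level_test s01 Ev v0 k0 r0.
have := level_flux_le s01 Ev v0 k0 r0 r10 r1r r20 kv.
rewrite (ball_massE k0 r0) -(fineK (gagliardo_fin_num Ev Et)) -EFinM.
rewrite -leeBrDr// => /le_trans; apply; rewrite -EFinB lee_fin lerD2l.
by rewrite lerNl.
Qed.

Lemma ball_mass_ge_half (k r : R) : 0 < k -> 0 < r ->
  (leb (eball 0 r `&` [set y | v y <= k / 2]%R) <= (beta * r ^+ n / 2)%:E)%E ->
  k / 4 * (beta * r ^+ n) <= ball_mass k r.
Proof.
move=> k0 r0; set S := _ `&` _ => Sle.
have mS : measurable S by exact: measurable_sublevel_ball.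
have k2 : 0 <= k / 2 by rewrite divr_ge0// ltW.
have mm : measurable_fun setT (fun x => \1_(eball 0 r) x * Num.min (v x) k).
  by apply: measurable_funM => //; exact: measurable_minr.
have min0 x : 0 <= Num.min (v x) k by rewrite le_min v0 ltW.
have int1 (B : set X) : measurable B ->
    ((k / 2)%:E * leb B = \int[leb]_x (k / 2 * \1_B x)%:E)%E.
  move=> mB; under eq_integral do rewrite EFinM.
  rewrite ge0_integralZl//; last exact/measurable_EFinP.
  by rewrite integral_indic// setIT.
have H : ((k / 2)%:E * leb (eball (0 : X) r) <= (ball_mass k r)%:E + (k / 2)%:E * leb S)%E.
  rewrite !int1//; last exact: measurable_eball.
  rewrite -(ball_massE k0 r0) -ge0_integralD//.
  - apply: ge0_le_integral => //.
    + by move=> x _; rewrite lee_fin mulr_ge0.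
    + by apply/measurable_EFinP/measurable_funM.
    + by apply: emeasurable_funD; apply/measurable_EFinP => //; exact: measurable_funM.
    + move=> x _; rewrite -EFinD lee_fin !indicE.
      have [xB|] := boolP (x \in eball 0 r); last first.
        by rewrite mulr0 mul0r add0r mulr_ge0.
      rewrite mul1r mulr1; have [xS|xS] := boolP (x \in S).
        by rewrite mulr1 lerDr.
      rewrite mulr0 addr0 le_min; apply/andP; split; last first.
        by rewrite ler_pdivrMr// ler_pMr// ler1n.
      rewrite leNgt; apply/negP => /ltW vk; move/negP: xS; apply.
      by rewrite inE /S; split => //; rewrite inE in xB.
  - by move=> x _; rewrite lee_fin mulr_ge0.
  - exact/measurable_EFinP.
  - by move=> x _; rewrite lee_fin mulr_ge0.
  - by apply/measurable_EFinP/measurable_funM.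
move: H; rewrite [X in (_ * X <= _)%E](lebesgue_eball 0 r0).
have := lee_wpmul2l (_ : 0 <= (k / 2)%:E)%E Sle; rewrite lee_fin => /(_ k2) H1 H2.
have := le_trans H2 (leeD (lexx _) H1); rewrite -!EFinM -EFinD lee_fin.
by move: (ball_mass k r) (beta * r ^+ n) => m b; lra.
Qed.

(** The absorption seen by the level test only comes from outside the ball where
    [v] exceeds the level. *)
Lemma gagliardo_level_test_ge (k r r1 omega D : R) : 0 < k -> 0 < r1 -> 0 < r ->
  0 <= omega -> 0 <= D -> (forall x, V x <= D / (1 + enorm x) `^ omega) ->
  (forall x, enorm x < r1 -> k <= v x) ->
  - (D / r1 `^ omega * k * (beta * r ^+ n) / e) <=
    fine (gagliardo s v (level_test v k r)).
Proof.
move=> k0 r10 r0 om0 D0 VD kv.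
have Et := finite_energy_level_test s01 Ev v0 k0 r0.
have tb := level_test_bound v0 k0 r0.
have tM x : 0 <= level_test v k r x <= 1 * \1_(eball 0 r) x by rewrite mul1r.
have mt : measurable_fun setT (level_test v k r) by case: Et.
have Dr0 : 0 <= D / r1 `^ omega by rewrite divr_ge0 ?powR_ge0.
have VE : (\int[leb]_x (V x * v x * level_test v k r x)%:E <=
    (D / r1 `^ omega * k * (beta * r ^+ n))%:E)%E.
  have -> : ((D / r1 `^ omega * k * (beta * r ^+ n))%:E =
      \int[leb]_x (D / r1 `^ omega * k * \1_(eball 0 r) x)%:E)%E.
    under eq_integral do rewrite EFinM.
    rewrite ge0_integralZl//; last 2 first.
    - exact/measurable_EFinP.
    - by rewrite lee_fin mulr_ge0// ltW.
    rewrite integral_indic//; last exact: measurable_eball.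
    by rewrite setIT [X in (_ * X)%E](lebesgue_eball 0 r0) -EFinM.
  apply: ge0_le_integral => //.
  - move=> x _; have /andP[t0 _] := tb x.
    by rewrite lee_fin mulr_ge0// mulr_ge0.
  - by apply/measurable_EFinP; exact: (measurable_funM (measurable_funM mV mv) mt).
  - by apply/measurable_EFinP; exact: measurable_funM.
  - move=> x _; rewrite lee_fin; have /andP[t0 t1] := tb x.
    have [vk|vk] := leP k (v x).
      rewrite /level_test above_eq0// mul0r mulr0.
      by rewrite mulr_ge0// mulr_ge0// ltW.
    apply: ler_pM => //; first by rewrite mulr_ge0.
    apply: ler_pM => //; last exact: ltW.
    rewrite (le_trans (VD x))// ler_wpM2l// lef_pV2 ?posrE ?powR_gt0//; last first.
      by rewrite ltr_pwDl// enorm_ge0.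
    apply: powR_le => //; first exact: ltW.
    rewrite (@le_trans _ _ (enorm x))// ?lerDr// leNgt; apply/negP => /kv.
    by rewrite leNgt vk.
exact: (super_fine r0 Et tM VE).
Qed.

(** The bookkeeping for the second case of [growth_step], with [rn = r ^ n], [t2 = r ^ (2 s)],
    [Tn = T ^ n], [P = (1 + T) ^ (n + 2 s)], [An = A ^ n], [A2 = A ^ (2 s)] and
    [rom = r ^ omega].  For large [r] the potential absorbs at most half of the flux,
    since [r ^ omega] is much larger than [r ^ (2 s)]. *)
Let flux_real (k beta' P rn t2 Tn kap A2 m D rom An e' : R) :
  0 < k -> 0 < beta' -> 0 < P -> 0 < rn -> 0 < t2 -> 0 < Tn -> 0 <= kap -> 0 < A2 ->
  0 <= m -> 0 < rom -> 0 < e' ->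
  k / 16 * (beta' * rn) / (P * (rn * t2)) * (beta' * (Tn * rn) / 2) <=
    2 * (kap / (A2 * t2)) * m + D / rom * k * (beta' * (An * rn)) / e' ->
  2 * D * beta' * An / (e' * (beta' ^+ 2 * Tn / (32 * P))) * t2 <= rom ->
  beta' ^+ 2 * Tn / (32 * P) / (4 * (kap + 1)) * (k * A2 * rn) <= m.
Proof.
move=> k0 b0 P0 rn0 t20 Tn0 kap0 A20 m0 rom0 e'0.
have c20 : 0 < beta' ^+ 2 * Tn / (32 * P) by rewrite divr_gt0// !mulr_gt0// exprn_gt0.
rewrite (_ : k / 16 * (beta' * rn) / (P * (rn * t2)) * (beta' * (Tn * rn) / 2) =
  beta' ^+ 2 * Tn / (32 * P) * (k * rn / t2)); last by field; rewrite !gt_eqF.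
rewrite (_ : D / rom * k * (beta' * (An * rn)) / e' =
   (beta' ^+ 2 * Tn / (32 * P)) * (k * rn / 2) *
   (2 * D * beta' * An / (e' * (beta' ^+ 2 * Tn / (32 * P))) / rom)); last first.
  by field; rewrite !gt_eqF.
move: c20; set c2 := _ / (32 * P); set B1 := _ / (e' * c2) => c20 H HB.
have HB' : B1 / rom <= t2^-1.
  by rewrite ler_pdivrMr// mulrC ler_pdivlMr.
have H1 : c2 * (k * rn / 2) * (B1 / rom) <= c2 * (k * rn / 2) * t2^-1.
  by rewrite ler_wpM2l// mulr_ge0 ?(ltW c20)// divr_ge0// mulr_ge0 ?ltW.
have H2 : c2 * (k * rn / 2) / t2 <= 2 * (kap / (A2 * t2)) * m by lra.
have AT : 0 < A2 * t2 by exact: mulr_gt0.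
have H3 : c2 * (k * rn / 2) * A2 <= 2 * kap * m.
  rewrite -(ler_pM2r t20) -[X in X <= _](_ : c2 * (k * rn / 2) / t2 * (A2 * t2) * t2 = _).
    rewrite ler_pM2r// -ler_pdivlMr//; apply: (le_trans H2).
    by rewrite [leRHS](_ : _ = 2 * (kap / (A2 * t2)) * m)//; field; rewrite !gt_eqF.
  by field; rewrite gt_eqF.
have kap1 : 0 < 4 * (kap + 1) by rewrite mulr_gt0// ltr_wpDl.
rewrite mulrAC ler_pdivrMr//; have : 0 <= m by [].
have : 0 <= kap * m by exact: mulr_ge0.
lra.
Qed.

(** If half of a ball of radius [T r] is above [k / 2], the barrier of that size
    yields a fixed fraction of [k], which is at least [k T ^ (- mu)] when [T] is
    large.  Otherwise a definite flux crosses the level [k] near the ball of radius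
    [r].  The potential can absorb only a part of it, so there is mass at scale
    [A r], and the barrier of that size yields [c k A ^ (- (n - 2 s))] with [c]
    independent of [A].  When [A] is large this is at least [k A ^ (- mu)].  Thus
    [T], [A] and the smallest radius [R0] are chosen in this order. *)
Lemma growth_step (mu omega D : R) : 2 * s < omega -> n%:R - 2 * s < mu -> 0 < mu ->
  0 <= D -> (forall x, V x <= D / (1 + enorm x) `^ omega) ->
  exists R0 A, [/\ 1 <= R0, 2 <= A & forall r k, R0 <= r -> 0 < k ->
    (forall x, enorm x < r -> k <= v x) ->
    exists2 B, 2 <= B <= A & forall x, enorm x < B * r -> k / B `^ mu <= v x].
Proof.
move=> oms nmu mu0 D0 VD; have /andP[s0 s1] := s01.
have s2 : 0 < 2 * s by exact: mulr_gt0.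
have om0 : 0 <= omega by rewrite ltW// (lt_trans s2).
have beta0 : 0 < beta := ball_volume_gt0.
have kap0 : 0 <= kappa := frac_moment_ge0 s.
have [cB cB0 spread] := barrier_ball_mass ler01.
have c10 : 0 < cB * beta / 4 by rewrite divr_gt0// mulr_gt0.
have [T0 T01 T0P] := powR_eventually_ge (cB * beta / 4)^-1 mu0.
(* First case: the fraction of [k] that survives is [cB * beta / 4]. *)
pose T := Num.max 2 T0.
have T2 : 2 <= T by rewrite le_max lexx.
have Tp : 0 < T by exact: lt_le_trans T2.
have TP : (cB * beta / 4)^-1 <= T `^ mu by apply: T0P; rewrite le_max lexx orbT.
(* Second case: the fraction that survives is [c3 * A ^ (- (n - 2 s))]. *)
pose P := (1 + T) `^ q.
have P0 : 0 < P by rewrite powR_gt0// addr_gt0.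
pose c2 := beta ^+ 2 * T ^+ n / (32 * P).
have c20 : 0 < c2 by rewrite divr_gt0// !mulr_gt0// exprn_gt0.
pose c3 := cB * (c2 / (4 * (kappa + 1))).
have kap4 : 0 < 4 * (kappa + 1) by rewrite mulr_gt0// ltr_wpDl.
have c30 : 0 < c3 by rewrite mulr_gt0// divr_gt0.
have dmu : 0 < mu - (n%:R - 2 * s) by rewrite subr_gt0.
have [A0 A01 A0P] := powR_eventually_ge c3^-1 dmu.
pose A := Num.max T A0.
have TA : T <= A by rewrite le_max lexx.
have A2 : 2 <= A by exact: le_trans TA.
have Ap : 0 < A by exact: lt_le_trans A2.
have AP : c3^-1 <= A `^ (mu - (n%:R - 2 * s)) by apply: A0P; rewrite le_max lexx orbT.
have omp : 0 < omega - 2 * s by rewrite subr_gt0.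
(* Beyond [R0] the absorption is at most half the flux, by [B1], and the potential is
   at most [(A r) ^ (- 2 s)] outside the ball of radius [r]. *)
pose B1 := 2 * D * beta * A ^+ n / (e * c2).
have [R0 R01 R0P] := powR_eventually_ge (Num.max B1 (D * A `^ (2 * s))) omp.
exists R0, A; split=> // r k R0r k0 kv.
have r1 : 1 <= r by exact: le_trans R0r.
have r0 : 0 < r by exact: lt_le_trans r1.
have r2s : 0 < r `^ (2 * s) by exact: powR_gt0.
have rom : r `^ omega = r `^ (2 * s) * r `^ (omega - 2 * s).
  by rewrite -powRD ?(gt_eqF r0) ?implybT// addrC subrK.
have /andP[rB1 rB2] : (B1 <= r `^ (omega - 2 * s)) && (D * A `^ (2 * s) <= r `^ (omega - 2 * s)).
  by rewrite -ge_max; exact: R0P.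
have rom0 : 0 < r `^ omega by exact: powR_gt0.
have spreadB B x : 2 <= B -> B <= A -> enorm x < B * r ->
    cB * ball_mass k (B * r) / (B * r) ^+ n <= v x.
  move=> B2 BA xB; have Bp : 0 < B by exact: lt_le_trans B2.
  have Br0 : 0 < B * r by exact: mulr_gt0.
  apply: (spread x k (B * r) (B * r)) => //.
  - by rewrite ler_pdivrMr// ler_peMr ?ler1n// ltW.
  - exact: ltW.
  - move=> y _; have [yr|yr] := ltP (enorm y) r; [right; exact: kv|left].
    apply: (le_trans (VD y)); apply: (@le_trans _ _ (D / r `^ omega)).
      rewrite ler_wpM2l// lef_pV2 ?posrE ?powR_gt0//; last by rewrite ltr_pwDl// enorm_ge0.
      apply: powR_le => //; first exact: ltW.
      by rewrite (le_trans yr)// lerDr.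
    rewrite ler_pdivrMr// mulrAC ler_pdivlMr ?powR_gt0//.
    rewrite mul1r powRM ?(ltW Bp) ?(ltW r0)// rom mulrA [leRHS]mulrC ler_pM2r//.
    apply: le_trans rB2; apply: ler_wpM2l; first exact: D0.
    by apply: powR_le => //; exact: ltW.
pose S := eball (0 : X) (T * r) `&` [set y | v y <= k / 2].
have Tr0 : 0 < T * r by exact: mulr_gt0.
have [Sle|Sgt] := leP (leb S) (beta * (T * r) ^+ n / 2)%:E.
  exists T; first by rewrite T2.
  move=> x xT; apply: le_trans (spreadB T x T2 TA xT).
  have := ball_mass_ge_half k0 Tr0 Sle.
  have Tn0 : 0 < (T * r) ^+ n by exact: exprn_gt0.
  move=> massT; apply: (@le_trans _ _ (cB * (k / 4 * (beta * (T * r) ^+ n)) / (T * r) ^+ n)); last first.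
    by rewrite ler_pM2r ?invr_gt0// ler_pM2l.
  rewrite (_ : _ / (T * r) ^+ n = k * (cB * beta / 4)); last by field; rewrite gt_eqF.
  by rewrite ler_pM2l// -[leRHS]invrK lef_pV2 ?posrE ?invr_gt0// powR_gt0.
exists A; first by rewrite A2 lexx.
move=> x xA; apply: le_trans (spreadB A x A2 (lexx A) xA).
have Ar0 : 0 < A * r by exact: mulr_gt0.
have r2A : 2 * r <= A * r by rewrite ler_pM2r.
have gE := gagliardo_level_test_ge k0 r0 Ar0 om0 D0 VD kv.
have := flux_ball_mass_le k0 r0 r2A Tr0 kv gE.
set coef := k / 16 * _ / _; have coef0 : (0 <= coef%:E)%E.
  rewrite lee_fin divr_ge0 ?powR_ge0// mulr_ge0//; first by rewrite divr_ge0// ltW.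
  by rewrite mulr_ge0 ?exprn_ge0// ltW.
move=> /(le_trans (lee_wpmul2l coef0 (ltW Sgt))); rewrite -EFinM lee_fin /coef.
have -> : (r + T * r) `^ q = P * (r ^+ n * r `^ (2 * s)).
  have -> : r + T * r = (1 + T) * r by rewrite mulrDl mul1r.
  rewrite powRM ?(ltW r0) ?addr_ge0 ?(ltW Tp)// (@powRD _ r) ?powR_mulrn ?(ltW r0)//.
  by rewrite (gt_eqF r0) implybT.
rewrite powRM ?(ltW r0) ?(ltW Ap)// !exprMn => H.
have mass0 := ball_mass_ge0 k0 Ar0.
have rn0 : 0 < r ^+ n by exact: exprn_gt0.
have An0 : 0 < A ^+ n by exact: exprn_gt0.
have := flux_real k0 beta0 P0 rn0 r2s (exprn_gt0 n Tp) kap0 (powR_gt0 (2 * s) Ap) mass0 rom0 e0 H.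
rewrite -/c2 -/B1 rom mulrC ler_pM2l// => /(_ rB1) massA.
apply: (@le_trans _ _ (cB * (c2 / (4 * (kappa + 1)) * (k * A `^ (2 * s) * r ^+ n)) /
    (A ^+ n * r ^+ n))); last first.
  by rewrite ler_pM2r ?invr_gt0 ?mulr_gt0// ler_pM2l.
rewrite [leRHS](_ : _ = k * (c3 * (A `^ (2 * s) / A ^+ n))); last first.
  have kap1 : 0 < kappa + 1 by rewrite ltr_wpDl.
  by rewrite /c3; field; rewrite !gt_eqF.
rewrite ler_pM2l// -powR_mulrn ?(ltW Ap)// -powRB ?(gt_eqF Ap) ?implybT//.
have -> : 2 * s - n%:R = (mu - (n%:R - 2 * s)) - mu by ring.
rewrite powRB ?(gt_eqF Ap) ?implybT// mulrA ler_peMl ?invr_ge0 ?powR_ge0//.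
by rewrite mulrC -ler_pdivrMr// mul1r.
Qed.

(** * Rapidly decaying potentials *)
Variables (omega D : R).
Hypotheses (n2s : 2 * s < n%:R) (om0 : 0 <= omega) (D0 : 0 <= D).
Hypothesis VD : forall x, V x <= D / (1 + enorm x) `^ omega.
Hypothesis vpos : {ae leb, forall x, 0 < v x}.

Let e1 (x : X) : 1 <= 1 + enorm x. Proof. by rewrite lerDl enorm_ge0. Qed.
Let e1p (x : X) : 0 < 1 + enorm x. Proof. exact: lt_le_trans (e1 x). Qed.

Lemma div_powR_le (C a : R) (x : X) : 0 <= C -> 0 <= a -> C / (1 + enorm x) `^ a <= C.
Proof.
move=> C0 a0; rewrite ler_pdivrMr ?powR_gt0// ler_peMr//.
by rewrite -[leLHS](powRr0 (1 + enorm x)); exact: ler_powR.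
Qed.

(** A strong minimum principle, obtained from the quantitative bound for potentials
    that are merely bounded. *)
Lemma locally_bounded_below r : 0 < r -> exists2 k, 0 < k &
  forall x, enorm x < r -> k <= v x.
Proof.
move=> r0; have /andP[s0 s1] := s01; have s2 : 0 <= 2 * s by rewrite mulr_ge0// ltW.
have VD0 x : V x <= D / (1 + enorm x) `^ 0.
  by rewrite powRr0 divr1 (le_trans (VD x))// div_powR_le.
have [C C0 Cv] := lower_bound_of_slow_decay (lexx 0) s2 D0 VD0
  (unit_ball_mass_gt0 vpos) (ball_mass_le_integral ltr01 ltr01).
exists (C / (1 + r) `^ (q - 0)); first by rewrite divr_gt0// powR_gt0// addr_gt0.
move=> x xr; apply: le_trans (Cv x); rewrite ler_pM2l// lef_pV2 ?posrE ?powR_gt0//; last first.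
  by rewrite addr_gt0.
apply: powR_le; first by rewrite subr0 addr_ge0.
  exact: ltW.
by rewrite lerD2l ltW.
Qed.

(** The bound [v >= c0 * r ^ (- mu)] on the ball of radius [r] is inherited by a
    ball at least twice and at most [A] times as large.  On the annulus between
    consecutive balls it costs a factor [A ^ mu] to express it by [|x|]. *)
Lemma lower_bound_of_fast_decay mu : 2 * s < omega -> n%:R - 2 * s < mu ->
  exists2 C, 0 < C & forall x, C / (1 + enorm x) `^ mu <= v x.
Proof.
move=> oms nmu; have mu0 : 0 < mu by apply: lt_trans nmu; rewrite subr_gt0.
have [R0 [A [R01 A2 step]]] :=
  growth_step oms nmu mu0 D0 VD.
have R00 : 0 < R0 by exact: lt_le_trans R01.
have A0 : 0 < A by exact: lt_le_trans A2.
have [k0 k00 kv] := locally_bounded_below R00.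
pose c0 := k0 * R0 `^ mu.
have c00 : 0 < c0 by rewrite mulr_gt0// powR_gt0.
pose C := Num.min k0 (c0 / A `^ mu).
have C0 : 0 < C by rewrite lt_min k00 divr_gt0// powR_gt0.
exists C => //.
have H m : exists r, [/\ 2 ^+ m * R0 <= r, forall x, enorm x < r -> c0 / r `^ mu <= v x &
    forall x, enorm x < r -> C / (1 + enorm x) `^ mu <= v x].
  elim: m => [|m [r [Rr rv rC]]].
    exists R0; rewrite expr0 mul1r; split => // x xR.
      by rewrite /c0 mulfK ?gt_eqF ?powR_gt0//; exact: kv.
    apply: (le_trans _ (kv x xR)); apply: (@le_trans _ _ C); last by rewrite ge_min lexx.
    by apply: div_powR_le; exact: ltW.
  have R0r : R0 <= r by rewrite (le_trans _ Rr)// ler_peMl ?(ltW R00)// exprn_ege1// ler1n.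
  have r0 : 0 < r by exact: lt_le_trans R0r.
  have cr0 : 0 < c0 / r `^ mu by rewrite divr_gt0// powR_gt0.
  have [B /andP[B2 BA] Bv] := step r (c0 / r `^ mu) R0r cr0 rv.
  have B0 : 0 < B by exact: lt_le_trans B2.
  exists (B * r); split.
  - by rewrite exprS -mulrA ler_pM// mulr_ge0 ?exprn_ge0// ltW.
  - move=> x xB; rewrite powRM ?(ltW B0) ?(ltW r0)// invfM mulrA mulrAC.
    exact: Bv.
  - move=> x xB; have [xr|xr] := ltP (enorm x) r; first exact: rC.
    apply: le_trans (Bv x xB).
    apply: (@le_trans _ _ (c0 / A `^ mu / (1 + enorm x) `^ mu)).
      by rewrite ler_pM2r ?invr_gt0 ?powR_gt0// ge_min lexx orbT.
    rewrite -mulrA -[leRHS]mulrA ler_pM2l// mulrC ler_pM ?invr_ge0 ?powR_ge0//.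
      rewrite lef_pV2 ?posrE ?powR_gt0//; apply: powR_le; [exact: ltW|exact: ltW|].
      by rewrite (le_trans xr)// lerDr.
    rewrite lef_pV2 ?posrE ?powR_gt0//; apply: powR_le => //; exact: ltW.
move=> x; pose m := (Num.trunc (enorm x)).+1.
have [r [Rr _]] := H m; apply; apply: lt_le_trans Rr.
rewrite (@lt_le_trans _ _ (2 ^+ m))//; last by rewrite ler_peMr// exprn_ge0.
by rewrite (lt_trans (truncnS_gt _))// -natrX ltr_nat ltn_expl.
Qed.

(** Flux through the level [k] requires that [v] go below [k / 2] on a set of positive
    measure; if it never does, there is nothing to prove. *)
Let level_dichotomy k :
  (exists2 r, 0 < r & (0 < leb (eball 0 r `&` [set y | v y <= k / 2]%R))%E) \/
  forall x, k / 2 <= v x.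
Proof.
have [?|nS] := pselect (exists2 r, 0 < r &
    (0 < leb (eball 0 r `&` [set y | v y <= k / 2]%R))%E); [by left|right].
suff : forall x, 0 <= v x - k / 2 by move=> H x; rewrite -subr_ge0.
apply: (ae_ge0_continuous (f := fun x => v x - k / 2)).
  by move=> x; apply: (cvgB (F := nbhs x)); [exact: cv|exact: cvg_cst].
have : leb.-negligible (\bigcup_m (eball (0 : X) m.+1%:R `&` [set y | v y <= k / 2]%R)).
  apply: negligible_bigcup => m; exists (eball (0 : X) m.+1%:R `&` [set y | v y <= k / 2]%R).
  split => //; first exact: measurable_sublevel_ball.
  apply/eqP; rewrite eq_le measure_ge0 andbT leNgt.
  by apply/negP => S0; apply: nS; exists m.+1%:R.
apply: negligibleS => x /= /negP; rewrite -ltNge subr_lt0 => vk.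
exists (Num.trunc (enorm x)) => //; split => /=; last exact: ltW.
by rewrite /eball /= subr0 truncnS_gt.
Qed.

(** Once the reaction dominates the absorption at infinity, the flux through a
    fixed level is never absorbed and reaches every scale. *)
Lemma lower_bound_of_reaction (p mu : R) : 2 * s < omega -> n%:R - 2 * s < mu ->
  mu * (p - 2) < omega ->
  (forall (phi : X -> R) c (r M : R), 0 < r -> finite_energy s phi ->
    (forall x, 0 <= phi x <= M * \1_(eball c r) x) ->
    (forall x, 0 < phi x -> V x <= v x `^ (p - 2)) ->
    (0 <= gagliardo s v phi)%E) -> 2 <= p ->
  exists2 C, 0 < C & forall x, C / (1 + enorm x) `^ (n%:R - 2 * s) <= v x.
Proof.
move=> oms nmu mup reaction p2; have /andP[s0 s1] := s01.
have s2 : 0 < 2 * s by exact: mulr_gt0.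
have ns0 : 0 <= n%:R - 2 * s by rewrite subr_ge0 ltW.
have beta0 : 0 < beta := ball_volume_gt0.
have kap0 : 0 <= kappa := frac_moment_ge0 s.
have p20 : 0 <= p - 2 by rewrite subr_ge0.
(* As [mu (p - 2) < omega], the bound with exponent [mu] makes [v ^ (p - 2)]
   dominate the potential far away. *)
have [C1 C10 C1v] := lower_bound_of_fast_decay oms nmu.
have dom : 0 < omega - mu * (p - 2) by rewrite subr_gt0.
have [R0 R01 R0P] := powR_eventually_ge (D / C1 `^ (p - 2)) dom.
have R00 : 0 < R0 by exact: lt_le_trans R01.
have Vv x : R0 <= enorm x -> V x <= v x `^ (p - 2).
  move=> xR; apply: (le_trans (VD x)).
  apply: (@le_trans _ _ ((C1 / (1 + enorm x) `^ mu) `^ (p - 2))); last first.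
    apply: powR_le => //; first by rewrite divr_ge0 ?powR_ge0// ltW.
  have y0 := e1p x; have yE : ((1 + enorm x) `^ mu)^-1 `^ (p - 2) =
      ((1 + enorm x) `^ (mu * (p - 2)))^-1 by rewrite -powRN -powRrM mulNr powRN.
  rewrite powRM ?(ltW C10) ?invr_ge0 ?powR_ge0// yE.
  rewrite ler_pdivrMr ?powR_gt0// mulrAC -mulrA -powRB ?(gt_eqF y0) ?implybT//.
  rewrite mulrC -ler_pdivrMr ?powR_gt0//; apply: R0P.
  by rewrite (le_trans xR)// lerDr.
have [k k0 kv] := locally_bounded_below R00.
have [[r2 r20 S0]|vk] := level_dichotomy k; last first.
  exists (k / 2); first exact: divr_gt0.
  by move=> x; apply: le_trans (vk x); apply: div_powR_le => //; rewrite divr_ge0// ltW.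
have [Cb Cb0 spread] := barrier_ball_mass D0.
have R20 : 0 < 2 * R0 by exact: mulr_gt0.
have [k2 k20 k2v] := locally_bounded_below R20.
pose S := eball (0 : X) r2 `&` [set y | v y <= k / 2]%R.
have Soo : leb S \is a fin_num.
  rewrite ge0_fin_numE//; apply: (@le_lt_trans _ _ (leb (eball (0 : X) r2))).
    apply: le_measure; rewrite ?inE; [|exact: measurable_eball|exact: subIsetl].
    exact: measurable_sublevel_ball.
  by rewrite [ltLHS](lebesgue_eball 0 r20) ltry.
pose mS := fine (leb S).
have mS0 : 0 < mS by rewrite fine_gt0// S0 ltey_eq Soo.
pose F := k / 16 * (beta * R0 ^+ n) / (R0 + r2) `^ q * mS.
have F0 : 0 < F.
  rewrite mulr_gt0// divr_gt0 ?powR_gt0 ?addr_gt0// mulr_gt0//; first exact: divr_gt0.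
  by rewrite mulr_gt0// exprn_gt0.
have kap1 : 0 < kappa + 1 by rewrite ltr_wpDl.
(* Inside the ball of radius [R0] the level test vanishes, and outside of it the
   reaction dominates: so there is no absorption term. *)
have massF rho : 2 * R0 <= rho -> F / (2 * (kappa + 1)) * rho `^ (2 * s) <= ball_mass k rho.
  move=> Rrho; have rho0 : 0 < rho by exact: lt_le_trans Rrho.
  have rs : 0 < rho `^ (2 * s) by exact: powR_gt0.
  have Et := finite_energy_level_test s01 Ev v0 k0 rho0.
  have tb := level_test_bound v0 k0 rho0.
  have tM x : 0 <= level_test v k rho x <= 1 * \1_(eball 0 rho) x by rewrite mul1r.
  have g0 : (0 <= gagliardo s v (level_test v k rho))%E.
    apply: (reaction _ 0 rho 1) => // x t0; apply: Vv; rewrite leNgt; apply/negP => /kv vk.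
    by move: t0; rewrite /level_test above_eq0// mul0r ltxx.
  have gE : - 0 <= fine (gagliardo s v (level_test v k rho)) by rewrite oppr0 fine_ge0.
  have := flux_ball_mass_le k0 R00 Rrho r20 kv gE.
  rewrite -/S -(fineK Soo) -EFinM lee_fin addr0 -/mS -/F => H.
  have mass0 := ball_mass_ge0 k0 rho0.
  rewrite mulrAC ler_pdivrMr ?mulr_gt0// -ler_pdivlMr//.
  apply: (le_trans H); rewrite ler_pdivlMr//.
  rewrite (_ : 2 * (kappa / rho `^ (2 * s)) * _ * _ = ball_mass k rho * (2 * kappa)); last first.
    by field; rewrite gt_eqF.
  by rewrite ler_wpM2l// ler_pM2l// lerDl.
pose C2 := Cb * (F / (2 * (kappa + 1))).
have C20 : 0 < C2 by rewrite mulr_gt0// divr_gt0// mulr_gt0.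
exists (Num.min C2 k2); first by rewrite lt_min C20.
move=> x; have [xR|xR] := ltP (enorm x) (2 * R0).
  apply: le_trans (k2v x xR); apply: (@le_trans _ _ (Num.min C2 k2)).
    by apply: div_powR_le => //; rewrite le_min !ltW.
  by rewrite ge_min lexx orbT.
have x0 : 0 < enorm x by exact: lt_le_trans xR.
apply: (@le_trans _ _ (C2 / enorm x `^ (n%:R - 2 * s))).
  apply: ler_pM; rewrite ?invr_ge0 ?powR_ge0//.
  - by rewrite le_min !ltW.
  - by rewrite ge_min lexx.
  - by rewrite lef_pV2 ?posrE ?powR_gt0//; apply: powR_le; rewrite ?enorm_ge0// lerDr.
apply: le_trans (spread x k (enorm x) (enorm x / 2) k0 x0 _ _ _ _) => //.
- rewrite powRB ?(gt_eqF x0) ?implybT// powR_mulrn ?enorm_ge0// invf_div mulrA.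
  by rewrite ler_pM2r ?invr_gt0 ?exprn_gt0// -mulrA ler_pM2l//; exact: massF.
- by rewrite ler_pdivrMr// ler_peMr ?enorm_ge0// ler1n.
- move=> y yx; left; have h0 : 0 < enorm x / 2 by exact: divr_gt0.
  apply: (le_trans (VD y)); rewrite ler_wpM2l// lef_pV2 ?posrE ?powR_gt0//.
  apply: (@le_trans _ _ ((1 + enorm y) `^ (2 * s))); last by apply: ler_powR => //; exact: ltW.
  apply: powR_le; [exact: ltW|exact: ltW|].
  have : enorm x - enorm y <= enorm (x - y) by exact: enormB_le.
  by rewrite enorm_distC; move: (enorm x) (enorm y) (enorm _) yx => a b c; lra.
Qed.

End supersolution.

(** * The solution and its continuous representative *)
Section reduction.
Context {R : realType} {n : nat}.
Local Notation leb := (@lebesgue_rV R n).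
Local Notation X := ('rV[R]_n).
Implicit Types (u v phi : X -> R) (s : R).

Lemma ae_product (P : X -> Prop) : {ae leb, forall x, P x} ->
  {ae (leb \x leb)%E, forall z, P z.1 /\ P z.2}.
Proof.
move=> [N [mN N0 PN]]; exists (N `*` setT `|` setT `*` N); split.
- by apply: measurableU; apply: measurableX.
- apply/eqP; rewrite eq_le measure_ge0 andbT.
  apply: (le_trans (measureU2 _ _ _)); [exact: measurableX|exact: measurableX|].
  rewrite [X in (X + _)%E](product_measure1E leb leb mN measurableT).
  rewrite [X in (_ + X)%E](product_measure1E leb leb measurableT mN).
  have -> : (leb N * leb setT = 0)%E by rewrite [X in (X * _)%E]N0; exact: mul0e.
  have -> : (leb setT * leb N = 0)%E by rewrite [X in (_ * X)%E]N0; exact: mule0.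
  by rewrite adde0.
- move=> [x y] /= nP; apply: contrapT => nN; apply: nP; split.
    by apply: contrapT => Px; apply: nN; left; split => //; exact: PN.
  by apply: contrapT => Py; apply: nN; right; split => //; exact: PN.
Qed.

Lemma gagliardo_ae_eq s u v u' v' : 0 < s < 1 ->
  measurable_fun setT u -> measurable_fun setT v ->
  measurable_fun setT u' -> measurable_fun setT v' ->
  {ae leb, forall x, u x = u' x} -> {ae leb, forall x, v x = v' x} ->
  gagliardo s u v = gagliardo s u' v'.
Proof.
move=> s01 mu mv mu' mv' uu' vv'; rewrite !gagliardoE.
apply: ae_eq_integral => //.
- by apply/measurable_EFinP; exact: measurable_energy_density.
- by apply/measurable_EFinP; exact: measurable_energy_density.
apply: filterS2 (ae_product uu') (ae_product vv') => z [u1 u2] [v1 v2] _.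
by rewrite /energy_density u1 u2 v1 v2.
Qed.

Lemma bounded_support_Lfun (p : R) phi c r M : 0 < p -> 0 < r ->
  measurable_fun setT phi -> (forall x, 0 <= phi x <= M * \1_(eball c r) x) ->
  phi \in Lfun leb p%:E.
Proof.
move=> p0 r0 mphi phiM; rewrite inE; apply/andP; split; rewrite inE //=.
rewrite /finite_norm unlock /=; apply: poweR_lty.
have M0 : 0 <= M.
  have /andP[a b] := phiM c; move: (le_trans a b).
  by rewrite indicE mem_set ?mulr1// /eball /= subrr enorm0.
have phi0 x : 0 <= phi x by have /andP[] := phiM x.
under eq_integral => x _ do rewrite ger0_norm//.
apply: (@le_lt_trans _ _ (\int[leb]_x (M `^ p * \1_(eball c r) x)%:E)%E).
  apply: ge0_le_integral => //.
  - by move=> x _; rewrite lee_fin powR_ge0.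
  - by apply/measurable_EFinP; apply: (measurableT_comp (measurable_powR p)).
  - apply/measurable_EFinP/measurable_funM => //; apply: measurable_indic.
    exact: measurable_eball.
  - move=> x _; have /andP[p1 p2] := phiM x.
    rewrite lee_fin; apply: (le_trans (powR_le (ltW p0) p1 p2)).
    rewrite indicE; case: (x \in _); rewrite ?mulr1//.
    by rewrite !mulr0 powR0// gt_eqF.
under eq_integral do rewrite EFinM.
rewrite ge0_integralZl//; last 2 first.
- by apply/measurable_EFinP; apply: measurable_indic; exact: measurable_eball.
- by rewrite lee_fin powR_ge0.
rewrite integral_indic//; last exact: measurable_eball.
by rewrite setIT [X in (_ * X)%E](lebesgue_eball c r0) -EFinM ltry.
Qed.

End reduction.

Section solution.
Context {R : realType} {n : nat}.
Local Notation leb := (@lebesgue_rV R n).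
Local Notation X := ('rV[R]_n).
Variables (s eps p D : R) (V u v : X -> R).
Hypotheses (s01 : 0 < s < 1) (n2s : 2 * s < n%:R) (eps0 : 0 < eps).
Hypotheses (cV : continuous V) (V0 : forall x, 0 <= V x) (VD : forall x, V x <= D).
Hypothesis sol : positive_weak_solution eps s V p u.
Hypothesis rep : continuous_representative u v.

Let mV : measurable_fun setT V. Proof. exact: continuous_measurable_rV. Qed.
Let cv : continuous v. Proof. by case: rep. Qed.
Let mv : measurable_fun setT v. Proof. exact: continuous_measurable_rV. Qed.
Let vu : {ae leb, forall x, v x = u x}. Proof. by case: rep. Qed.

Lemma representative_ae_gt0 : {ae leb, forall x, 0 < v x}.
Proof. by have [_ upos] := sol; apply: filterS2 vu upos => x ->. Qed.

Lemma representative_ge0 x : 0 <= v x.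
Proof.
apply: (ae_ge0_continuous cv); apply: filterS representative_ae_gt0 => y.
exact: ltW.
Qed.

Let mu : measurable_fun setT u.
Proof.
have [[[+ _] _] _] := sol; rewrite inE => /andP[+ _].
by rewrite inE.
Qed.

Let Vu2_ge0 : (0 <= \int[leb]_x (V x * u x ^+ 2)%:E)%E.
Proof. by apply: integral_ge0 => x _; rewrite lee_fin mulr_ge0// sqr_ge0. Qed.

Let gagliardo_uu_ge0 : (0 <= gagliardo s u u)%E.
Proof.
by rewrite gagliardoE; apply: integral_ge0 => z _; rewrite lee_fin energy_density_ge0.
Qed.

Lemma representative_finite_energy : finite_energy s v.
Proof.
split=> //; rewrite (gagliardo_ae_eq s01 mv mv mu mu vu vu).
have [[[_ +] _] _] := sol; apply: le_lt_trans.
exact: leeDl.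
Qed.

Let Vu2_lty : (\int[leb]_x (V x * u x ^+ 2)%:E < +oo)%E.
Proof.
have [[[_ +] _] _] := sol; apply: le_lt_trans.
exact: leeDr.
Qed.

Section test.
Variables (phi : X -> R) (c : X) (r M : R).
Hypotheses (r0 : 0 < r) (Ephi : finite_energy s phi).
Hypothesis phiM : forall x, 0 <= phi x <= M * \1_(eball c r) x.

Let mphi : measurable_fun setT phi. Proof. by case: Ephi. Qed.
Let phi0 x : 0 <= phi x. Proof. by have /andP[] := phiM x. Qed.

Let Vphi2_lty : (\int[leb]_x (V x * phi x ^+ 2)%:E < +oo)%E.
Proof.
have mi : measurable_fun setT (\1_(eball c r) : X -> R).
  by apply: measurable_indic; exact: measurable_eball.
have DM0 : 0 <= D * M ^+ 2 by rewrite mulr_ge0 ?sqr_ge0// (le_trans (V0 c)).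
apply: (@le_lt_trans _ _ (\int[leb]_x ((D * M ^+ 2)%:E * (\1_(eball c r) x)%:E))%E).
  apply: ge0_le_integral => //.
  - by move=> x _; rewrite lee_fin mulr_ge0// sqr_ge0.
  - by apply/measurable_EFinP/measurable_funM => //; exact: measurable_funX.
  - by apply: measurable_funeM; exact/measurable_EFinP.
  - move=> x _; rewrite -EFinM lee_fin -mulrA.
    apply: ler_pM => //; first exact: sqr_ge0.
    have /andP[p0 p1] := phiM x; move: p1; rewrite indicE; case: (x \in _) => p1.
      move: p1; rewrite !mulr1 => p1.
      by rewrite ler_pXn2r// nnegrE// (le_trans p0).
    move: p1; rewrite !mulr0 => p1; have -> : phi x = 0 by apply/eqP; rewrite eq_le p1.
    by rewrite expr0n.
rewrite ge0_integralZl//; last exact/measurable_EFinP.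
rewrite integral_indic//; last exact: measurable_eball.
by rewrite setIT [X in (_ * X)%E](lebesgue_eball c r0) -EFinM ltry.
Qed.

(** Admissibility of the test functions of the previous sections rests on the
    boundedness of [V]. *)
Lemma test_HsV : HsV s V phi.
Proof.
split; last by rewrite lte_add_pinfty//; case: Ephi.
apply: (bounded_support_Lfun _ r0 mphi phiM).
have /andP[s0 _] := s01; rewrite divr_gt0 ?subr_gt0// mulr_gt0//.
by rewrite (lt_trans _ n2s)// mulr_gt0.
Qed.

Let I_ge0 : (0 <= \int[leb]_x (V x * v x * phi x)%:E)%E.
Proof.
apply: integral_ge0 => x _; rewrite lee_fin; apply: mulr_ge0 => //.
by apply: mulr_ge0 => //; exact: representative_ge0.
Qed.

Let int_Vuphi : (\int[leb]_x (V x * u x * phi x)%:E = \int[leb]_x (V x * v x * phi x)%:E)%E.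
Proof.
apply: ae_eq_integral => //.
- by apply/measurable_EFinP; apply: measurable_funM => //; exact: measurable_funM.
- by apply/measurable_EFinP; apply: measurable_funM => //; exact: measurable_funM.
by apply: filterS vu => x -> _.
Qed.

Let int_Vvphi_lty : (\int[leb]_x (V x * v x * phi x)%:E < +oo)%E.
Proof.
rewrite -int_Vuphi.
have m2 (w : X -> R) : measurable_fun setT w ->
    measurable_fun setT (fun x => (V x * w x ^+ 2)%:E).
  by move=> mw; apply/measurable_EFinP/measurable_funM => //; exact: measurable_funX.
have p2 (w : X -> R) x : (0 <= (V x * w x ^+ 2)%:E)%E.
  by rewrite lee_fin mulr_ge0// sqr_ge0.
rewrite int_Vuphi.
apply: le_lt_trans (lte_add_pinfty Vu2_lty Vphi2_lty).
have -> : (\int[leb]_x (V x * u x ^+ 2)%:E = \int[leb]_x (V x * v x ^+ 2)%:E)%E.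
  by apply: ae_eq_integral => //; [exact: m2|exact: m2|apply: filterS vu => x -> _].
rewrite -ge0_integralD//; last 2 first.
- exact: m2.
- exact: m2.
apply: ge0_le_integral => //.
- move=> x _; rewrite lee_fin; apply: mulr_ge0 => //.
  by apply: mulr_ge0 => //; exact: representative_ge0.
- by apply/measurable_EFinP; apply: measurable_funM => //; exact: measurable_funM.
- by apply: emeasurable_funD; exact: m2.
move=> x _; rewrite -EFinD lee_fin -mulrDr -mulrA ler_wpM2l//.
move: (v x) (phi x) => a b.
by have := sqr_ge0 (a - b); have := sqr_ge0 a; have := sqr_ge0 b; nra.
Qed.

Let equation : ((eps `^ (2 * s))%:E * gagliardo s v phi + \int[leb]_x (V x * v x * phi x)%:E =
  \int[leb]_x (`|v x| `^ (p - 2) * v x * phi x)%:E)%E.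
Proof.
have mphi' := mphi.
rewrite (gagliardo_ae_eq s01 mv mphi mu mphi vu); last by apply: filterS vu.
have [[_ /(_ phi test_HsV) eq_phi] _] := sol; rewrite -int_Vuphi eq_phi.
have mpow (w : X -> R) : measurable_fun setT w ->
    measurable_fun setT (fun x => `|w x| `^ (p - 2) * w x * phi x).
  move=> mw; apply: measurable_funM => //; apply: measurable_funM => //.
  apply: (measurableT_comp (measurable_powR (p - 2))).
  exact: measurableT_comp.
apply: ae_eq_integral => //.
- by apply/measurable_EFinP; exact: mpow.
- by apply/measurable_EFinP; exact: mpow.
by apply: filterS vu => x -> _.
Qed.

Let e_gt0 : 0 < eps `^ (2 * s). Proof. exact: powR_gt0. Qed.

Lemma test_super :
  (0 <= (eps `^ (2 * s))%:E * gagliardo s v phi + \int[leb]_x (V x * v x * phi x)%:E)%E.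
Proof.
rewrite equation; apply: integral_ge0 => x _; rewrite lee_fin.
apply: mulr_ge0 => //; apply: mulr_ge0; first exact: powR_ge0.
exact: representative_ge0.
Qed.

Lemma test_reaction : (forall x, 0 < phi x -> V x <= v x `^ (p - 2)) ->
  (0 <= gagliardo s v phi)%E.
Proof.
move=> Vv.
have le_int : (\int[leb]_x (V x * v x * phi x)%:E <=
    \int[leb]_x (`|v x| `^ (p - 2) * v x * phi x)%:E)%E.
  apply: ge0_le_integral => //.
  - move=> x _; rewrite lee_fin; apply: mulr_ge0 => //.
    by apply: mulr_ge0 => //; exact: representative_ge0.
  - by apply/measurable_EFinP; apply: measurable_funM => //; exact: measurable_funM.
  - apply/measurable_EFinP; apply: measurable_funM => //; apply: measurable_funM => //.
    apply: (measurableT_comp (measurable_powR (p - 2))).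
    exact: measurableT_comp.
  - move=> x _; rewrite lee_fin; have := phi0 x; rewrite le_eqVlt => /predU1P[<-|px].
      by rewrite !mulr0.
    have vx := representative_ge0 x.
    by rewrite ler_wpM2r// ler_wpM2r// ger0_norm// Vv.
move: le_int; rewrite -equation -(fineK (gagliardo_fin_num representative_finite_energy Ephi)).
have I_fin : (\int[leb]_x (V x * v x * phi x)%:E)%E \is a fin_num by rewrite ge0_fin_numE.
rewrite -(fineK I_fin) -EFinM -EFinD !lee_fin lerDr.
by rewrite pmulr_rge0.
Qed.

End test.
End solution.

(** * Decay estimates *)
Section final_estimates.
Context {R : realType} {n : nat}.

Lemma powR_1D_le (t a : R) : 0 <= t -> 0 <= a -> (1 + t) `^ a <= 2 `^ a * (1 + t `^ a).
Proof.
move=> t0 a0; have [t1|t1] := leP t 1.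
  apply: (@le_trans _ _ (2 `^ a)); first by apply: powR_le => //; lra.
  by rewrite ler_peMr ?powR_ge0// lerDl powR_ge0.
apply: (@le_trans _ _ ((2 * t) `^ a)); first by apply: powR_le => //; lra.
by rewrite powRM// ler_wpM2l ?powR_ge0// lerDr.
Qed.

Lemma lower_bound_weight (v : 'rV[R]_n -> R) (a : R) : 0 <= a ->
  (exists2 C, 0 < C & forall x, C / (1 + enorm x) `^ a <= v x) ->
  exists C : R, 0 < C /\ forall x, C / (1 + enorm x `^ a) <= v x.
Proof.
move=> a0 [C C0 Cv]; exists (C / 2 `^ a); split; first by rewrite divr_gt0 ?powR_gt0.
move=> x; apply: le_trans (Cv x).
have w0 : 0 < 1 + enorm x `^ a by rewrite ltr_pwDl// powR_ge0.
rewrite -mulrA -invfM ler_pM2l// lef_pV2 ?posrE ?mulr_gt0 ?powR_gt0//.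
  by apply: powR_1D_le => //; exact: enorm_ge0.
by rewrite ltr_pwDl// enorm_ge0.
Qed.

Lemma potential_weight (V : 'rV[R]_n -> R) (omega : R) : 0 <= omega ->
  (forall x, 0 <= V x) ->
  has_ubound (range (fun x => (1 + enorm x `^ omega) * V x)) ->
  exists2 D, 0 <= D & forall x, V x <= D / (1 + enorm x) `^ omega.
Proof.
move=> om0 V0 [M MV].
have HM x : (1 + enorm x `^ omega) * V x <= M by apply: MV; exists x.
have w0 x : 0 < 1 + enorm x `^ omega by rewrite ltr_pwDl// powR_ge0.
have M0 : 0 <= M by rewrite (le_trans _ (HM 0))// mulr_ge0// ltW.
exists (2 `^ omega * M); first by rewrite mulr_ge0 ?powR_ge0.
move=> x; rewrite ler_pdivlMr; last by rewrite powR_gt0// ltr_pwDl// enorm_ge0.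
rewrite mulrC (le_trans (ler_wpM2r (V0 x) (powR_1D_le (enorm_ge0 x) om0)))//.
by rewrite -mulrA ler_wpM2l ?powR_ge0.
Qed.

End final_estimates.

Theorem theorem1p5 (R : realType) (N : nat) (s omega p eps : R)
    (V u v : 'rV[R]_N -> R) :
  (1 <= N)%N -> 0 < s < 1 -> 2 * s < N%:R ->
  continuous V -> (forall x, 0 <= V x) ->
  0 <= omega ->
  has_ubound (range (fun x => (1 + enorm x `^ omega) * V x)) ->
  p_star N s omega < p < crit_exp N s ->
  0 < eps ->
  positive_weak_solution eps s V p u ->
  continuous_representative u v ->
  [/\ (N%:R - 2 * s) * (p - 2) < omega -> 2 * s < (N%:R - 2 * s) * (p - 2) ->
        exists C : R, 0 < C /\
          forall x, C / (1 + enorm x `^ (N%:R - 2 * s)) <= v x,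
      2 * s < omega <= (N%:R - 2 * s) * (p - 2) ->
        forall mu : R, N%:R - 2 * s < mu ->
          exists C : R, 0 < C /\
            forall x, C / (1 + enorm x `^ mu) <= v x
    & 0 <= omega <= 2 * s ->
        exists C : R, 0 < C /\
          forall x, C / (1 + enorm x `^ (N%:R + 2 * s - omega)) <= v x].
Proof.
move=> _ s01 N2s cV V0 om0 Vub _ eps0 sol rep; have /andP[s0 s1] := s01.
have s2 : 0 < 2 * s by exact: mulr_gt0.
have N2s0 : 0 < N%:R - 2 * s by rewrite subr_gt0.
have e0 : 0 < eps `^ (2 * s) by exact: powR_gt0.
have mV := continuous_measurable_rV cV.
have [D D0 VD] := potential_weight om0 V0 Vub.
have VD0 x : V x <= D by rewrite (le_trans (VD x))// div_powR_le.
have [cv _] := rep.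
have v0 := representative_ge0 sol rep.
have vpos := representative_ae_gt0 sol rep.
have Ev := representative_finite_energy s01 V0 sol rep.
have super : weak_supersolution s (eps `^ (2 * s)) V v.
  by move=> phi c r M r0 Ephi phiM; exact: (test_super s01 N2s cV V0 VD0 sol rep r0 Ephi phiM).
split.
- move=> Npom sNp; have oms := lt_trans sNp Npom.
  have p20 : 0 < p - 2 by rewrite -(pmulr_rgt0 _ N2s0) (lt_trans _ sNp).
  (* Any exponent strictly between [N - 2 s] and [omega / (p - 2)] will do. *)
  pose mu := (N%:R - 2 * s + omega / (p - 2)) / 2.
  have Nom : N%:R - 2 * s < omega / (p - 2) by rewrite ltr_pdivlMr.
  apply: lower_bound_weight; first exact: ltW.
  apply: (lower_bound_of_reaction s01 e0 mV V0 Ev cv v0 super N2s om0 D0 VD vpos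
    (p := p) (mu := mu) oms).
  + by rewrite /mu; lra.
  + by rewrite -ltr_pdivlMr// /mu; lra.
  + by move=> phi c r M r0 Ephi phiM; exact: (test_reaction s01 N2s eps0 cV V0 VD0 sol rep r0 Ephi phiM).
  + by rewrite -subr_ge0 ltW.
- move=> /andP[oms _] mu Nmu; apply: lower_bound_weight; first by rewrite ltW// (lt_trans N2s0).
  exact: (lower_bound_of_fast_decay s01 e0 mV V0 Ev cv v0 super N2s om0 D0 VD vpos oms Nmu).
- move=> /andP[_ oms]; apply: lower_bound_weight.
    by rewrite -addrA addr_ge0// subr_ge0.
  exact: (lower_bound_of_slow_decay s01 e0 mV V0 Ev cv v0 super om0 oms D0 VD
    (unit_ball_mass_gt0 Ev v0 vpos) (ball_mass_le_integral Ev v0 ltr01 ltr01)).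
Qed.
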